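(* Let $F:S^1\to\mathbb{C}$ be of bounded variation, and let $d\in\mathbb{N}$ be given. Then $$\frac{1}{N^d}\,\mathbb{E}_\Theta\bigl[(\operatorname{Tr}(F)(\sigma))^d\bigr]=\left(\int_{S^1}F(\varphi)\,d\varphi\right)^d+O\left(\frac{\mathbb{E}_\Theta[T(\sigma)]}{N}\right),$$ where $T(\sigma)$ is the total number of cycles of $\sigma\in\mathfrak{S}_N$ and $d\varphi$ is the uniform (probability) measure on $S^1$. Moreover, if $g_\Theta\in\mathcal{F}(r,\vartheta,K)$ or $g_\Theta\in e\mathcal{F}(r,\vartheta,\gamma)$, then $\mathbb{E}_\Theta[T(\sigma)]\sim\vartheta\log(N)$, and thus we have a quick convergence of the moments.
   Context: $\mathfrak{S}_N$ is the symmetric group on $N$ objects, identified with the group of $N\times N$ permutation matrices via $\sigma\mapsto(\delta_{i,\sigma(j)})_{1\le i,j\le N}$; $C_k(\sigma)$ is the number of cycles of $\sigma$ of length $k$. Let $\Theta=(\theta_k)_{k\ge1}$ be a sequence of strictly positive reals. The generalized Ewens measure on $\mathfrak{S}_N$ is $\mathbb{P}_\Theta[\sigma]=\frac{1}{h_N N!}\prod_{k=1}^N\theta_k^{C_k(\sigma)}$, with $h_N$ the normalization constant; $\mathbb{E}_\Theta$ is its expectation. Put $g_\Theta(t)=\sum_{k\ge1}\frac{\theta_k}{k}t^k$. For a function $F:S^1\to\mathbb{C}$ on the unit circle, $\operatorname{Tr}(F)(\sigma):=\sum_{k=1}^NF(\omega_k)$ where $\omega_1,\dots,\omega_N$ are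 the eigenvalues (with multiplicity) of the permutation matrix of $\sigma$. The constant in $O(\cdot)$ may depend on $F$ and $d$; asymptotics are as $N\to\infty$. For $R>r>0$ and $0<\phi<\pi/2$ let $\Delta_0(r,R,\phi)=\{z\in\mathbb{C}: |z|<R,\ z\ne r,\ |\arg(z-r)|>\phi\}$. For $r>0$, $\vartheta\ge0$ and a complex constant $K$, a function $g$ is in $\mathcal{F}(r,\vartheta,K)$ if there exist $R>r$ and $0<\phi<\pi/2$ such that $g$ is holomorphic in $\Delta_0(r,R,\phi)$ and $g(t)=\vartheta\log\left(\frac{1}{1-t/r}\right)+K+O(t-r)$ as $t\to r$ with $t\in\Delta_0(r,R,\phi)$. For $r>0$, $\vartheta\ge0$ and $0<\gamma\le1$, a function $g$ is in $e\mathcal{F}(r,\vartheta,\gamma)$ if $g$ is holomorphic in $|t|<r$ and $g(t)=\vartheta\log\left(\frac{1}{1-t/r}\right)+g_0(t)$ where the Taylor coefficients of $g_0$ at $0$ satisfy $[t^N][g_0]=O(r^{-N}N^{-1-\gamma})$ as $N\to\infty$.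
   Formalization: The ''Moreover'' part is stated for ϑ > 0 only: for ϑ = 0 the claim E[T] ~ ϑ log N would read E[T] ~ 0, which is false since T ≥ 1 (e.g. θ_k = 1/(k−1)!, where g_Θ(t) = e^t − 1 lies in F(r, 0, e^r − 1)). *)

(* Defs.v *)
From HB Require Import structures.
From mathcomp Require Export all_boot all_order all_algebra all_fingroup.
From mathcomp Require Export complex.
From mathcomp Require Export all_classical all_reals all_analysis.
Import Order.TTheory GRing.Theory Num.Theory.
Export numFieldNormedType.Exports.

Set Implicit Arguments.
Unset Strict Implicit.
Unset Printing Implicit Defensive.

Local Open Scope classical_set_scope.
Local Open Scope complex_scope.
Local Open Scope ring_scope.

(** * Permutations and their eigenvalues *)

(* [perm_mx] of the library is the transpose of this matrix. *)
Definition permutation_matrix (K : pzRingType) (N : nat) (s : 'S_N) : 'M[K]_N :=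
  \matrix_(i < N, j < N) (i == s j)%:R.

(* The roots of the characteristic polynomial, repeated according to
   multiplicity; the order of the list is arbitrary. *)
Definition eigenvalues (K : closedFieldType) (N : nat) (A : 'M[K]_N) : seq K :=
  sval (closed_field_poly_normal (char_poly A)).

(* The eigenvalues of a permutation matrix have modulus 1, so [Tr F] depends
   only on the restriction of [F] to the unit circle. *)
Definition Tr (R : realType) (F : R[i] -> R[i]) (N : nat) (s : 'S_N) : R[i] :=
  \sum_(w <- eigenvalues (permutation_matrix R[i] s)) F w.

Definition cycle_count (N : nat) (s : 'S_N) (k : nat) : nat :=
  #|[set c in porbits s | #|c| == k]|.

Definition total_cycles (N : nat) (s : 'S_N) : nat := #|porbits s|.

(** * The generalized Ewens measure *)

(* Only the values [theta k] with [1 <= k] are used. *)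
Definition cycle_weight (R : realType) (theta : nat -> R) (N : nat) (s : 'S_N) : R :=
  \prod_(1 <= k < N.+1) theta k ^+ cycle_count s k.

Definition ewens_norm (R : realType) (theta : nat -> R) (N : nat) : R :=
  (N`!%:R)^-1 * \sum_(s : 'S_N) cycle_weight theta s.

Definition ewens_prob (R : realType) (theta : nat -> R) (N : nat) (s : 'S_N) : R :=
  (ewens_norm theta N * N`!%:R)^-1 * cycle_weight theta s.

Definition ewens_expectation (R : realType) (theta : nat -> R) (N : nat)
    (X : 'S_N -> R) : R :=
  \sum_(s : 'S_N) ewens_prob theta s * X s.

Definition ewens_expectationC (R : realType) (theta : nat -> R) (N : nat)
    (X : 'S_N -> R[i]) : R[i] :=
  \sum_(s : 'S_N) (ewens_prob theta s)%:C * X s.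

Definition expected_cycles (R : realType) (theta : nat -> R) (N : nat) : R :=
  ewens_expectation theta (fun s : 'S_N => (total_cycles s)%:R).

Definition trace_moment (R : realType) (theta : nat -> R) (F : R[i] -> R[i])
    (d N : nat) : R[i] :=
  ewens_expectationC theta (fun s : 'S_N => Tr F s ^+ d).

(** * Functions on the unit circle *)

Definition circle_point (R : realType) (x : R) : R[i] :=
  cos (2 * pi * x) +i* sin (2 * pi * x).

(* [variation] and [bounded_variation] of the library are restricted to
   real-valued functions.  A partition of [0, 1] read on the circle starts and
   ends at the point 1, so this is the variation around the whole circle. *)
Definition circle_variation (R : realType) (F : R[i] -> R[i]) (s : seq R) : R :=
  \sum_(xy <- zip (0 :: s) s)
    complex.Re `|F (circle_point xy.2) - F (circle_point xy.1)|.

Definition circle_bounded_variation (R : realType) (F : R[i] -> R[i]) : Prop :=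
  has_ubound [set circle_variation F s | s in itv_partition 0 1].

(* The integral against the push-forward of Lebesgue measure on [0, 1], i.e.
   the uniform probability measure on the circle. *)
Definition circle_integral (R : realType) (F : R[i] -> R[i]) : R[i] :=
  (\int[lebesgue_measure]_(x in `[0, 1]) complex.Re (F (circle_point x)))%R +i*
  (\int[lebesgue_measure]_(x in `[0, 1]) complex.Im (F (circle_point x)))%R.

(** * The function classes F(r, vt, K) and eF(r, vt, gamma)
    The ranges of [r], [vt] and [gamma] are imposed where the classes are used. *)

(* Principal determinations: the argument is in ]-pi, pi]. *)
Definition carg (R : realType) (z : R[i]) : R :=
  let a := acos (complex.Re z / complex.Re `|z|) in
  if 0 <= complex.Im z then a else - a.

Definition clog (R : realType) (z : R[i]) : R[i] :=
  ln (complex.Re `|z|) +i* carg z.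

Definition holomorphic_on (R : realType) (D : set R[i]) (g : R[i] -> R[i]) : Prop :=
  forall z, D z -> derivable (g : R[i]^o -> R[i]^o) z 1.

Definition has_taylor_coefs (R : realType) (g : R[i] -> R[i]) (a : nat -> R[i]) : Prop :=
  \forall t \near (0 : R[i]^o),
    (fun n => \sum_(0 <= k < n) a k * t ^+ k : R[i]^o) @ \oo --> (g t : R[i]^o).

(* [g] is a determination of g_Theta, the sum of theta_k / k * t ^ k over
   1 <= k (the coefficient of index 0 is theta_0 / 0 = 0): by analytic
   continuation, its germ at 0 determines it on the connected domains below. *)
Definition is_g_Theta (R : realType) (theta : nat -> R) (g : R[i] -> R[i]) : Prop :=
  has_taylor_coefs g (fun k => (theta k / k%:R)%:C).

Definition Delta0 (R : realType) (r rho phi : R) : set R[i] :=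
  [set z | [/\ `|z| < rho%:C, z != r%:C & phi < `|carg (z - r%:C)|]].

Definition log_singularity (R : realType) (r vt : R) (t : R[i]) : R[i] :=
  vt%:C * clog (1 / (1 - t / r%:C)).

Definition class_F (R : realType) (r vt : R) (K : R[i]) (g : R[i] -> R[i]) : Prop :=
  exists rho phi : R,
    [/\ r < rho, 0 < phi < pi / 2,
        holomorphic_on (Delta0 r rho phi) g &
        exists C : R, \forall t \near (r%:C : R[i]^o), Delta0 r rho phi t ->
          `|g t - (log_singularity r vt t + K)| <= C%:C * `|t - r%:C|].

Definition class_eF (R : realType) (r vt gamma : R) (g : R[i] -> R[i]) : Prop :=
  holomorphic_on [set t | `|t| < r%:C] g /\
  exists (g0 : R[i] -> R[i]) (a : nat -> R[i]),
    [/\ forall t, `|t| < r%:C -> g t = log_singularity r vt t + g0 t,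
        has_taylor_coefs g0 a &
        exists C : R, \forall N \near \oo,
          `|a N| <= (C * (r ^- N * N%:R `^ (- 1 - gamma)))%:C].

(* Main.v *)
Require Import Defs.
From mathcomp Require Import ring lra zify measurable_realfun.
Import Order.TTheory GRing.Theory Num.Theory.
Import ComplexField.Normc.

(** Both halves rest on the cycle decomposition of a permutation.

    The moments.  A cycle of length m carries the eigenvalues exp(2 i pi j / m),
    0 <= j < m, so [Tr F] is a sum over the cycles of Riemann sums of [F] with m
    equidistributed nodes ([trace_porbits]).  For a monotone function such a sum
    differs from m times the integral by at most the increment of the function,
    whatever m is; a function of bounded variation is a difference of monotone
    ones ([circle_riemann]).  Each cycle therefore costs a bounded error, that
    is |Tr F - N I| <= V T with I the integral of [F] and T the number of cycles
    ([trace_deviation]).  As [x ^+ d] is Lipschitz on bounded sets, taking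
    expectations gives the first half, with a constant which does not depend on
    the weights ([trace_moment_deviation]).

    The number of cycles.  Let h_n be the normalization constants, H(t) the sum
    of the h_n t^n and g the sum of the theta_k / k t^k.  The identity
    H = exp(g) and the fact that the coefficients of g H are h_n E[T] turn into
    the two recursions
      n h_n = sum_(j < n) theta_(n - j) h_j               ([ewens_norm_rec])
      h_n E[T] = sum_(j < n) theta_(n - j) / (n - j) h_j  ([expected_cyclesE]),
    which are proved combinatorially, by removing the points of a marked cycle
    one by one ([marked_sum_rec]).  Suppose that theta_k r^k tends to vt.  After
    rescaling by r^n, the first recursion forces h_(n - k) / h_n to be close to
    1 uniformly for k <= dl n with dl small ([renewal_regular]); in the second
    one the terms with k = n - j > dl n contribute O(1), so that E[T] is
    equivalent to the sum of the theta_k r^k / k for k <= n, hence to vt ln n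
    ([renewal_expected_cycles]).

    The weights.  What remains is that both classes of singularities force
    theta_k r^k to tend to vt, that is, that the Taylor coefficients of
    g - vt log (1 / (1 - t / r)) are o(r^-n / n).  For the class eF this is the
    hypothesis, up to the uniqueness of Taylor coefficients ([class_eF_theta]).
    For the class F it is a weak form of the transfer theorem of singularity
    analysis ([coefficient_littleo]): a function that vanishes to first order
    at r and is holomorphic in a domain which extends beyond the circle |t| = r
    except for a cone at r has coefficients o(r^-n / n).  Only o is needed where
    the transfer theorem gives O(r^-n / n^2), so each piece of the contour may
    be bounded by its length times a supremum.  In the coordinate w given by
    t = r exp(w), circles are vertical segments and the contour is made of sides
    of rectangles, so Cauchy's theorem is only needed for rectangles
    ([goursat_rect]). *)

Set Implicit Arguments.
Unset Strict Implicit.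
Unset Printing Implicit Defensive.
Local Open Scope classical_set_scope.
Local Open Scope complex_scope.
Local Open Scope ring_scope.

(** * Complex modulus and complex derivatives *)

Section ComplexBasics.
Variable R : realType.
Implicit Types (z w h l : R[i]) (x y a b c e : R).

Lemma cabsE z : `|z| = (normc z)%:C. Proof. by []. Qed.

Lemma normc_ge0 z : 0 <= normc z.
Proof. by case: z => x y; exact: sqrtr_ge0. Qed.

Lemma normc0 : normc (0 : R[i]) = 0.
Proof. by apply: complexI; rewrite -cabsE normr0. Qed.

Lemma normc_eq0 z : (normc z == 0) = (z == 0).
Proof. by apply/eqP/eqP => [/eq0_normc//|->]; exact: normc0. Qed.

Lemma normc_gt0 z : (0 < normc z) = (z != 0).
Proof. by rewrite lt_def normc_ge0 andbT normc_eq0. Qed.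

Lemma normcD z w : normc (z + w) <= normc z + normc w.
Proof. exact: le_normcD. Qed.

Lemma normcBC z w : normc (z - w) = normc (w - z).
Proof. by rewrite -normcN opprB. Qed.

Lemma normcB z w : normc (z - w) <= normc z + normc w.
Proof. by rewrite -(normcN w) normcD. Qed.

Lemma normcB_ge z w : normc z - normc w <= normc (z - w).
Proof. by rewrite lerBlDr (le_trans _ (normcD _ _))// subrK. Qed.

Lemma normcX z n : normc (z ^+ n) = normc z ^+ n.
Proof. by elim: n => [|n IH]; rewrite ?normc1// !exprS normcM IH. Qed.

Lemma normcR x : normc x%:C = `|x|.
Proof. by rewrite /= expr0n addr0 sqrtr_sqr. Qed.

Lemma normc_real z : 0 <= z -> z = (normc z)%:C.
Proof. by move=> z0; rewrite -cabsE ger0_norm. Qed.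

Lemma normc_sum (I : Type) (s : seq I) (P : pred I) (F : I -> R[i]) :
  normc (\sum_(i <- s | P i) F i) <= \sum_(i <- s | P i) normc (F i).
Proof.
elim/big_ind2 : _ => [|z1 x1 z2 x2 h1 h2|//]; first by rewrite normc0.
by rewrite (le_trans (normcD _ _))// lerD.
Qed.

Lemma ReD z w : complex.Re (z + w) = complex.Re z + complex.Re w.
Proof. by case: z w => ? ? []. Qed.
Lemma ImD z w : complex.Im (z + w) = complex.Im z + complex.Im w.
Proof. by case: z w => ? ? []. Qed.
Lemma ReN z : complex.Re (- z) = - complex.Re z.
Proof. by case: z. Qed.
Lemma ImN z : complex.Im (- z) = - complex.Im z.
Proof. by case: z. Qed.
Lemma ReM z w : complex.Re (z * w) =
  complex.Re z * complex.Re w - complex.Im z * complex.Im w.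
Proof. by case: z w => ? ? []. Qed.
Lemma ImM z w : complex.Im (z * w) =
  complex.Re z * complex.Im w + complex.Im z * complex.Re w.
Proof. by case: z w => ? ? []. Qed.

Lemma normc_ge_absRe z : `|complex.Re z| <= normc z.
Proof.
case: z => x y /=; rewrite -(sqrtr_sqr x) ler_sqrt ?addr_ge0 ?sqr_ge0//.
by rewrite lerDl sqr_ge0.
Qed.

Lemma normc_ge_absIm z : `|complex.Im z| <= normc z.
Proof.
case: z => x y /=; rewrite -(sqrtr_sqr y) ler_sqrt ?addr_ge0 ?sqr_ge0//.
by rewrite lerDr sqr_ge0.
Qed.

Lemma normc_le_ReIm z : normc z <= `|complex.Re z| + `|complex.Im z|.
Proof.
have {1}-> : z = (complex.Re z)%:C + 'i * (complex.Im z)%:C by rewrite -complexE.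
rewrite (le_trans (normcD _ _))// lerD ?normcR// normcM normcR.
by rewrite /= expr0n expr1n add0r sqrtr1 mul1r.
Qed.

Lemma normc_eq_sqrt x y : normc (x +i* y) = Num.sqrt (x ^+ 2 + y ^+ 2).
Proof. by []. Qed.

Lemma nearcP z (P : set R[i]) : (\forall t \near (z : R[i]^o), P t) <->
  exists2 d : R, 0 < d & forall h, normc h < d -> P (z + h).
Proof.
split.
  move=> /nbhs_ballP[d /= d0 Pd].
  have dE : d = (normc d)%:C by apply: normc_real; rewrite ltW.
  exists (normc d); first by rewrite normc_gt0 gt_eqF.
  move=> h hd; apply: Pd; rewrite /ball /= /ball_ /= opprD addNKr normrN.
  by rewrite cabsE dE ltcR.
move=> [d d0 Pd]; apply/nbhs_ballP; exists d%:C; first by rewrite /= ltcR.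
move=> t; rewrite /ball /= /ball_ /= cabsE ltcR normcBC => td.
by rewrite -(subrK z t) addrC; exact: Pd.
Qed.

(** The first-order expansion with an explicit radius: unlike the limit of
    difference quotients it needs no division, so that sums, products and
    compositions are estimated directly. *)
Definition has_cderiv (f : R[i] -> R[i]) z l := forall e, 0 < e ->
  exists2 d, 0 < d &
    forall h, normc h < d -> normc (f (z + h) - f z - l * h) <= e * normc h.

Lemma holomorphic_onP (D : set R[i]) f : holomorphic_on D f ->
  forall z, D z -> exists l, has_cderiv f z l.
Proof.
move=> fD z /fD /= df; exists ('D_1 (f : R[i]^o -> R[i]^o) z) => e e0.
have /cvg_ex[/= l dl] := df.
have -> : 'D_1 (f : R[i]^o -> R[i]^o) z = l by apply: cvg_lim.
move/cvgrPdist_le : dl => /(_ e%:C); rewrite ltcR => /(_ e0).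
rewrite near_withinE => /nearcP[d d0 H].
exists d => // h hd; have := H _ hd; rewrite add0r => {}H.
have [->|h0] := eqVneq h 0.
  by rewrite addr0 subrr mulr0 subr0 normc0 mulr0.
have {}H := H h0.
move: H; rewrite cabsE lecR => H.
have -> : f (z + h) - f z - l * h = - h * (l - h^-1 * (f (z + h) - f z)).
  by field.
rewrite normcM normcN mulrC ler_wpM2r ?normc_ge0//.
by move: H; rewrite /GRing.scale /= mulr1 (addrC h z).
Qed.

Lemma cderiv_cont f z l : has_cderiv f z l -> forall e, 0 < e ->
  exists2 d, 0 < d & forall h, normc h < d -> normc (f (z + h) - f z) <= e.
Proof.
move=> /(_ 1 ltr01)[d d0 H] e e0.
have l1 : 0 < 1 + normc l by rewrite ltr_pwDl// normc_ge0.
exists (Num.min d (e / (1 + normc l))); first by rewrite lt_min d0 divr_gt0.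
move=> h; rewrite lt_min => /andP[/H {}H hd].
rewrite -(subrK (l * h) (f (z + h) - f z)) (le_trans (normcD _ _))//.
rewrite normcM; apply: (@le_trans _ _ ((1 + normc l) * normc h)).
  by rewrite mulrDl lerD.
by move: hd; rewrite ltr_pdivlMr// mulrC => /ltW.
Qed.

Lemma cderiv_cst (c : R[i]) z : has_cderiv (fun=> c) z 0.
Proof.
move=> e e0; exists 1 => // h _.
by rewrite subrr mul0r subr0 normc0 mulr_ge0 ?normc_ge0// ltW.
Qed.

Lemma cderivD f g z l m : has_cderiv f z l -> has_cderiv g z m ->
  has_cderiv (fun t => f t + g t) z (l + m).
Proof.
move=> df dg e e0; have e2 : 0 < e / 2 by rewrite divr_gt0.
have [d1 d10 h1] := df _ e2; have [d2 d20 h2] := dg _ e2.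
exists (Num.min d1 d2); first by rewrite lt_min d10.
move=> h; rewrite lt_min => /andP[/h1{}h1 /h2{}h2].
have -> : f (z + h) + g (z + h) - (f z + g z) - (l + m) * h =
  (f (z + h) - f z - l * h) + (g (z + h) - g z - m * h) by ring.
rewrite (le_trans (normcD _ _))// (le_trans (lerD h1 h2))//.
by rewrite -mulrDl -splitr.
Qed.

Lemma cderivM f g z l m : has_cderiv f z l -> has_cderiv g z m ->
  has_cderiv (fun t => f t * g t) z (l * g z + f z * m).
Proof.
move=> df dg e e0.
pose A := 1 + normc (f z) + normc (g z) + normc m.
have A0 : 0 < A by rewrite !ltr_pwDl ?normc_ge0.
have e2 : 0 < e / 2 by rewrite divr_gt0.
have eA : 0 < e / (3 * A) by rewrite divr_gt0// mulr_gt0.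
pose e' := Num.min 1 (e / (3 * A)).
have e'0 : 0 < e' by rewrite lt_min ltr01.
have e'1 : e' <= 1 by rewrite ge_min lexx.
have e'A : e' * A <= e / 3.
  apply: (@le_trans _ _ (e / (3 * A) * A)).
    by rewrite ler_wpM2r ?ge_min ?lexx ?orbT// ltW.
  by rewrite invfM mulrA divfK// gt_eqF.
have [d1 d10 h1] := df _ e'0; have [d2 d20 h2] := dg _ e'0.
have [d3 d30 h3] := cderiv_cont df e'0.
exists (Num.min d1 (Num.min d2 d3)); first by rewrite !lt_min d10 d20.
move=> h; rewrite !lt_min => /and3P[/h1{}h1 /h2{}h2 /h3{}h3].
have -> : f (z + h) * g (z + h) - f z * g z - (l * g z + f z * m) * h =
  (f (z + h) - f z - l * h) * g z + f (z + h) * (g (z + h) - g z - m * h)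
  + (f (z + h) - f z) * m * h by ring.
rewrite (le_trans (normcD _ _))// (le_trans (lerD (normcD _ _) (lexx _)))//.
rewrite !normcM.
have n0 := normc_ge0 h; have f0 := normc_ge0 (f z).
have g0 := normc_ge0 (g z); have m0 := normc_ge0 m.
have fzh : normc (f (z + h)) <= 1 + normc (f z).
  rewrite -(subrK (f z) (f (z + h))) (le_trans (normcD _ _))// lerD2r.
  exact: le_trans h3 e'1.
have t1 : normc (f (z + h) - f z - l * h) * normc (g z) <= e / 3 * normc h.
  apply: (le_trans (ler_wpM2r g0 h1)).
  rewrite mulrAC ler_wpM2r// (le_trans _ e'A)// ler_wpM2l ?(ltW e'0)//.
  by rewrite /A; lra.
have t2 : normc (f (z + h)) * normc (g (z + h) - g z - m * h) <= e / 3 * normc h.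
  apply: (le_trans (ler_pM (normc_ge0 _) (normc_ge0 _) fzh h2)).
  rewrite mulrA ler_wpM2r// mulrC (le_trans _ e'A)// ler_wpM2l ?(ltW e'0)//.
  by rewrite /A; lra.
have t3 : normc (f (z + h) - f z) * normc m * normc h <= e / 3 * normc h.
  rewrite ler_wpM2r// (le_trans (ler_wpM2r m0 h3))//.
  rewrite (le_trans _ e'A)// ler_wpM2l ?(ltW e'0)//.
  by rewrite /A; lra.
lra.
Qed.

Lemma cderiv_comp f g z l m : has_cderiv f z l -> has_cderiv g (f z) m ->
  has_cderiv (fun t => g (f t)) z (m * l).
Proof.
move=> df dg e e0.
have l0 := normc_ge0 l; have m0 := normc_ge0 m.
have B0 : 0 < 1 + normc l by rewrite ltr_pwDl.
have C0 : 0 < 1 + normc m by rewrite ltr_pwDl.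
have e1 : 0 < e / 2 / (1 + normc l) by rewrite !divr_gt0.
pose e2 := Num.min 1 (e / 2 / (1 + normc m)).
have e20 : 0 < e2 by rewrite lt_min ltr01 !divr_gt0.
have [d1 d10 h1] := dg _ e1; have [d2 d20 h2] := df _ e20.
have d12 : 0 < d1 / 2 by rewrite divr_gt0.
have [d3 d30 h3] := cderiv_cont df d12.
exists (Num.min d2 d3); first by rewrite lt_min d20.
move=> h; rewrite lt_min => /andP[/h2{}h2 /h3{}h3].
have hk : normc (f (z + h) - f z) < d1 by rewrite (le_lt_trans h3)// ltr_pdivrMr// ltr_pMr// ltr1n.
have := h1 _ hk; rewrite (addrC (f z)) subrK => {}h1.
have -> : g (f (z + h)) - g (f z) - m * l * h =
  (g (f (z + h)) - g (f z) - m * (f (z + h) - f z))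
   + m * (f (z + h) - f z - l * h) by ring.
rewrite (le_trans (normcD _ _))// normcM.
have n0 := normc_ge0 h.
have k1 : normc (f (z + h) - f z) <= (1 + normc l) * normc h.
  rewrite -(subrK (l * h) (f (z + h) - f z)) (le_trans (normcD _ _))//.
  rewrite normcM mulrDl lerD// (le_trans h2)// ler_wpM2r//.
  by rewrite ge_min lexx.
have t1 : normc (g (f (z + h)) - g (f z) - m * (f (z + h) - f z)) <= e / 2 * normc h.
  apply: (le_trans h1); apply: (le_trans (ler_wpM2l (ltW e1) k1)).
  by rewrite mulrA divfK// gt_eqF.
have t2 : normc m * normc (f (z + h) - f z - l * h) <= e / 2 * normc h.
  apply: (le_trans (ler_wpM2l m0 h2)); rewrite mulrA ler_wpM2r//.
  apply: (@le_trans _ _ ((1 + normc m) * (e / 2 / (1 + normc m)))).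
    apply: ler_pM => //; rewrite ?(ltW e20) ?lerDr//.
    by rewrite ge_min lexx orbT.
  by rewrite mulrC divfK// gt_eqF.
lra.
Qed.

Lemma cderiv_affine (c : R[i]) l z : has_cderiv (fun t => c + l * t) z l.
Proof.
move=> e e0; exists 1 => // h _.
have -> : c + l * (z + h) - (c + l * z) - l * h = 0 by ring.
by rewrite normc0 mulr_ge0 ?normc_ge0// ltW.
Qed.

Lemma cderiv_inv z : z != 0 -> has_cderiv (fun t => t^-1) z (- z^-2).
Proof.
move=> z0 e e0; have n0 : 0 < normc z by rewrite normc_gt0.
pose d := Num.min (normc z / 2) (e * normc z ^+ 3 / 2).
exists d; first by rewrite lt_min !divr_gt0// mulr_gt0// exprn_gt0.
move=> h; rewrite lt_min => /andP[h1 h2].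
have zh : normc z / 2 <= normc (z + h).
  rewrite -(opprK h) (le_trans _ (normcB_ge _ _))// normcN.
  by lra.
have zh0 : z + h != 0 by rewrite -normc_gt0 (lt_le_trans _ zh)// divr_gt0.
have -> : (z + h)^-1 - z^-1 - - z^-2 * h = h * h / (z ^+ 2 * (z + h)).
  field. by rewrite z0 zh0.
rewrite !normcM normcV normcM normcX mulrAC ler_wpM2r ?normc_ge0//.
rewrite ler_pdivrMr; last by rewrite mulr_gt0 ?exprn_gt0// normc_gt0.
apply: (le_trans (ltW h2)).
have -> : e * normc z ^+ 3 / 2 = e * (normc z ^+ 2 * (normc z / 2)) by ring.
by rewrite ler_wpM2l ?(ltW e0)// ler_wpM2l// exprn_ge0// ltW.
Qed.

End ComplexBasics.

(** * The complex exponential *)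

Section RealDerivative.
Variable R : realType.
Implicit Types x l : R.

Lemma is_derive_eps (f : R -> R) x l : is_derive x 1 f l -> forall e, 0 < e ->
  exists2 d, 0 < d & forall h, `|h| < d -> `|f (x + h) - f x - l * h| <= e * `|h|.
Proof.
move=> [df dl] e e0; move: df; rewrite /derivable => /cvg_ex[/= m dm].
have lm : l = m by rewrite -dl; apply: cvg_lim.
move/cvgrPdist_le : dm => /(_ e e0); rewrite near_withinE => /nbhs_ballP[d /= d0 H].
exists d => // h hd; have [->|h0] := eqVneq h 0.
  by rewrite addr0 subrr mulr0 subr0 normr0 mulr0.
have := H h; rewrite /ball /= sub0r normrN => /(_ hd h0).
rewrite /GRing.scale /= mulr1 -lm (addrC h x) => {}H.
have -> : f (x + h) - f x - l * h = - h * (l - h^-1 * (f (x + h) - f x)) by field.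
by rewrite normrM normrN mulrC ler_wpM2r.
Qed.

End RealDerivative.

Section ComplexExponential.
Variable R : realType.
Implicit Types (z w h l : R[i]) (x y a b c e : R).

Definition cexp z : R[i] :=
  (expR (complex.Re z) * cos (complex.Im z)) +i*
  (expR (complex.Re z) * sin (complex.Im z)).

Lemma cexp0 : cexp 0 = 1.
Proof. by rewrite /cexp /= expR0 cos0 sin0 mulr1 mulr0. Qed.

Lemma cexpD z w : cexp (z + w) = cexp z * cexp w.
Proof.
case: z w => [s x] [t y]; rewrite /cexp /= expRD cosD sinD.
by apply/eqP; rewrite eq_complex /=; apply/andP; split; apply/eqP; ring.
Qed.

Lemma normc_cexp z : normc (cexp z) = expR (complex.Re z).
Proof.
rewrite /cexp normc_eq_sqrt !exprMn -mulrDr cos2Dsin2 mulr1.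
by rewrite sqrtr_sqr ger0_norm// expR_ge0.
Qed.

Lemma cexp_neq0 z : cexp z != 0.
Proof. by rewrite -normc_gt0 normc_cexp expR_gt0. Qed.

Lemma cexpN z : cexp (- z) = (cexp z)^-1.
Proof.
by apply: (mulfI (cexp_neq0 z)); rewrite -cexpD subrr cexp0 divff// cexp_neq0.
Qed.

(** The only analytic input on the exponential; [cexpD] carries it from 0 to
    every point. *)
Lemma cexp_bound e : 0 < e ->
  exists2 d, 0 < d & forall h, normc h < d -> normc (cexp h - 1 - h) <= e * normc h.
Proof.
move=> e0; pose e1 := Num.min 1 (e / 6).
have e10 : 0 < e1 by rewrite lt_min ltr01 divr_gt0.
have e11 : e1 <= 1 by rewrite ge_min lexx.
have e16 : e1 <= e / 6 by rewrite ge_min lexx orbT.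
have [d1 d10 h1] := is_derive_eps (is_derive_expR (0 : R)) e10.
have [d2 d20 h2] := is_derive_eps (is_derive_cos (0 : R)) e10.
have [d3 d30 h3] := is_derive_eps (is_derive_sin (0 : R)) e10.
exists (Num.min (Num.min d1 d2) (Num.min d3 (e1 / 2))).
  by rewrite !lt_min d10 d20 d30 divr_gt0.
move=> [s x]; rewrite !lt_min => /andP[/andP[hd1 hd2] /andP[hd3 hd4]].
set n := normc _ in hd1 hd2 hd3 hd4 *.
have sn : `|s| <= n := normc_ge_absRe (s +i* x).
have xn : `|x| <= n := normc_ge_absIm (s +i* x).
have := h1 s (le_lt_trans sn hd1); have := h2 x (le_lt_trans xn hd2).
have := h3 x (le_lt_trans xn hd3); rewrite !add0r expR0 cos0 sin0 !(mul1r, oppr0, mul0r, subr0).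
move=> {}h3 {}h2 {}h1.
have n0 : 0 <= n by rewrite /n normc_ge0.
have es : `|expR s - 1| <= e1.
  rewrite -(subrK s (expR s - 1)) (le_trans (ler_normD _ _))//.
  have : e1 * `|s| <= `|s| by rewrite ler_piMl.
  by lra.
have es2 : `|expR s| <= 2.
  rewrite -(subrK 1 (expR s)) (le_trans (ler_normD _ _))// normr1.
  by lra.
apply: (le_trans (normc_le_ReIm _)); rewrite /cexp /= oppr0 addr0.
have -> : expR s * cos x - 1 - s = (expR s - 1 - s) + expR s * (cos x - 1) by ring.
have -> : expR s * sin x - x = expR s * (sin x - x) + (expR s - 1) * x by ring.
have b1 : `|expR s - 1 - s| <= e1 * n by rewrite (le_trans h1)// ler_wpM2l// ltW.
have b2 : `|expR s * (cos x - 1)| <= 2 * (e1 * n).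
  by rewrite normrM ler_pM// (le_trans h2)// ler_wpM2l// ltW.
have b3 : `|expR s * (sin x - x)| <= 2 * (e1 * n).
  by rewrite normrM ler_pM// (le_trans h3)// ler_wpM2l// ltW.
have b4 : `|(expR s - 1) * x| <= e1 * n by rewrite normrM ler_pM.
have b5 : e1 * n <= e / 6 * n by rewrite ler_wpM2r.
apply: (le_trans (lerD (ler_normD _ _) (ler_normD _ _))).
lra.
Qed.

Lemma cderiv_cexp z : has_cderiv cexp z (cexp z).
Proof.
move=> e e0; have c0 : 0 < normc (cexp z) by rewrite normc_gt0 cexp_neq0.
have [d d0 H] := cexp_bound (divr_gt0 e0 c0).
exists d => // h /H; rewrite cexpD.
have -> : cexp z * cexp h - cexp z - cexp z * h = cexp z * (cexp h - 1 - h) by ring.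
rewrite normcM; move=> /(ler_wpM2l (ltW c0)) /le_trans; apply.
by rewrite mulrA (mulrC (normc _) (e / _)) divfK// gt_eqF.
Qed.

End ComplexExponential.

(** * Integrals of complex-valued functions of a real variable *)

Section ComplexIntegral.
Variable R : realType.
Notation mu := (@lebesgue_measure R).
Implicit Types (f g : R -> R[i]) (a b c x y M : R) (z : R[i]).

(** Integration is componentwise, as in [circle_integral]; the price is the
    factor 2 in [cint_bound], harmless for all the estimates below. *)
Definition cint f a b : R[i] :=
  (\int[mu]_(x in `[a, b]) complex.Re (f x))%R +i*
  (\int[mu]_(x in `[a, b]) complex.Im (f x))%R.

Definition cintegrable f a b :=
  mu.-integrable `[a, b] (fun x => (complex.Re (f x))%:E) /\
  mu.-integrable `[a, b] (fun x => (complex.Im (f x))%:E).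

Definition ccont f x := forall e, 0 < e ->
  exists2 d, 0 < d & forall y, `|y - x| < d -> normc (f y - f x) <= e.

Lemma ccont_Re f x : ccont f x -> {for x, continuous (fun x => complex.Re (f x))}.
Proof.
move=> cf; apply/cvgrPdist_le => e e0; have [d d0 H] := cf e e0.
apply/nbhs_ballP; exists d => //= y; rewrite /ball /= distrC => /H.
apply: le_trans; rewrite -normcN opprB -ReN -ReD; exact: normc_ge_absRe.
Qed.

Lemma ccont_Im f x : ccont f x -> {for x, continuous (fun x => complex.Im (f x))}.
Proof.
move=> cf; apply/cvgrPdist_le => e e0; have [d d0 H] := cf e e0.
apply/nbhs_ballP; exists d => //= y; rewrite /ball /= distrC => /H.
apply: le_trans; rewrite -normcN opprB -ImN -ImD; exact: normc_ge_absIm.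
Qed.

Lemma ccont_integrable f a b :
  (forall x, a <= x <= b -> ccont f x) -> cintegrable f a b.
Proof.
move=> cf; split; apply: continuous_compact_integrable;
  try exact: segment_compact; apply: continuous_in_subspaceT => x;
  rewrite inE /= in_itv /= => /cf; [exact: ccont_Re|exact: ccont_Im].
Qed.

Lemma Rint_cat (f : R -> R) a b c : a <= b <= c ->
  mu.-integrable `[a, c] (EFin \o f) ->
  (\int[mu]_(x in `[a, c]) f x = \int[mu]_(x in `[a, b]) f x + \int[mu]_(x in `[b, c]) f x)%R.
Proof.
move=> /andP[ab bc] If; apply/eqP; rewrite addrC -subr_eq; apply/eqP.
rewrite (@Rintegral_itvB _ f (BLeft a) (BRight c) b)// ?bnd_simp//.
rewrite Rintegral_itv_obnd_cbnd//.
by apply: integrableS If => //; apply: subset_itv; rewrite bnd_simp.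
Qed.

Lemma cint_cat f a b c : a <= b <= c -> cintegrable f a c ->
  cint f a c = cint f a b + cint f b c.
Proof. by move=> abc [h1 h2]; rewrite /cint (Rint_cat abc h1) (Rint_cat abc h2). Qed.

Lemma cintegrableD f g a b : cintegrable f a b -> cintegrable g a b ->
  cintegrable (fun x => f x + g x) a b.
Proof.
move=> [f1 f2] [g1 g2]; split.
  apply: eq_integrable (integrableD _ f1 g1) => // x _.
  by rewrite ReD EFinD.
apply: eq_integrable (integrableD _ f2 g2) => // x _.
by rewrite ImD EFinD.
Qed.

Lemma cintD f g a b : cintegrable f a b -> cintegrable g a b ->
  cint (fun x => f x + g x) a b = cint f a b + cint g a b.
Proof.
move=> [f1 f2] [g1 g2]; apply/eqP; rewrite eq_complex /=.
apply/andP; split; apply/eqP.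
  by under eq_Rintegral do rewrite ReD; rewrite RintegralD.
by under eq_Rintegral do rewrite ImD; rewrite RintegralD.
Qed.

Lemma cintegrableZ f z a b : cintegrable f a b ->
  cintegrable (fun x => z * f x) a b.
Proof.
move=> [f1 f2]; split.
  apply: eq_integrable (integrableB _ (integrableZl _ (complex.Re z) f1)
    (integrableZl _ (complex.Im z) f2)) => // x _.
  by rewrite ReM EFinB !EFinM.
apply: eq_integrable (integrableD _ (integrableZl _ (complex.Re z) f2)
    (integrableZl _ (complex.Im z) f1)) => // x _.
by rewrite ImM EFinD !EFinM.
Qed.

Lemma cintZ f z a b : cintegrable f a b ->
  cint (fun x => z * f x) a b = z * cint f a b.
Proof.
move=> [f1 f2]; rewrite /cint.
have Z1 (u : R) : mu.-integrable `[a, b] (EFin \o (fun x => u * complex.Re (f x))).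
  by apply: eq_integrable (integrableZl _ u f1) => // x _; rewrite /= EFinM.
have Z2 (u : R) : mu.-integrable `[a, b] (EFin \o (fun x => u * complex.Im (f x))).
  by apply: eq_integrable (integrableZl _ u f2) => // x _; rewrite /= EFinM.
apply/eqP; rewrite eq_complex ReM ImM /=; apply/andP; split; apply/eqP.
  by under eq_Rintegral do rewrite ReM; rewrite RintegralB// !RintegralZl.
by under eq_Rintegral do rewrite ImM; rewrite RintegralD// !RintegralZl.
Qed.

Lemma Rint_bound (f : R -> R) a b M : a <= b ->
  mu.-integrable `[a, b] (EFin \o f) ->
  (forall x, a <= x <= b -> `|f x| <= M) ->
  `|\int[mu]_(x in `[a, b]) f x|%R <= M * (b - a).
Proof.
move=> ab If fM; apply: (le_trans (le_normr_Rintegral _ If)) => //.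
have -> : M * (b - a) = (\int[mu]_(x in `[a, b]) M)%R.
  by rewrite Rintegral_cst//= lebesgue_measure_itv/= lte_fin; case: ltgtP ab => // ->; rewrite subrr.
have I1 : mu.-integrable `[a, b] (EFin \o (fun=> M)).
  by apply: continuous_compact_integrable;
    [exact: segment_compact|move=> x; exact: cvg_cst].
have I2 : mu.-integrable `[a, b] (EFin \o (fun x => `|f x|)).
  exact: integrable_norm.
by apply: le_Rintegral I2 I1 _ => // x /=; rewrite in_itv; exact: fM.
Qed.

Lemma cint_bound f a b M : a <= b -> cintegrable f a b ->
  (forall x, a <= x <= b -> normc (f x) <= M) ->
  normc (cint f a b) <= 2 * (M * (b - a)).
Proof.
move=> ab [h1 h2] fM; rewrite (le_trans (normc_le_ReIm _))// mulrDl mul1r.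
by rewrite lerD//; apply: Rint_bound => // x xab; rewrite (le_trans _ (fM x xab))//;
  (exact: normc_ge_absRe || exact: normc_ge_absIm).
Qed.

Lemma eq_cint f g a b : (forall x, a <= x <= b -> f x = g x) ->
  cint f a b = cint g a b.
Proof.
move=> fg; rewrite /cint; congr (_ +i* _); apply: eq_Rintegral => x;
  by rewrite inE /= in_itv/= => /fg ->.
Qed.

Lemma eq_cintegrable f g a b : (forall x, a <= x <= b -> f x = g x) ->
  cintegrable f a b -> cintegrable g a b.
Proof.
move=> fg [h1 h2]; split; [apply: eq_integrable h1|apply: eq_integrable h2] => // x;
  by rewrite inE /= in_itv/= => /fg ->.
Qed.

Lemma Rint_FTC (f F : R -> R) a b : a <= b ->
  (forall x, is_derive x 1 F (f x)) -> continuous f ->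
  (\int[mu]_(x in `[a, b]) f x)%R = F b - F a.
Proof.
move=> ab dF cf; have cF : continuous F.
  by move=> x; apply: differentiable_continuous; apply/derivable1_diffP; have [] := dF x.
move: ab; rewrite le_eqVlt => /predU1P[->|ab].
  by rewrite subrr set_itv1 Rintegral_set1.
rewrite /Rintegral (@continuous_FTC2 _ f F a b)//.
- exact: continuous_subspaceT.
- split; [by move=> x _; have [] := dF x| |].
  + by apply: cvg_at_right_filter; exact: cF.
  + by apply: cvg_at_left_filter; exact: cF.
- by move=> x _; rewrite derive1E; have [] := dF x.
Qed.

Lemma cint_FTC f F a b : a <= b ->
  (forall x, is_derive x 1 (fun x => complex.Re (F x)) (complex.Re (f x))) ->
  (forall x, is_derive x 1 (fun x => complex.Im (F x)) (complex.Im (f x))) ->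
  (forall x, ccont f x) -> cint f a b = F b - F a.
Proof.
move=> ab F1 F2 cf; rewrite /cint (Rint_FTC ab F1) ?(Rint_FTC ab F2).
- by case: (F b) (F a) => ? ? [].
- by move=> x; apply: ccont_Im.
- by move=> x; apply: ccont_Re.
Qed.

End ComplexIntegral.

(** * Cauchy's theorem on rectangles *)

Section Goursat.
Variable R : realType.
Implicit Types (G : R[i] -> R[i]) (a b c d s x e u v : R) (z l : R[i]).

(** Bisection as an induction principle: a property of subrectangles that passes
    from the four quarters to the whole, and holds for the small enough ones
    around each point, holds for the rectangle.  Otherwise a nested sequence of
    bad quarters would shrink to a point contradicting the second hypothesis.
    The subrectangle [P s x u] has corner (s, x) and is the given one scaled by
    [u].  This serves for Goursat's lemma and for boundedness. *)
Lemma rect_bisection (a c A B : R) (P : R -> R -> R -> Prop)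
  (inside := fun s x u => [/\ a <= s, s + u * A <= a + A, c <= x & x + u * B <= c + B]) :
  0 <= A -> 0 <= B ->
  (forall s x u, 0 < u -> inside s x u ->
     P s x (u / 2) -> P (s + u / 2 * A) x (u / 2) ->
     P s (x + u / 2 * B) (u / 2) -> P (s + u / 2 * A) (x + u / 2 * B) (u / 2) ->
     P s x u) ->
  (forall s0 x0, a <= s0 <= a + A -> c <= x0 <= c + B ->
     exists2 e, 0 < e & forall s x u, 0 < u < e -> inside s x u ->
       s <= s0 <= s + u * A -> x <= x0 <= x + u * B -> P s x u) ->
  P a c 1.
Proof.
move=> A0 B0 split_ local; apply: contrapT => nP.
(* A triple (s, x, u) encodes the subrectangle with corner (s, x) and scale u. *)
pose good (p : R * R * R) := [/\ 0 < p.2, inside p.1.1 p.1.2 p.2 & ~ P p.1.1 p.1.2 p.2].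
pose child (p q : R * R * R) := [/\ q.2 = p.2 / 2,
  p.1.1 <= q.1.1, q.1.1 + q.2 * A <= p.1.1 + p.2 * A,
  p.1.2 <= q.1.2 & q.1.2 + q.2 * B <= p.1.2 + p.2 * B].
have next p : exists q, good p -> good q /\ child p q.
  have [gp|] := pselect (good p); last by exists p.
  case: p gp => -[s x] u [/= u0 ins nPp].
  have u20 : 0 < u / 2 by rewrite divr_gt0.
  have uA : 0 <= u / 2 * A by rewrite mulr_ge0// ltW.
  have uB : 0 <= u / 2 * B by rewrite mulr_ge0// ltW.
  have eA : u * A = u / 2 * A + u / 2 * A by field.
  have eB : u * B = u / 2 * B + u / 2 * B by field.
  have [i1 i2 i3 i4] := ins.
  have step s' x' : (s' = s \/ s' = s + u / 2 * A) -> (x' = x \/ x' = x + u / 2 * B) ->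
      ~ P s' x' (u / 2) -> exists q, good (s, x, u) -> good q /\ child (s, x, u) q.
    move=> hs hx nP'; exists (s', x', u / 2) => _.
    have [s1 s2] : s <= s' /\ s' + u / 2 * A <= s + u * A by case: hs => ->; split; lra.
    have [x1 x2] : x <= x' /\ x' + u / 2 * B <= x + u * B by case: hx => ->; split; lra.
    split; split=> //=; split; lra.
  have [p1|p1] := pselect (P s x (u / 2)); last by apply: step p1; left.
  have [p2|p2] := pselect (P (s + u / 2 * A) x (u / 2)); last first.
    by apply: step p2; [right|left].
  have [p3|p3] := pselect (P s (x + u / 2 * B) (u / 2)); last first.
    by apply: step p3; [left|right].
  have [p4|p4] := pselect (P (s + u / 2 * A) (x + u / 2 * B) (u / 2)); last first.
    by apply: step p4; right.
  by exfalso; apply: nPp; exact: split_.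
have [f fP] := choice next.
pose p n := iter n f (a, c, 1).
have g0 : good (a, c, 1) by split=> //=; split; rewrite ?mul1r.
have gp n : good (p n) by elim: n => [//|n IH]; have [] := fP _ IH.
have cp n : child (p n) (p n.+1) by have [] := fP _ (gp n).
have pu n : (p n).2 = 1 / 2 ^+ n.
  elim: n => [|n IH]; first by rewrite /= expr0 divr1.
  by have [-> _ _ _ _] := cp n; rewrite IH exprS; field; rewrite expf_neq0.
have nest n k : [/\ (p n).1.1 <= (p (n + k)%N).1.1,
   (p (n + k)%N).1.1 + (p (n + k)%N).2 * A <= (p n).1.1 + (p n).2 * A,
   (p n).1.2 <= (p (n + k)%N).1.2 &
   (p (n + k)%N).1.2 + (p (n + k)%N).2 * B <= (p n).1.2 + (p n).2 * B].
  elim: k => [|k [h1 h2 h3 h4]]; first by rewrite addn0.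
  rewrite addnS; have [_ k1 k2 k3 k4] := cp (n + k)%N.
  by split; [exact: le_trans h1 k1|exact: le_trans k2 h2|exact: le_trans h3 k3|exact: le_trans k4 h4].
have up n : 0 <= (p n).2 * A /\ 0 <= (p n).2 * B.
  by have [/ltW u0 _ _] := gp n; split; rewrite mulr_ge0.
have bd1 m n : (p m).1.1 <= (p n).1.1 + (p n).2 * A.
  case: (leqP m n) => mn.
    have [h _ _ _] := nest m (n - m)%N; rewrite subnKC// in h.
    by rewrite (le_trans h)// lerDl; have [] := up n.
  have [_ h _ _] := nest n (m - n)%N; rewrite subnKC// in h; last exact: ltnW.
  by rewrite (le_trans _ h)// lerDl; have [] := up m.
have bd2 m n : (p m).1.2 <= (p n).1.2 + (p n).2 * B.
  case: (leqP m n) => mn.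
    have [_ _ h _] := nest m (n - m)%N; rewrite subnKC// in h.
    by rewrite (le_trans h)// lerDl; have [] := up n.
  have [_ _ _ h] := nest n (m - n)%N; rewrite subnKC// in h; last exact: ltnW.
  by rewrite (le_trans _ h)// lerDl; have [] := up m.
pose S1 := range (fun n => (p n).1.1); pose S2 := range (fun n => (p n).1.2).
have S1b n : ubound S1 ((p n).1.1 + (p n).2 * A) by move=> _ [m _ <-].
have S2b n : ubound S2 ((p n).1.2 + (p n).2 * B) by move=> _ [m _ <-].
have S1s : has_sup S1 by split; [exists (p 0%N).1.1, 0%N|exists ((p 0%N).1.1 + (p 0%N).2 * A)].
have S2s : has_sup S2 by split; [exists (p 0%N).1.2, 0%N|exists ((p 0%N).1.2 + (p 0%N).2 * B)].
have in1 n : (p n).1.1 <= sup S1 <= (p n).1.1 + (p n).2 * A.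
  apply/andP; split; first by apply: sup_upper_bound => //; exists n.
  by apply: ge_sup => //; case: S1s.
have in2 n : (p n).1.2 <= sup S2 <= (p n).1.2 + (p n).2 * B.
  apply/andP; split; first by apply: sup_upper_bound => //; exists n.
  by apply: ge_sup => //; case: S2s.
(* The suprema of the corners lie in all the nested rectangles. *)
have [||e e0 H] := local (sup S1) (sup S2).
- by have := in1 0%N; rewrite /= mul1r.
- by have := in2 0%N; rewrite /= mul1r.
have [n ne] : exists n, (p n).2 < e.
  have [n _ /(_ n (leqnn n))] := near_infty_natSinv_expn_lt (PosNum e0).
  by move=> /= ne; exists n; rewrite pu.
have [u0 ins nPn] := gp n; apply: nPn; apply: H => //.
by rewrite u0.
Qed.

Lemma dist_in_itv x y a d : a <= x <= a + d -> a <= y <= a + d -> `|x - y| <= d.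
Proof. by move=> /andP[? ?] /andP[? ?]; rewrite ler_norml; apply/andP; split; lra. Qed.

Definition boundary_int G a b c d : R[i] :=
  cint (fun s => G (s +i* c)) a b + 'i * cint (fun x => G (b +i* x)) c d
  - cint (fun s => G (s +i* d)) a b - 'i * cint (fun x => G (a +i* x)) c d.

Lemma cint_cst z a b : a <= b -> cint (fun=> z) a b = z * (b - a)%:C.
Proof.
move=> ab; rewrite /cint !Rintegral_cst//= lebesgue_measure_itv/= lte_fin.
case: z => u v; case: ltgtP ab => //= [ab _|-> _].
  by apply/eqP; rewrite eq_complex /=; apply/andP; split; apply/eqP; ring.
by rewrite !mulr0 subrr; apply/eqP; rewrite eq_complex /=; apply/andP; split; apply/eqP; ring.
Qed.

Lemma ccont_cst z x : ccont (fun=> z) x.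
Proof. by move=> e e0; exists 1 => // y _; rewrite subrr normc0 ltW. Qed.

Lemma cderiv_ccont_h G s x l : has_cderiv G (s +i* x) l ->
  ccont (fun s => G (s +i* x)) s.
Proof.
move=> dG e e0; have [d d0 H] := cderiv_cont dG e0; exists d => // y yd.
have := H ((y - s)%:C); rewrite normcR => /(_ yd).
by have -> : s +i* x + (y - s)%:C = y +i* x
  by apply/eqP; rewrite eq_complex /= addr0 subrKC !eqxx.
Qed.

Lemma cderiv_ccont_v G s x l : has_cderiv G (s +i* x) l ->
  ccont (fun x => G (s +i* x)) x.
Proof.
move=> dG e e0; have [d d0 H] := cderiv_cont dG e0; exists d => // y yd.
have := H (0 +i* (y - x)).
rewrite normc_eq_sqrt expr0n add0r sqrtr_sqr => /(_ yd).
by have -> : s +i* x + 0 +i* (y - x) = s +i* y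
  by apply/eqP; rewrite eq_complex /= addr0 subrKC !eqxx.
Qed.

Definition cdiff_on_rect G a b c d :=
  forall s x, a <= s <= b -> c <= x <= d -> exists l, has_cderiv G (s +i* x) l.

Lemma cdiff_on_rect_sub G a b c d a' b' c' d' :
  a <= a' -> b' <= b -> c <= c' -> d' <= d ->
  cdiff_on_rect G a b c d -> cdiff_on_rect G a' b' c' d'.
Proof.
move=> aa bb cc dd H s x /andP[s1 s2] /andP[x1 x2]; apply: H; apply/andP; split;
  (exact: le_trans s1 || exact: le_trans s2 _ || exact: le_trans x1 || exact: le_trans x2 _).
Qed.

Lemma cdiff_on_rect_h G a b c d y : cdiff_on_rect G a b c d -> c <= y <= d ->
  cintegrable (fun s => G (s +i* y)) a b.
Proof.
move=> dG yd; apply: ccont_integrable => s sab.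
by have [l dl] := dG s y sab yd; exact: cderiv_ccont_h dl.
Qed.

Lemma cdiff_on_rect_v G a b c d s : cdiff_on_rect G a b c d -> a <= s <= b ->
  cintegrable (fun x => G (s +i* x)) c d.
Proof.
move=> dG sab; apply: ccont_integrable => x xcd.
by have [l dl] := dG s x sab xcd; exact: cderiv_ccont_v dl.
Qed.

Lemma boundary_int_split G a m b c n d : a <= m <= b -> c <= n <= d ->
  cdiff_on_rect G a b c d ->
  boundary_int G a b c d = boundary_int G a m c n + boundary_int G m b c n
     + boundary_int G a m n d + boundary_int G m b n d.
Proof.
move=> amb cnd dG; have /andP[am mb] := amb; have /andP[cn nd] := cnd.
have ab := le_trans am mb; have cd := le_trans cn nd.
rewrite /boundary_int.
rewrite (cint_cat amb (cdiff_on_rect_h dG (y := c) _)) ?lexx//.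
rewrite (cint_cat amb (cdiff_on_rect_h dG (y := d) _)) ?lexx ?andbT//.
rewrite (cint_cat cnd (cdiff_on_rect_v dG (s := a) _)) ?lexx//.
rewrite (cint_cat cnd (cdiff_on_rect_v dG (s := b) _)) ?lexx ?andbT//.
ring.
Qed.

Lemma boundary_int_bound G a b c d e : a <= b -> c <= d ->
  cdiff_on_rect G a b c d ->
  (forall s x, a <= s <= b -> c <= x <= d -> normc (G (s +i* x)) <= e) ->
  normc (boundary_int G a b c d) <= 4 * (e * ((b - a) + (d - c))).
Proof.
move=> ab cd dG He.
have aab : a <= a <= b by rewrite lexx.
have bab : a <= b <= b by rewrite lexx andbT.
have ccd : c <= c <= d by rewrite lexx.
have dcd : c <= d <= d by rewrite lexx andbT.
have b1 := cint_bound ab (cdiff_on_rect_h dG ccd) (fun s h => He s c h ccd).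
have b2 := cint_bound cd (cdiff_on_rect_v dG bab) (fun x h => He b x bab h).
have b3 := cint_bound ab (cdiff_on_rect_h dG dcd) (fun s h => He s d h dcd).
have b4 := cint_bound cd (cdiff_on_rect_v dG aab) (fun x h => He a x aab h).
have ni z : normc ('i * z) = normc z.
  by rewrite normcM /= expr0n expr1n add0r sqrtr1 mul1r.
rewrite /boundary_int (le_trans (normcB _ _))//.
rewrite (le_trans (lerD (normcB _ _) (lexx _)))//.
rewrite (le_trans (lerD (lerD (normcD _ _) (lexx _)) (lexx _)))// !ni.
lra.
Qed.

Lemma boundary_intD G H a b c d : a <= b -> c <= d ->
  cdiff_on_rect G a b c d -> cdiff_on_rect H a b c d ->
  boundary_int (fun z => G z + H z) a b c d =
  boundary_int G a b c d + boundary_int H a b c d.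
Proof.
move=> ab cd dG dH.
have aab : a <= a <= b by rewrite lexx.
have bab : a <= b <= b by rewrite lexx andbT.
have ccd : c <= c <= d by rewrite lexx.
have dcd : c <= d <= d by rewrite lexx andbT.
rewrite /boundary_int.
rewrite (cintD (cdiff_on_rect_h dG ccd) (cdiff_on_rect_h dH ccd)).
rewrite (cintD (cdiff_on_rect_h dG dcd) (cdiff_on_rect_h dH dcd)).
rewrite (cintD (cdiff_on_rect_v dG aab) (cdiff_on_rect_v dH aab)).
rewrite (cintD (cdiff_on_rect_v dG bab) (cdiff_on_rect_v dH bab)).
ring.
Qed.

Lemma cdiff_on_rect_affine (p l : R[i]) a b c d :
  cdiff_on_rect (fun z => p + l * z) a b c d.
Proof. by move=> s x _ _; exists l; exact: cderiv_affine. Qed.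

(** An affine function has a primitive; here this amounts to two opposite sides
    differing by a constant. *)
Lemma boundary_int_affine (p l : R[i]) a b c d : a <= b -> c <= d ->
  boundary_int (fun z => p + l * z) a b c d = 0.
Proof.
move=> ab cd; have dG := cdiff_on_rect_affine p l (a := a) (b := b) (c := c) (d := d).
have aab : a <= a <= b by rewrite lexx.
have dcd : c <= d <= d by rewrite lexx andbT.
have ccd : c <= c <= d by rewrite lexx.
have C1 z : cintegrable (fun=> z) a b.
  by apply: ccont_integrable => x _; exact: ccont_cst.
have C2 z : cintegrable (fun=> z) c d.
  by apply: ccont_integrable => x _; exact: ccont_cst.
have e1 : cint (fun s => p + l * (s +i* c)) a b =
    cint (fun s => p + l * (s +i* d)) a b + l * ('i * (c - d)%:C) * (b - a)%:C.
  rewrite -(cint_cst _ ab) -(cintD (cdiff_on_rect_h dG dcd) (C1 _)).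
  apply: eq_cint => s _; rewrite -addrA -mulrDr; congr (_ + l * _).
  by apply/eqP; rewrite eq_complex /=; apply/andP; split; apply/eqP; ring.
have e2 : cint (fun x => p + l * (b +i* x)) c d =
    cint (fun x => p + l * (a +i* x)) c d + l * (b - a)%:C * (d - c)%:C.
  rewrite -(cint_cst _ cd) -(cintD (cdiff_on_rect_v dG aab) (C2 _)).
  apply: eq_cint => s _; rewrite -addrA -mulrDr; congr (_ + l * _).
  by apply/eqP; rewrite eq_complex /=; apply/andP; split; apply/eqP; ring.
rewrite /boundary_int e1 e2 (_ : (c - d)%:C = - (d - c)%:C); first ring.
by rewrite -[RHS]rmorphN opprB.
Qed.

(** Goursat's argument: |boundary integral| <= e u^2 for a rectangle of scale [u]
    is inherited from the quarters, and near a point of differentiability only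
    the remainder after subtracting the affine part contributes, which is
    o(u) on a boundary of length O(u). *)
Theorem goursat_rect G a b c d : a <= b -> c <= d ->
  cdiff_on_rect G a b c d -> boundary_int G a b c d = 0.
Proof.
move=> ab cd dG; set A := b - a; set B := d - c.
have A0 : 0 <= A by rewrite subr_ge0.
have B0 : 0 <= B by rewrite subr_ge0.
have bE : a + A = b by rewrite subrKC.
have dE : c + B = d by rewrite subrKC.
apply/eqP; rewrite -normc_eq0 eq_le normc_ge0 andbT; apply/ler_addgt0Pr => e e0.
rewrite add0r.
suff : normc (boundary_int G a (a + 1 * A) c (c + 1 * B)) <= e * 1 ^+ 2.
  by rewrite !mul1r bE dE expr1n mulr1.
apply: (@rect_bisection a c A B (fun s x u =>
  normc (boundary_int G s (s + u * A) x (x + u * B)) <= e * u ^+ 2)) => //.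
- move=> s x u u0 [i1 i2 i3 i4].
  have uA : 0 <= u / 2 * A by rewrite mulr_ge0// divr_ge0// ltW.
  have uB : 0 <= u / 2 * B by rewrite mulr_ge0// divr_ge0// ltW.
  have eA : u * A = u / 2 * A + u / 2 * A by field.
  have eB : u * B = u / 2 * B + u / 2 * B by field.
  have eu : e * (u / 2) ^+ 2 = e * u ^+ 2 / 4 by field.
  have sub : cdiff_on_rect G s (s + u * A) x (x + u * B).
    by apply: cdiff_on_rect_sub dG => //; rewrite -?bE -?dE.
  rewrite eA eB !addrA in sub *; rewrite eu => p1 p2 p3 p4.
  rewrite (@boundary_int_split _ _ (s + u / 2 * A) _ _ (x + u / 2 * B))//; last 2 first.
  - by rewrite !lerDl uA.
  - by rewrite !lerDl uB.
  rewrite (le_trans (normcD _ _))//.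
  rewrite (le_trans (lerD (normcD _ _) (lexx _)))//.
  rewrite (le_trans (lerD (lerD (normcD _ _) (lexx _)) (lexx _)))//.
  rewrite (le_trans (lerD (lerD (lerD p1 p2) p3) p4))//.
  by rewrite le_eqVlt; apply/orP; left; apply/eqP; field.
- move=> s0 x0; rewrite bE dE => s0ab x0cd.
  have [l dl] := dG _ _ s0ab x0cd.
  pose D := 1 + A + B; have D0 : 0 < D by rewrite /D; lra.
  have e1 : 0 < e / (4 * D ^+ 2) by rewrite divr_gt0// mulr_gt0// exprn_gt0.
  have [r r0 H] := dl _ e1.
  exists (r / D); first by rewrite divr_gt0.
  move=> s x u /andP[u0 ur] [i1 i2 i3 i4] s0u x0u.
  have uA : 0 <= u * A by rewrite mulr_ge0// ltW.
  have uB : 0 <= u * B by rewrite mulr_ge0// ltW.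
  have sub : cdiff_on_rect G s (s + u * A) x (x + u * B).
    by apply: cdiff_on_rect_sub dG => //; lra.
  pose z0 := s0 +i* x0.
  (* The remainder of [G] after its affine approximation at the point. *)
  pose E w := G w + ((- G z0 + l * z0) + - l * w).
  have dE' : cdiff_on_rect E s (s + u * A) x (x + u * B).
    move=> s' x' h1 h2; have [m dm] := sub _ _ h1 h2.
    by exists (m + - l); apply: cderivD => //; exact: cderiv_affine.
  have -> : G = (fun w => E w + ((G z0 - l * z0) + l * w)).
    by apply/funext => w; rewrite /E; ring.
  rewrite boundary_intD//; try lra; last exact: cdiff_on_rect_affine.
  rewrite boundary_int_affine ?addr0; try lra.
  have EB : forall s' x', s <= s' <= s + u * A -> x <= x' <= x + u * B ->
      normc (E (s' +i* x')) <= e / (4 * D ^+ 2) * (u * (A + B)).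
    move=> s' x' hs hx; pose h := (s' - s0) +i* (x' - x0).
    have nh : normc h <= u * (A + B).
      rewrite (le_trans (normc_le_ReIm _))// mulrDr /= lerD//.
        by apply: dist_in_itv hs s0u.
      by apply: dist_in_itv hx x0u.
    have hr : normc h < r.
      rewrite (le_lt_trans nh)// (@le_lt_trans _ _ (u * D))//.
        by rewrite ler_pM2l// /D; lra.
      by rewrite -ltr_pdivlMr.
    have zh : s' +i* x' = z0 + h.
      by apply/eqP; rewrite eq_complex /= !subrKC !eqxx.
    have -> : E (s' +i* x') = G (z0 + h) - G z0 - l * h by rewrite /E zh; ring.
    by rewrite (le_trans (H _ hr))// ler_wpM2l// ltW.
  apply: (le_trans (boundary_int_bound _ _ dE' EB)); try lra.
  have -> : 4 * (e / (4 * D ^+ 2) * (u * (A + B)) * (s + u * A - s + (x + u * B - x)))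
    = e * u ^+ 2 * ((A + B) / D) ^+ 2 by field; rewrite gt_eqF.
  rewrite ler_piMr//; first by rewrite mulr_ge0 ?exprn_ge0// ltW.
  have q0 : 0 <= (A + B) / D by apply: divr_ge0; [exact: addr_ge0|exact: ltW].
  have q1 : (A + B) / D <= 1 by rewrite ler_pdivrMr// mul1r /D -addrA; move: (A + B) => AB; lra.
  exact: exprn_ile1.
Qed.

End Goursat.

(** * The principal logarithm *)

Section ComplexLogarithm.
Variable R : realType.
Implicit Types (z w h l v : R[i]) (x y e : R).

(** The complement of the closed negative half-line, as a single inequality. *)
Definition slit z := 0 < normc z + complex.Re z.

Lemma slit_neq0 z : slit z -> z != 0.
Proof. by apply: contraTneq => ->; rewrite /slit normc0 addr0 ltxx. Qed.

Lemma normc_gt_Re z : complex.Im z != 0 -> `|complex.Re z| < normc z.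
Proof.
case: z => x y /= y0; rewrite -(sqrtr_sqr x) ltr_sqrt ?ltrDl.
  by rewrite lt_def sqrf_eq0 y0 sqr_ge0.
by rewrite ltr_wpDl ?sqr_ge0// lt_def sqrf_eq0 y0 sqr_ge0.
Qed.

Lemma slit_Im z : complex.Im z != 0 -> slit z.
Proof.
by move=> /normc_gt_Re; rewrite ltr_norml => /andP[h _]; rewrite /slit -ltrBlDr sub0r ltrNl.
Qed.

Lemma slit_Re z : 0 < complex.Re z -> slit z.
Proof. by move=> h; rewrite /slit ltr_wpDl// normc_ge0. Qed.

Lemma normc_sqr z : normc z ^+ 2 = complex.Re z ^+ 2 + complex.Im z ^+ 2.
Proof. by case: z => x y /=; rewrite sqr_sqrtr// addr_ge0// sqr_ge0. Qed.

Lemma slitV z : slit z -> slit z^-1.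
Proof.
move=> sz; have z0 := slit_neq0 sz; have n0 : 0 < normc z by rewrite normc_gt0.
have -> : z^-1 = ((complex.Re z / normc z ^+ 2) -i* (complex.Im z / normc z ^+ 2)).
  by rewrite normc_sqr; case: (z).
rewrite /slit.
have -> : normc ((complex.Re z / normc z ^+ 2) -i* (complex.Im z / normc z ^+ 2)) = normc z / normc z ^+ 2.
  rewrite normc_eq_sqrt sqrrN !expr_div_n -mulrDl -normc_sqr -expr_div_n.
  by rewrite sqrtr_sqr ger0_norm// divr_ge0 ?exprn_ge0// ltW.
by rewrite /= -mulrDl divr_gt0// exprn_gt0.
Qed.

Lemma ratio_itv z : z != 0 -> -1 <= complex.Re z / normc z <= 1.
Proof.
rewrite -normc_gt0 => n0; rewrite -ler_norml normrM normfV (ger0_norm (ltW n0)).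
by rewrite ler_pdivrMr// mul1r normc_ge_absRe.
Qed.

Lemma cargE z : carg z = if 0 <= complex.Im z
  then acos (complex.Re z / normc z) else - acos (complex.Re z / normc z).
Proof. by []. Qed.

Lemma cos_carg z : z != 0 -> cos (carg z) = complex.Re z / normc z.
Proof.
move=> z0; rewrite cargE; have : complex.Re z / normc z \in `[(-1), 1].
  by rewrite in_itv /= ratio_itv.
by move=> /acosK E; case: ifP => _; rewrite ?cosN E.
Qed.

Lemma sin_carg z : z != 0 -> sin (carg z) = complex.Im z / normc z.
Proof.
move=> z0; have n0 : 0 < normc z by rewrite normc_gt0.
have E : sin (acos (complex.Re z / normc z)) = `|complex.Im z| / normc z.
  rewrite sin_acos ?ratio_itv//.
  have -> : 1 - (complex.Re z / normc z) ^+ 2 = (complex.Im z / normc z) ^+ 2.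
    rewrite !expr_div_n normc_sqr; field.
    by rewrite -normc_sqr sqrf_eq0 gt_eqF.
  by rewrite sqrtr_sqr normrM normfV (ger0_norm (ltW n0)).
rewrite cargE; case: ifPn => [h|]; first by rewrite E ger0_norm.
by rewrite -ltNge => h; rewrite sinN E ltr0_norm// mulNr opprK.
Qed.

Lemma clogK z : z != 0 -> cexp (clog z) = z.
Proof.
move=> z0; have n0 : 0 < normc z by rewrite normc_gt0.
rewrite /cexp /clog /= lnK ?posrE// cos_carg// sin_carg//.
rewrite !(mulrC (normc z)) !divfK ?gt_eqF//.
by case: (z).
Qed.

(** The half-angle formula removes the case distinction on the sign of the
    imaginary part, on which continuity is not visible. *)
Lemma carg_atan z : slit z ->
  carg z = 2 * atan (complex.Im z / (normc z + complex.Re z)).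
Proof.
move=> sz; have z0 := slit_neq0 sz; have n0 : 0 < normc z by rewrite normc_gt0.
set u := complex.Im z / _; set a := atan u.
have c2 : cos a ^+ 2 = (1 + u ^+ 2)^-1.
  by rewrite /a cos_atan exprVn sqr_sqrtr// addr_ge0// sqr_ge0.
have u1 : 1 + u ^+ 2 = 2 * normc z / (normc z + complex.Re z).
  rewrite /u expr_div_n.
  have -> : complex.Im z ^+ 2 = normc z ^+ 2 - complex.Re z ^+ 2 by rewrite normc_sqr addrC addKr.
  by field; rewrite gt_eqF.
have ca : cos (2 * a) = complex.Re z / normc z.
  rewrite mulr_natl cos_mulr2n c2 u1 -mulr_natl; field.
  by rewrite !gt_eqF.
have [a1 a2] : - (pi / 2) < a /\ a < pi / 2 by rewrite /a atan_gtNpi2 atan_ltpi2.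
rewrite cargE -ca.
case: ifPn => h.
  rewrite cosK// in_itv /=.
  have : 0 <= a by rewrite /a -(@atan0 R) le_atan// divr_ge0// ltW.
  by move=> h2; apply/andP; split; lra.
rewrite -ltNge in h; rewrite -cosN cosK ?opprK// in_itv /=.
have : a <= 0 by rewrite /a -(@atan0 R) le_atan// pmulr_lle0 ?invr_gt0// ltW.
by move=> h2; apply/andP; split; lra.
Qed.

(** The three continuous ingredients |z|, Re z, Im z are composed along the
    filter of neighborhoods of the increment 0, expressed with the modulus. *)
Lemma clog_cont z : slit z -> forall e, 0 < e ->
  exists2 d, 0 < d & forall h, normc h < d -> normc (clog (z + h) - clog z) <= e.
Proof.
move=> sz e e0; have n0 : 0 < normc z by rewrite normc_gt0 slit_neq0.
(* The neighborhoods of 0 are those of the modulus. *)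
have [F [FF FP]] : exists F : set_system R[i], Filter F /\
    forall P : set R[i], F P <-> exists2 d : R, 0 < d & forall h, normc h < d -> P h.
  exists [set P : set R[i] | exists2 d : R, 0 < d & forall h, normc h < d -> P h].
  split=> //; split=> [|P Q [d d0 Pd] [d' d'0 Qd]|P Q PQ [d d0 Pd]].
  - by exists 1.
  - exists (Num.min d d'); first by rewrite lt_min d0.
    by move=> h; rewrite lt_min => /andP[/Pd ? /Qd ?].
  - by exists d => // h /Pd /PQ.
have near0 (f : R[i] -> R) c : (forall h, `|f h - c| <= normc h) -> f h @[h --> F] --> c.
  move=> fc; apply/cvgrPdist_le => e' e'0; apply/FP; exists e' => // h he.
  by rewrite distrC (le_trans (fc h))// ltW.
have cn : normc (z + h) @[h --> F] --> normc z.
  apply: near0 => h; rewrite ler_norml; apply/andP; split.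
    by have := normcB_ge z (- h); rewrite normcN opprK; lra.
  by rewrite lerBlDl normcD.
have cr : complex.Re (z + h) @[h --> F] --> complex.Re z.
  by apply: near0 => h; rewrite ReD addrAC subrr add0r normc_ge_absRe.
have ci : complex.Im (z + h) @[h --> F] --> complex.Im z.
  by apply: near0 => h; rewrite ImD addrAC subrr add0r normc_ge_absIm.
have c1 : ln (normc (z + h)) @[h --> F] --> ln (normc z).
  by apply: continuous_cvg => //; exact: continuous_ln.
have c2 : atan (complex.Im (z + h) / (normc (z + h) + complex.Re (z + h)))
    @[h --> F] --> atan (complex.Im z / (normc z + complex.Re z)).
  apply: continuous_cvg; first exact: continuous_atan.
  by apply: cvgM => //; apply: cvgV; [rewrite gt_eqF|exact: cvgD].
have c3 : normc (z + h) + complex.Re (z + h) @[h --> F] --> normc z + complex.Re z.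
  exact: cvgD.
have e2 : 0 < e / 2 by rewrite divr_gt0.
move/cvgrPdist_le : c1 => /(_ _ e2)/FP[d1 d10 h1].
have e4 : 0 < e / 4 by rewrite divr_gt0.
move/cvgrPdist_le : c2 => /(_ _ e4)/FP[d2 d20 h2].
move/cvgrPdist_lt : c3 => /(_ _ sz)/FP[d3 d30 h3].
exists (Num.min d1 (Num.min d2 d3)); first by rewrite !lt_min d10 d20.
move=> h; rewrite !lt_min => /and3P[/h1{}h1 /h2{}h2 /h3{}h3].
have szh : slit (z + h).
  move: h3; rewrite /slit ltr_norml => /andP[_]; rewrite ltrBlDr; lra.
rewrite (le_trans (normc_le_ReIm _))// ReD ImD ReN ImN /= (splitr e) lerD// distrC//.
rewrite !carg_atan// -mulrBr normrM ger0_norm//; lra.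
Qed.

(** Given continuity, the derivative of the inverse follows from that of the
    exponential. *)
Lemma cderiv_clog z : slit z -> has_cderiv (@clog R) z z^-1.
Proof.
move=> sz e e0; have z0 := slit_neq0 sz.
have n0 : 0 < normc z by rewrite normc_gt0.
pose e1 := Num.min (1 / 2) (e * normc z / 2).
have e10 : 0 < e1 by rewrite lt_min !divr_gt0// mulr_gt0.
have [d d0 H] := cexp_bound e10.
have d20 : 0 < d / 2 by rewrite divr_gt0.
have [d1 d10 H1] := clog_cont sz d20.
exists (Num.min d1 (normc z)); first by rewrite lt_min d10.
move=> h; rewrite lt_min => /andP[/H1 hk hz]; set k := clog (z + h) - clog z in hk *.
have zh0 : z + h != 0.
  by apply/eqP => /eqP; rewrite addr_eq0 => /eqP zE; rewrite zE normcN ltxx in hz.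
have ek : cexp k = 1 + z^-1 * h.
  by rewrite /k cexpD cexpN !clogK//; field.
have /H : normc k < d by rewrite (le_lt_trans hk)// ltr_pdivrMr// ltr_pMr// ltr1n.
have -> : cexp k - 1 - k = - (k - z^-1 * h) by rewrite ek; ring.
rewrite normcN => b1.
have nzh : normc (z^-1 * h) = normc h / normc z by rewrite normcM normcV mulrC.
have bk : normc k <= 2 * (normc h / normc z).
  have := normcD (k - z^-1 * h) (z^-1 * h); rewrite subrK nzh => b2.
  have : e1 * normc k <= 1 / 2 * normc k by rewrite ler_wpM2r ?normc_ge0// ge_min lexx.
  by move: (normc k) (normc h / normc z) (e1 * normc k) b1 b2 => *; lra.
apply: (le_trans b1); apply: (@le_trans _ _ (e * normc z / 2 * (2 * (normc h / normc z)))).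
  by rewrite ler_pM ?normc_ge0 ?(ltW e10)// ge_min lexx orbT.
by rewrite le_eqVlt; apply/orP; left; apply/eqP; field; rewrite gt_eqF.
Qed.

(** Restriction to a line reduces complex derivatives to real ones, for which
    the mean value theorem and the fundamental theorem of calculus hold. *)
Lemma cderiv_is_derive (f : R[i] -> R[i]) z v x l :
  has_cderiv f (z + x%:C * v) l ->
  is_derive x 1 (fun y : R => complex.Re (f (z + y%:C * v))) (complex.Re (l * v)) /\
  is_derive x 1 (fun y : R => complex.Im (f (z + y%:C * v))) (complex.Im (l * v)).
Proof.
move=> df.
have main e : 0 < e -> exists2 d, 0 < d & forall h : R, `|h| < d -> h != 0 ->
    normc (h^-1%:C * (f (z + (h + x)%:C * v) - f (z + x%:C * v)) - l * v) <= e.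
  move=> e0; have v1 : 0 < 1 + normc v by rewrite ltr_pwDl// normc_ge0.
  have [d d0 H] := df _ (divr_gt0 e0 v1).
  exists (d / (1 + normc v)); first by rewrite divr_gt0.
  move=> h; rewrite ltr_pdivlMr// => hd h0.
  have hv : normc (h%:C * v) < d.
    rewrite (le_lt_trans _ hd)// normcM normcR ler_wpM2l//; lra.
  have := H _ hv; have -> : z + x%:C * v + h%:C * v = z + (h + x)%:C * v.
    by rewrite rmorphD; ring.
  move=> {}H.
  have -> : h^-1%:C * (f (z + (h + x)%:C * v) - f (z + x%:C * v)) - l * v =
    h^-1%:C * (f (z + (h + x)%:C * v) - f (z + x%:C * v) - l * (h%:C * v)).
    have hh : h^-1%:C * h%:C = 1 by rewrite -rmorphM mulVf.
    rewrite [RHS]mulrBr; congr (_ - _); transitivity ((h^-1%:C * h%:C) * (l * v)); last ring.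
    by rewrite hh mul1r.
  rewrite normcM normcR normfV mulrC ler_pdivrMr ?normr_gt0//.
  rewrite (le_trans H)// normcM normcR.
  have -> : e / (1 + normc v) * (`|h| * normc v) = e * `|h| * (normc v / (1 + normc v)) by ring.
  rewrite ler_piMr ?mulr_ge0 ?(ltW e0)//.
  by rewrite ler_pdivrMr// mul1r; lra.
by split; apply: DeriveDef; rewrite ?/derivable;
  [ apply/cvg_ex; exists (complex.Re (l * v)) | apply: cvg_lim => //
  | apply/cvg_ex; exists (complex.Im (l * v)) | apply: cvg_lim => //];
  apply/cvgrPdist_le => e /main[d d0 H]; rewrite near_withinE;
  apply/nbhs_ballP; exists d => //= h; rewrite /ball /= sub0r normrN => hd h0;
  rewrite /GRing.scale /= mulr1 distrC; apply: le_trans (H h hd h0);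
  [apply: le_trans (normc_ge_absRe _)|apply: le_trans (normc_ge_absRe _)
  |apply: le_trans (normc_ge_absIm _)|apply: le_trans (normc_ge_absIm _)];
  rewrite ?ReD ?ImD ?ReN ?ImN ?ReM ?ImM ?ReD ?ImD ?ReN ?ImN /= mul0r ?subr0 ?addr0.
Qed.

Lemma cderiv_segment_bound (f f' : R[i] -> R[i]) z B :
  (forall x : R, 0 <= x <= 1 -> has_cderiv f (x%:C * z) (f' (x%:C * z))) ->
  (forall x : R, 0 <= x <= 1 -> normc (f' (x%:C * z) * z) <= B) ->
  normc (f z - f 0) <= 2 * B.
Proof.
move=> df fB; pose u x := complex.Re (f (0 + x%:C * z)).
pose v x := complex.Im (f (0 + x%:C * z)).
have d1 x : 0 <= x <= 1 -> is_derive x 1 u (complex.Re (f' (x%:C * z) * z)) /\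
    is_derive x 1 v (complex.Im (f' (x%:C * z) * z)).
  by move=> x01; apply: cderiv_is_derive; rewrite add0r; exact: df.
have cont (g : R -> R) (g' : R -> R) : (forall x, 0 <= x <= 1 -> is_derive x 1 g (g' x)) ->
   {within `[0, 1], continuous g}.
  move=> dg; apply: continuous_in_subspaceT => x; rewrite inE /= in_itv /= => x01.
  by apply: differentiable_continuous; apply/derivable1_diffP; have [] := dg x x01.
have mvt (g : R -> R) (g' : R -> R) : (forall x, 0 <= x <= 1 -> is_derive x 1 g (g' x)) ->
   (forall x, 0 <= x <= 1 -> `|g' x| <= B) -> `|g 1 - g 0| <= B.
  move=> dg gB; have [||c c01 ->] := @MVT_segment R g g' 0 1 ler01.
  - by move=> x; rewrite in_itv /= => /andP[x0 x1]; apply: dg; rewrite !ltW.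
  - exact: cont dg.
  - by rewrite subr0 mulr1; apply: gB; rewrite in_itv in c01.
have -> : f z = f (0 + 1%:C * z) by rewrite add0r mul1r.
have -> : f 0 = f (0 + 0%:C * z) by rewrite add0r mul0r.
rewrite (le_trans (normc_le_ReIm _))// ReD ImD ReN ImN mulrDl mul1r lerD//.
  apply: (mvt u); first by move=> x /d1[h _]; exact: h.
  by move=> x /fB; apply: le_trans; exact: normc_ge_absRe.
apply: (mvt v); first by move=> x /d1[_ h]; exact: h.
by move=> x /fB; apply: le_trans; exact: normc_ge_absIm.
Qed.

End ComplexLogarithm.

(** * Taylor coefficients and the logarithmic series *)

Section TaylorCoefficients.
Variable R : realType.
Implicit Types (f : R[i] -> R[i]) (c : nat -> R[i]) (z w t v : R[i]) (x y s e r : R).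

Lemma cvg_cseqP (u : nat -> R[i]) t :
  ((u : nat -> R[i]^o) @ \oo --> (t : R[i]^o)) <->
  forall e, 0 < e -> exists N0, forall n, (N0 <= n)%N -> normc (u n - t) <= e.
Proof.
split=> [/cvgrPdist_le H e e0|H].
  have := H e%:C; rewrite ltcR => /(_ e0)[N0 _ N0P]; exists N0 => n nN.
  by have := N0P n nN; rewrite /= distrC cabsE lecR.
apply/cvgrPdist_le => e e0.
have eE : e = (normc e)%:C by apply: normc_real; exact: ltW.
have [|N0 N0P] := H (normc e); first by rewrite normc_gt0 gt_eqF.
by exists N0 => // n nN; rewrite /= distrC cabsE eE lecR; exact: N0P.
Qed.

(** Convergence at one point t1 bounds c_k t1^k; at half that modulus the series
    is then dominated by a geometric one, uniformly in t. *)
Lemma taylor_tail f c : has_taylor_coefs f c ->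
  exists2 tau : R, 0 < tau & exists N0 : nat, forall t n, normc t <= tau -> (N0 <= n)%N ->
    normc (f t - \sum_(0 <= k < n) c k * t ^+ k) <= 2 * 2^-1 ^+ n.
Proof.
move=> /nearcP[d d0 H].
pose t1 : R := d / 2; have t10 : 0 < t1 by rewrite divr_gt0.
exists (t1 / 2); first by rewrite divr_gt0.
have /H : normc t1%:C < d.
  by rewrite normcR gtr0_norm// ltr_pdivrMr// ltr_pMr// ltr1n.
rewrite add0r => /cvg_cseqP/(_ (1 / 2)); rewrite divr_gt0// => /(_ isT)[N0 hN0].
have cb k : (N0 <= k)%N -> normc (c k) * t1 ^+ k <= 1.
  move=> kN; have := hN0 k.+1 (leqW kN); have := hN0 k kN.
  rewrite big_nat_recr//=; set S := \sum_(_ <= _ < _) _ => h1 h2.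
  have -> : normc (c k) * t1 ^+ k = normc ((S + c k * t1%:C ^+ k - f t1%:C) - (S - f t1%:C)).
    have -> : S + c k * t1%:C ^+ k - f t1%:C - (S - f t1%:C) = c k * t1%:C ^+ k by ring.
    by rewrite normcM normcX normcR gtr0_norm.
  by rewrite (le_trans (normcB _ _))//; lra.
exists N0 => t n tt nN.
have nt0 := normc_ge0 t.
have ck k : (N0 <= k)%N -> normc (c k * t ^+ k) <= 2^-1 ^+ k.
  move=> kN; rewrite normcM normcX.
  apply: (@le_trans _ _ (normc (c k) * (t1 / 2) ^+ k)).
    by rewrite ler_wpM2l ?normc_ge0// lerXn2r ?nnegrE// divr_ge0// ltW.
  by rewrite expr_div_n mulrA -exprVn ler_piMl ?cb// exprn_ge0.
have part m : normc (\sum_(0 <= k < n + m) c k * t ^+ k - \sum_(0 <= k < n) c k * t ^+ k)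
    <= 2 * 2^-1 ^+ n - 2 * 2^-1 ^+ (n + m).
  elim: m => [|m IH]; first by rewrite addn0 !subrr normc0.
  rewrite addnS big_nat_recr//= addrAC (le_trans (normcD _ _))//.
  have := ck (n + m)%N (leq_trans nN (leq_addr _ _)).
  move: IH; rewrite exprS; move: (normc _) (normc _) => A B; lra.
have /H : normc t < d.
  by rewrite (le_lt_trans tt)// /t1; lra.
rewrite add0r => /cvg_cseqP cv.
apply/ler_addgt0Pr => e e0; have [N1 hN1] := cv e e0.
have := hN1 (n + N1)%N (leq_addl _ _); have := part N1.
rewrite normcBC => h1 h2.
set S := \sum_(0 <= k < n) _ in h1 *; set S' := \sum_(0 <= k < n + N1) _ in h1 h2.
have -> : f t - S = (f t - S') + (S' - S) by ring.
rewrite (le_trans (normcD _ _))// addrC lerD// 1?normcBC//.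
by rewrite normcBC (le_trans h1)// lerBlDr lerDl mulr_ge0// exprn_ge0.
Qed.

Lemma eq_cderiv f g z l : (forall t, f t = g t) -> has_cderiv f z l -> has_cderiv g z l.
Proof. by move=> /funext ->. Qed.

Lemma cderivXn z n : has_cderiv (fun t => t ^+ n.+1 / n.+1%:R) z (z ^+ n).
Proof.
have H : has_cderiv (fun t => t ^+ n.+1) z (n.+1%:R * z ^+ n).
  elim: n => [|n IH].
    have := cderiv_affine (0 : R[i]) 1 z; rewrite expr0 mulr1.
    by apply: eq_cderiv => u; rewrite add0r mul1r expr1.
  have -> : n.+2%:R * z ^+ n.+1 = (0 + 1) * z ^+ n.+1 + z * (n.+1%:R * z ^+ n).
    by rewrite -(natr1 n.+1) !exprS; ring.
  have := cderivM (cderiv_affine (0 : R[i]) 1 z) IH.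
  rewrite !add0r !mul1r; apply: eq_cderiv => u.
  by rewrite add0r mul1r -exprS.
have := cderivM (cderiv_cst n.+1%:R^-1 z) H.
rewrite mul0r add0r mulKf ?pnatr_eq0//.
by apply: eq_cderiv => u; rewrite mulrC.
Qed.

Lemma slit_sub1 z : normc z < 1 -> slit (1 - z).
Proof.
move=> z1; apply: slit_Re; rewrite ReD ReN /= subr_gt0 (le_lt_trans _ z1)//.
by rewrite (le_trans (ler_norm _))// normc_ge_absRe.
Qed.

Lemma cderiv_clog_inv z : slit (1 - z) ->
  has_cderiv (fun t => @clog R (1 - t)^-1) z (1 - z)^-1.
Proof.
move=> sz; have z1 := slit_neq0 sz.
have d1 : has_cderiv (fun t => (1 - t)^-1) z ((1 - z) ^- 2).
  have h1 : has_cderiv (fun t => 1 - t) z (-1).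
    have := cderiv_affine (1 : R[i]) (-1) z.
    by apply: eq_cderiv => u; rewrite mulN1r.
  have := cderiv_comp h1 (cderiv_inv z1).
  by rewrite mulrN1 opprK.
have := cderiv_comp d1 (cderiv_clog (slitV sz)).
suff -> : (1 - z)^-1^-1 * (1 - z) ^- 2 = (1 - z)^-1 by [].
by field.
Qed.

Lemma clog1 : clog (1 : R[i]) = 0.
Proof.
rewrite -[LHS]/(ln (normc (1 : R[i])) +i* carg 1).
by rewrite cargE normc1 /= lexx ln1 divr1 acos1.
Qed.

(** The remainder vanishes at 0 and has derivative t^n / (1 - t), which is small
    on the segment from 0 to z. *)
Lemma clog_taylor_bound z n : normc z <= 1 / 2 ->
  normc (clog (1 - z)^-1 - \sum_(0 <= k < n.+1) z ^+ k / k%:R) <= 2 * 2^-1 ^+ n.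
Proof.
move=> z2; pose f t := @clog R (1 - t)^-1 - \sum_(0 <= k < n.+1) t ^+ k / k%:R.
have df t : normc t < 1 -> has_cderiv f t (t ^+ n / (1 - t)).
  move=> t1; have st := slit_sub1 t1; rewrite /f; elim: n {f} => [|n IH].
    rewrite expr0 div1r; apply: eq_cderiv (cderiv_clog_inv st) => u.
    by rewrite big_nat1 invr0 mulr0 subr0.
  have -> : t ^+ n.+1 / (1 - t) = t ^+ n / (1 - t) + (0 * (t ^+ n.+1 / n.+1%:R) + -1 * t ^+ n).
    by rewrite mul0r exprS; field; exact: slit_neq0.
  have := cderivD IH (cderivM (cderiv_cst (-1) t) (cderivXn t n)).
  apply: eq_cderiv => u.
  by rewrite [X in _ = _ - X]big_nat_recr//= mulN1r opprD addrA.
have f0 : f 0 = 0.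
  rewrite /f subr0 invr1 clog1 big1 ?subr0// => -[|k] _; first by rewrite invr0 mulr0.
  by rewrite exprS !mul0r.
have -> : clog (1 - z)^-1 - \sum_(0 <= k < n.+1) z ^+ k / k%:R = f z - f 0.
  by rewrite f0 subr0.
have hx (x : R) : 0 <= x <= 1 -> normc (x%:C * z) <= 1 / 2.
  move=> /andP[x0 x1]; rewrite normcM normcR ger0_norm//.
  by rewrite (le_trans _ z2)// ler_piMl// normc_ge0.
apply: (@cderiv_segment_bound R f (fun t => t ^+ n / (1 - t))) => x x01.
  by apply: df; rewrite (le_lt_trans (hx x x01))//; lra.
have h2 := hx x x01; set t := x%:C * z in h2 *.
have n1 : 1 / 2 <= normc (1 - t).
  by rewrite (le_trans _ (normcB_ge _ _))// normc1; lra.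
rewrite !normcM normcX normcV.
have a1 : normc t ^+ n <= 2^-1 ^+ n.
  by rewrite lerXn2r ?nnegrE ?normc_ge0// -div1r.
have a2 : (normc (1 - t))^-1 * normc z <= 1.
  by rewrite mulrC ler_pdivrMr ?mul1r; [exact: le_trans n1|exact: lt_le_trans n1].
rewrite -mulrA -[leRHS]mulr1 ler_pM ?exprn_ge0 ?normc_ge0//.
by rewrite mulr_ge0 ?invr_ge0 ?normc_ge0.
Qed.

Lemma clog_taylor r : 0 < r ->
  has_taylor_coefs (fun t => clog (1 / (1 - t / r%:C))) (fun k => (r ^- k / k%:R)%:C).
Proof.
move=> r0; apply/nearcP; exists (r / 2); first by rewrite divr_gt0.
move=> t tr; rewrite add0r; apply/cvg_cseqP => e e0.
have tz : normc (t / r%:C) <= 1 / 2.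
  by rewrite normcM normcV normcR gtr0_norm// ler_pdivrMr//; lra.
have [N _ HN] := near_infty_natSinv_expn_lt (PosNum (divr_gt0 e0 (ltr0n R 2))).
exists N.+1 => -[//|n] nN; rewrite normcBC.
have -> : \sum_(0 <= k < n.+1) (r ^- k / k%:R)%:C * t ^+ k =
    \sum_(0 <= k < n.+1) (t / r%:C) ^+ k / k%:R.
  apply: eq_bigr => k _; rewrite expr_div_n rmorphM !fmorphV rmorphXn rmorph_nat.
  by rewrite mulrC mulrA.
rewrite div1r (le_trans (clog_taylor_bound n tz))//.
have := HN n nN; rewrite /= div1r -exprVn; lra.
Qed.

End TaylorCoefficients.

(** * Cauchy's formula for Taylor coefficients in logarithmic coordinates *)

Section CauchyCoefficients.
Variable R : realType.
Implicit Types (f : R[i] -> R[i]) (c : nat -> R[i]) (z w t v : R[i]) (x y s e r : R).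

Lemma cexpX z n : cexp z ^+ n = cexp (n%:R * z).
Proof.
elim: n => [|n IH]; first by rewrite mul0r cexp0.
by rewrite exprS IH -cexpD -natr1 mulrDl mul1r addrC.
Qed.

Lemma cexp_2pi : cexp (0 +i* (2 * pi)) = 1 :> R[i].
Proof.
rewrite /cexp /= expR0 mulr_natl cos2pi sin2pi mulr0 mul1r.
by [].
Qed.

Lemma cexp_period s x : cexp (s +i* (x + 2 * pi)) = cexp (s +i* x).
Proof.
have -> : s +i* (x + 2 * pi) = s +i* x + 0 +i* (2 * pi).
  by apply/eqP; rewrite eq_complex /= addr0 !eqxx.
by rewrite cexpD cexp_2pi mulr1.
Qed.

Lemma cexp_natB_2pi k n : cexp ((k%:R - n%:R) * (0 +i* (2 * pi))) = 1 :> R[i].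
Proof. by rewrite mulrBl cexpD cexpN -!cexpX cexp_2pi !expr1n divr1. Qed.

Lemma cderiv_cexp_lin l z : has_cderiv (fun w => cexp (l * w)) z (cexp (l * z) * l).
Proof.
have h : has_cderiv (fun w => l * w) z l.
  by apply: eq_cderiv (cderiv_affine 0 l z) => u; rewrite add0r.
exact: cderiv_comp h (cderiv_cexp _).
Qed.

Lemma cderiv_continuous_v f s : (forall x, exists l, has_cderiv f (s +i* x) l) ->
  forall x, ccont (fun x => f (s +i* x)) x.
Proof. by move=> H x; have [l dl] := H x; exact: cderiv_ccont_v dl. Qed.

Lemma cint_cexp k n s y : cint (fun x => cexp ((k%:R - n%:R) * (s +i* x))) y (y + 2 * pi)
  = if k == n then (2 * pi)%:C else 0.
Proof.
have y2 : y <= y + 2 * pi by rewrite lerDl mulr_ge0// pi_ge0.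
case: eqVneq => [->|kn].
  rewrite (@eq_cint _ _ (fun=> 1)); first by rewrite cint_cst// mul1r addrAC subrr add0r.
  by move=> x _; rewrite subrr mul0r cexp0.
set p : R[i] := k%:R - n%:R.
have p0 : p != 0 by rewrite subr_eq0 eqr_nat.
have i0 : 'i != 0 :> R[i] by rewrite eq_complex /= oner_eq0 andbF.
pose F w := cexp (p * w) / ('i * p).
have dF w : has_cderiv F w (cexp (p * w) * 'i^-1).
  have := cderivM (cderiv_cexp_lin p w) (cderiv_cst ('i * p)^-1 w).
  by rewrite mulr0 addr0 /F invfM mulrA (mulrAC _ p) mulfK.
have cE w : cexp (p * w) * 'i^-1 * 'i = cexp (p * w) by rewrite divfK.
have path x : s +i* x = s%:C + x%:C * 'i.
  by apply/eqP; rewrite eq_complex /=; apply/andP; split; apply/eqP; ring.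
have dRI x : is_derive x 1 (fun x => complex.Re (F (s +i* x))) (complex.Re (cexp (p * (s +i* x))))
    /\ is_derive x 1 (fun x => complex.Im (F (s +i* x))) (complex.Im (cexp (p * (s +i* x)))).
  have := @cderiv_is_derive R F s%:C 'i x _ (dF _).
  rewrite cE -path.
  have -> : (fun y : R => complex.Re (F (s%:C + y%:C * 'i))) = (fun y => complex.Re (F (s +i* y))).
    by apply/funext => u; rewrite path.
  have -> : (fun y : R => complex.Im (F (s%:C + y%:C * 'i))) = (fun y => complex.Im (F (s +i* y))).
    by apply/funext => u; rewrite path.
  by [].
transitivity (F (s +i* (y + 2 * pi)) - F (s +i* y)).
  apply: (@cint_FTC _ _ (fun x => F (s +i* x))) => //.
  - by move=> x; have [] := dRI x.
  - by move=> x; have [] := dRI x.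
  - apply: (@cderiv_continuous_v (fun w => cexp (p * w))) => x.
    by exists (cexp (p * (s +i* x)) * p); exact: cderiv_cexp_lin.
have -> : s +i* (y + 2 * pi) = s +i* y + 0 +i* (2 * pi).
  by apply/eqP; rewrite eq_complex /= addr0 !eqxx.
by rewrite /F mulrDr cexpD cexp_natB_2pi mulr1 subrr.
Qed.

Lemma cintegrable_sum (g : nat -> R -> R[i]) c a b n :
  (forall k, cintegrable (g k) a b) ->
  cintegrable (fun x => \sum_(0 <= k < n) c k * g k x) a b.
Proof.
move=> Ig; elim: n => [|n IH].
  apply: (@eq_cintegrable _ (fun=> 0)); first by move=> x _; rewrite big_geq.
  by apply: ccont_integrable => x _; exact: ccont_cst.
apply: (@eq_cintegrable _ (fun x => \sum_(0 <= k < n) c k * g k x + c n * g n x)).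
  by move=> x _; rewrite big_nat_recr.
by apply: cintegrableD => //; exact: cintegrableZ.
Qed.

Lemma cint_sum (g : nat -> R -> R[i]) c a b n : a <= b ->
  (forall k, cintegrable (g k) a b) ->
  cint (fun x => \sum_(0 <= k < n) c k * g k x) a b = \sum_(0 <= k < n) c k * cint (g k) a b.
Proof.
move=> ab Ig; elim: n => [|n IH].
  rewrite big_geq// (@eq_cint _ _ (fun=> 0)) ?cint_cst ?mul0r//.
  by move=> x _; rewrite big_geq.
rewrite big_nat_recr//= -IH -cintZ// -cintD.
- by apply: eq_cint => x _; rewrite big_nat_recr.
- exact: cintegrable_sum.
- exact: cintegrableZ.
Qed.

(** In the coordinate t = r exp(w), dt / t^(n + 1) is exp(- n w) dw / r^n, and
    the circle of radius r exp(s) becomes a vertical segment of length 2 pi and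
    abscissa s. *)
Definition circle_integrand f r n w := f (r%:C * cexp w) * cexp (- n%:R * w).

(** On small circles the series converges uniformly, so it may be integrated term
    by term; only the exponential of exponent 0 has a nonzero integral over a
    period. *)
Lemma cauchy_coefficient f c r : 0 < r -> has_taylor_coefs f c ->
  exists s0 : R, forall s n y, s <= s0 ->
    (forall x, ccont (fun x => circle_integrand f r n (s +i* x)) x) ->
    cint (fun x => circle_integrand f r n (s +i* x)) y (y + 2 * pi) =
      (2 * pi)%:C * (c n * r%:C ^+ n).
Proof.
move=> r0 /taylor_tail[tau tau0 [N0 tail]].
exists (ln (tau / r)) => s n y ss cG.
have y2 : y <= y + 2 * pi by rewrite lerDl mulr_ge0// pi_ge0.
have IG : cintegrable (fun x => circle_integrand f r n (s +i* x)) y (y + 2 * pi).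
  by apply: ccont_integrable.
have nt x : normc (r%:C * cexp (s +i* x)) <= tau.
  rewrite normcM normcR normc_cexp gtr0_norm//= -ler_pdivlMl// mulrC.
  by rewrite -[leRHS]lnK ?posrE ?divr_gt0// ler_expR.
pose g k x := cexp ((k%:R - n%:R) * (s +i* x)).
have Ig k : cintegrable (g k) y (y + 2 * pi).
  apply: ccont_integrable => x _; apply: (@cderiv_continuous_v (fun w => cexp (_ * w))) => u.
  by eexists; exact: cderiv_cexp_lin.
pose S m x := \sum_(0 <= k < m) (c k * r%:C ^+ k) * g k x.
have IS m : cintegrable (S m) y (y + 2 * pi) by exact: cintegrable_sum.
have cS m : (n < m)%N -> cint (S m) y (y + 2 * pi) = (2 * pi)%:C * (c n * r%:C ^+ n).
  move=> nm; rewrite cint_sum// (bigD1_seq n) ?mem_index_iota ?iota_uniq//=.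
  rewrite cint_cexp eqxx big1 ?addr0; first by rewrite mulrC.
  by move=> k /negbTE kn; rewrite /g cint_cexp kn mulr0.
(* The modulus of exp(- n w) on the segment. *)
pose E := expR (- n%:R * s).
have diff m x : (N0 <= m)%N ->
    normc (circle_integrand f r n (s +i* x) + -1 * S m x) <= 2 * 2^-1 ^+ m * E.
  move=> mN; set w := s +i* x.
  have -> : circle_integrand f r n w + -1 * S m x =
      (f (r%:C * cexp w) - \sum_(0 <= k < m) c k * (r%:C * cexp w) ^+ k) * cexp (- n%:R * w).
    rewrite /circle_integrand mulrBl mulN1r; congr (_ - _).
    rewrite /S mulr_suml; apply: eq_bigr => k _; rewrite /g exprMn cexpX.
    by rewrite mulrBl -mulNr cexpD -!mulrA.
  rewrite normcM normc_cexp; have -> : complex.Re (- n%:R * w) = - n%:R * s.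
    by rewrite -(rmorph_nat (real_complex R)) ReM ReN ImN /=; ring.
  by rewrite ler_wpM2r ?expR_ge0//; apply: tail => //; exact: nt.
apply/eqP; rewrite -subr_eq0 -normc_eq0 eq_le normc_ge0 andbT.
apply/ler_addgt0Pr => e e0; rewrite add0r.
pose A : R := 2 * (2 * E * (2 * pi)) + 1.
have A0 : 0 < A by rewrite ltr_wpDl// !mulr_ge0 ?pi_ge0 ?expR_ge0.
have [M _ HM] := near_infty_natSinv_expn_lt (PosNum (divr_gt0 e0 A0)).
pose m := (maxn n.+1 (maxn N0 M)).
have mn : (n < m)%N by rewrite /m leq_max leqnn.
have mN : (N0 <= m)%N by rewrite /m !leq_max leqnn orbT.
have mM : (M <= m)%N by rewrite /m !leq_max leqnn !orbT.
have -> : cint (fun x => circle_integrand f r n (s +i* x)) y (y + 2 * pi) -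
   (2 * pi)%:C * (c n * r%:C ^+ n) =
   cint (fun x => circle_integrand f r n (s +i* x) + -1 * S m x) y (y + 2 * pi).
  by rewrite cintD ?cintZ ?cS ?mulN1r//; exact: cintegrableZ.
rewrite (le_trans (cint_bound y2 _ (fun x _ => diff m x mN)))//.
  by apply: cintegrableD => //; exact: cintegrableZ.
have := HM m mM; rewrite /= div1r -exprVn ltr_pdivlMr// /A => h.
apply: le_trans (ltW h).
have p0 : 0 <= 2^-1 ^+ m :> R by rewrite exprn_ge0.
rewrite -subr_ge0; set z := (X in 0 <= X).
have -> : z = 2^-1 ^+ m by rewrite /z; ring.
exact: p0.
Qed.

(** Boundedness is local and passes from four quarters to their union. *)
Lemma cdiff_bounded (G : R[i] -> R[i]) (a b p q : R) : a <= b -> p <= q ->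
  cdiff_on_rect G a b p q ->
  exists B, forall s x, a <= s <= b -> p <= x <= q -> normc (G (s +i* x)) <= B.
Proof.
move=> ab pq dG.
have := @rect_bisection R a p (b - a) (q - p) (fun s x u =>
  exists B, forall s' x', s <= s' <= s + u * (b - a) -> x <= x' <= x + u * (q - p) ->
    normc (G (s' +i* x')) <= B).
rewrite !mul1r !subrKC; apply; rewrite ?subr_ge0//.
- move=> s x u u0 _ [B1 H1] [B2 H2] [B3 H3] [B4 H4].
  exists (Num.max (Num.max B1 B2) (Num.max B3 B4)) => s' x' /andP[s1 s2] /andP[x1 x2].
  have es : u * (b - a) = u / 2 * (b - a) + u / 2 * (b - a) by field.
  have ex : u * (q - p) = u / 2 * (q - p) + u / 2 * (q - p) by field.
  rewrite es addrA in s2; rewrite ex addrA in x2.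
  rewrite !le_max.
  case: (leP s' (s + u / 2 * (b - a))) => hs; case: (leP x' (x + u / 2 * (q - p))) => hx.
  + by rewrite H1 ?s1 ?x1.
  + by rewrite H3 ?s1 ?(ltW hx) ?orbT.
  + by rewrite H2 ?x1 ?(ltW hs) ?orbT.
  + by rewrite H4 ?(ltW hs) ?(ltW hx) ?orbT.
- move=> s0 x0 hs0 hx0; have [l dl] := dG _ _ hs0 hx0.
  have [d d0 H] := cderiv_cont dl ltr01.
  pose D := (b - a) + (q - p) + 1.
  have D0 : 0 < D by rewrite ltr_wpDl// addr_ge0 ?subr_ge0.
  exists (d / D); first by rewrite divr_gt0.
  move=> s x u /andP[u0 ud] _ hs hx; exists (1 + normc (G (s0 +i* x0))) => s' x' hs' hx'.
  have := H ((s' - s0) +i* (x' - x0)).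
  have -> : s0 +i* x0 + (s' - s0) +i* (x' - x0) = s' +i* x'.
    by apply/eqP; rewrite eq_complex /= !subrKC !eqxx.
  move=> {}H; have {}H : normc (G (s' +i* x') - G (s0 +i* x0)) <= 1.
    apply: H; rewrite (le_lt_trans (normc_le_ReIm _))//=.
    have := dist_in_itv hs' hs; have := dist_in_itv hx' hx => h1 h2.
    rewrite (le_lt_trans (lerD h2 h1))// -mulrDr.
    by move: ud; rewrite ltr_pdivlMr// /D; lra.
  by rewrite -(subrK (G (s0 +i* x0)) (G (s' +i* x'))) (le_trans (normcD _ _))// lerD2r.
Qed.

End CauchyCoefficients.

(** * Decay of coefficients from the singularity on the circle of convergence *)

Section Transfer.
Variable R : realType.
Implicit Types (f : R[i] -> R[i]) (c : nat -> R[i]) (z w t v : R[i]) (x y s e r : R).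

(** A domain of holomorphy in the coordinate t = r exp(s + i x): the disk
    |t| < r is s < 0, and beyond it a cone-shaped neighborhood of the real
    half-line from r on is left out.  The condition is periodic in [x]. *)
Definition log_region (kap eta : R) s x :=
  s < 0 \/ (s < eta /\ (cos x <= 0 \/ s < kap * `|sin x|)).

(** Away from the singularity by the angle [x0], the abscissa may grow up to a
    multiple of sin x0 inside [log_region]. *)
Lemma sin_ge_away x0 x : 0 < x0 -> x0 <= pi / 2 -> x0 <= x <= 2 * pi - x0 ->
  cos x <= 0 \/ sin x0 <= `|sin x|.
Proof.
move=> x00 x0p /andP[x1 x2]; have p0 := pi_gt0 R.
have [cx|cx] := leP (cos x) 0; first by left.
right.
have cle y : x0 <= y <= pi -> cos y <= cos x0.
  move=> /andP[y1 y2]; rewrite leNgt ltr_cos -?leNgt// in_itv /=; apply/andP; split=> //; lra.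
have cxx : cos x <= cos x0.
  have [xp|xp] := leP x pi; first by apply: cle; rewrite x1.
  have -> : cos x = cos (pi *+ 2 - x) by rewrite cosB cos2pi sin2pi mul1r mul0r addr0.
  by apply: cle; rewrite -mulr_natl; apply/andP; split; lra.
have s0 : 0 <= sin x0 by apply: sin_ge0_pi; apply/andP; split; lra.
rewrite -(ger0_norm s0) -!sqrtr_sqr ler_sqrt ?sqr_ge0// !sin2cos2.
by rewrite lerB// lerXn2r// nnegrE (ltW (lt_le_trans cx cxx), ltW cx)// ltW.
Qed.

Section ContourBound.
Variables (f : R[i] -> R[i]) (c : nat -> R[i]) (r kap eta C dlt : R).
Hypotheses (r0 : 0 < r) (C0 : 0 <= C) (fc : has_taylor_coefs f c).
Hypothesis df : forall s x, log_region kap eta s x ->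
  exists l, has_cderiv f (r%:C * cexp (s +i* x)) l.
Hypothesis nf : forall s x, log_region kap eta s x -> `|s| <= dlt -> `|x| <= dlt ->
  normc (f (r%:C * cexp (s +i* x))) <= C * (`|s| + `|x|).

Let G n := circle_integrand f r n.

Lemma circle_integrand_cderiv n s x : log_region kap eta s x ->
  exists l, has_cderiv (G n) (s +i* x) l.
Proof.
move=> /df[l dl]; have d1 := cderivM (cderiv_cst r%:C (s +i* x)) (cderiv_cexp (s +i* x)).
have d2 := cderiv_comp d1 dl.
eexists; exact: (cderivM d2 (cderiv_cexp_lin (- n%:R) (s +i* x))).
Qed.

Lemma circle_integrand_period n s x : G n (s +i* (x + 2 * pi)) = G n (s +i* x).
Proof.
rewrite /G /circle_integrand cexp_period; congr (_ * _).
by rewrite !mulNr !cexpN -!cexpX cexp_period.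
Qed.

Lemma circle_integrand_norm n s x :
  normc (G n (s +i* x)) = normc (f (r%:C * cexp (s +i* x))) * expR (- (n%:R * s)).
Proof.
rewrite /G /circle_integrand normcM normc_cexp; congr (_ * expR _).
by rewrite -(rmorph_nat (real_complex R)) ReM ReN ImN /=; ring.
Qed.

(** By Cauchy's theorem the integral over a circle inside the disk does not
    depend on its radius: the horizontal sides cancel by periodicity. *)
Lemma cauchy_coefficient_shift n s y : s < 0 ->
  cint (fun x => G n (s +i* x)) y (y + 2 * pi) = (2 * pi)%:C * (c n * r%:C ^+ n).
Proof.
move=> s_lt0; have [s0 H] := cauchy_coefficient r0 fc.
(* Far enough to the left the series formula is available. *)
pose sm := Num.min s0 s.
have sms : sm <= s by rewrite ge_min lexx orbT.
have y2 : y <= y + 2 * pi by rewrite lerDl mulr_ge0// pi_ge0.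
have reg u x : u <= s -> log_region kap eta u x by move=> us; left; exact: le_lt_trans s_lt0.
have <- : cint (fun x => G n (sm +i* x)) y (y + 2 * pi) = (2 * pi)%:C * (c n * r%:C ^+ n).
  apply: H; first by rewrite ge_min lexx.
  by apply: cderiv_continuous_v => x; apply: circle_integrand_cderiv; exact: reg.
have dG : cdiff_on_rect (G n) sm s y (y + 2 * pi).
  by move=> t x /andP[_ ts] _; apply: circle_integrand_cderiv; exact: reg.
have := goursat_rect sms y2 dG; rewrite /boundary_int.
have -> : cint (fun u => G n (u +i* (y + 2 * pi))) sm s = cint (fun u => G n (u +i* y)) sm s.
  by apply: eq_cint => t _; rewrite circle_integrand_period.
set A := cint _ sm s; rewrite (addrC A) addrK -mulrBr => /eqP.
have i0 : 'i != 0 :> R[i] by rewrite eq_complex /= oner_eq0 andbF.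
by rewrite mulf_eq0 (negbTE i0) /= subr_eq0 => /eqP.
Qed.

(** The contour stays at abscissa -sg < 0 for |x| <= x0, moves horizontally to
    s1 > 0 and stays there for the rest of the period.  The three terms bound
    the arc near the singularity and the two horizontal segments, where
    |f| is at most C (|s| + |x|), and the outer arc, where the integrand is
    exponentially small. *)
Lemma contour_bound n (x0 s1 sg B : R) : 0 < x0 -> x0 <= pi / 2 -> x0 <= dlt ->
  0 < sg -> 0 < s1 -> sg + s1 <= dlt -> s1 < eta -> s1 < kap * sin x0 ->
  0 < kap ->
  (forall x, x0 <= x <= 2 * pi - x0 -> normc (f (r%:C * cexp (s1 +i* x))) <= B) ->
  2 * pi * (normc (c n) * r ^+ n) <=
    2 * (C * (sg + x0) * expR (n%:R * sg) * (2 * x0))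
    + 2 * (2 * (C * (sg + s1 + x0) * expR (n%:R * sg) * (s1 + sg)))
    + 2 * (B * expR (- (n%:R * s1)) * (2 * pi)).
Proof.
move=> x00 x0p x0d sg0 s10 sd s1e s1k kap0 fB.
have p0 := pi_gt0 R; have dlt0 : 0 < dlt by lra.
have s1sg : s1 <= dlt by lra.
have sgd : sg <= dlt by lra.
have reg s x : s <= s1 -> x0 <= x <= 2 * pi - x0 -> log_region kap eta s x.
  move=> ss hx; have [s_lt0|s_ge0] := ltP s 0; [by left|right].
  split; first exact: le_lt_trans s1e.
  have [h|h] := sin_ge_away x00 x0p hx; [by left|right].
  by rewrite (le_lt_trans ss)// (lt_le_trans s1k)// ler_wpM2l// ltW.
have E0 := expR_ge0 (n%:R * sg).
have eb s : - sg <= s -> expR (- (n%:R * s)) <= expR (n%:R * sg).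
  by move=> h; rewrite ler_expR -mulrN ler_wpM2l// lerNl.
have nxx : - x0 <= x0 by lra.
have xx : x0 <= 2 * pi - x0 by lra.
have ss1 : - sg <= s1 by lra.
have e2 : 2 * pi - x0 = - x0 + 2 * pi by rewrite addrC.
have sg_lt0 : - sg < 0 by rewrite oppr_lt0.
have cG : forall x, ccont (fun x => G n (- sg +i* x)) x.
  by apply: cderiv_continuous_v => x; apply: circle_integrand_cderiv; left.
have main : (2 * pi)%:C * (c n * r%:C ^+ n) =
    cint (fun x => G n (- sg +i* x)) (- x0) x0 +
    cint (fun x => G n (- sg +i* x)) x0 (2 * pi - x0).
  rewrite -(cauchy_coefficient_shift n (- x0) sg_lt0) -e2; apply: cint_cat.
    by rewrite nxx xx.
  exact: ccont_integrable.
have dG : cdiff_on_rect (G n) (- sg) s1 x0 (2 * pi - x0).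
  by move=> s x /andP[_ hs] hx; apply: circle_integrand_cderiv; exact: reg.
have := goursat_rect ss1 xx dG; rewrite /boundary_int.
set bot := cint (fun s => G n (s +i* x0)) _ _.
set top := cint (fun s => G n (s +i* (2 * pi - x0))) _ _.
set rgt := cint (fun x => G n (s1 +i* x)) _ _.
set lft := cint (fun x => G n (- sg +i* x)) x0 _ in main *.
move=> gz.
have lE : lft = rgt - 'i * (bot - top).
  have ii : 'i * 'i = -1 :> R[i] by rewrite -expr2 sqr_i.
  have : 'i * (bot + 'i * rgt - top - 'i * lft) = 0 by rewrite gz mulr0.
  rewrite !mulrDr !mulrN !mulrA !ii !mulN1r opprK => h.
  by apply/eqP; rewrite -subr_eq0 -h; apply/eqP; ring.
have ni z : normc ('i * z) = normc z.
  by rewrite normcM /= expr0n expr1n add0r sqrtr1 mul1r.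
have b1 : normc (cint (fun x => G n (- sg +i* x)) (- x0) x0) <=
    2 * (C * (sg + x0) * expR (n%:R * sg) * (2 * x0)).
  rewrite (_ : 2 * x0 = x0 - - x0); last ring.
  apply: cint_bound => //; first exact: ccont_integrable.
  move=> x hx; have xa : `|x| <= x0 by rewrite ler_norml.
  rewrite circle_integrand_norm ler_pM ?normc_ge0 ?expR_ge0 ?eb//.
  apply: le_trans (nf _ _ _) _; [by left| |exact: le_trans x0d|].
    by rewrite normrN gtr0_norm.
  by rewrite ler_wpM2l// normrN gtr0_norm// lerD2l.
have sabs s : - sg <= s <= s1 -> `|s| <= sg + s1.
  by move=> /andP[h1 h2]; rewrite ler_norml; apply/andP; split; lra.
have b2 : normc bot <= 2 * (C * (sg + s1 + x0) * expR (n%:R * sg) * (s1 + sg)).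
  rewrite -[X in s1 + X]opprK; apply: cint_bound => //.
    by apply: (cdiff_on_rect_h dG); rewrite lexx.
  move=> s hs; have /andP[hs1 hs2] := hs.
  rewrite circle_integrand_norm ler_pM ?normc_ge0 ?expR_ge0 ?eb//.
  apply: le_trans (nf _ _ _) _.
  - by apply: reg => //; rewrite lexx.
  - exact: le_trans (sabs _ hs) sd.
  - by rewrite gtr0_norm.
  - by rewrite ler_wpM2l// (gtr0_norm x00) lerD2r sabs.
have b3 : normc top <= 2 * (C * (sg + s1 + x0) * expR (n%:R * sg) * (s1 + sg)).
  rewrite -[X in s1 + X]opprK; apply: cint_bound => //.
    by apply: (cdiff_on_rect_h dG); rewrite lexx andbT.
  move=> s hs; have /andP[hs1 hs2] := hs.
  rewrite e2 circle_integrand_period circle_integrand_norm ler_pM ?normc_ge0 ?expR_ge0 ?eb//.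
  apply: le_trans (nf _ _ _) _.
  - have : log_region kap eta s x0 by apply: reg => //; rewrite lexx.
    by rewrite /log_region cosN sinN normrN.
  - exact: le_trans (sabs _ hs) sd.
  - by rewrite normrN gtr0_norm.
  - by rewrite ler_wpM2l// normrN (gtr0_norm x00) lerD2r sabs.
have b4 : normc rgt <= 2 * (B * expR (- (n%:R * s1)) * (2 * pi)).
  have B0 : 0 <= B by apply: le_trans (fB x0 _); rewrite ?normc_ge0// lexx.
  apply: (@le_trans _ _ (2 * (B * expR (- (n%:R * s1)) * (2 * pi - x0 - x0)))).
    apply: cint_bound => //; first by apply: (cdiff_on_rect_v dG); rewrite lexx andbT.
    by move=> x hx; rewrite circle_integrand_norm ler_wpM2r ?expR_ge0// fB.
  rewrite ler_wpM2l// ler_wpM2l ?mulr_ge0 ?expR_ge0//; lra.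
have nE : 2 * pi * (normc (c n) * r ^+ n) = normc ((2 * pi)%:C * (c n * r%:C ^+ n)).
  rewrite !normcM normcX !normcR (ger0_norm (ltW r0)) ger0_norm//.
  by rewrite mulr_ge0// ltW.
rewrite nE main lE (le_trans (normcD _ _))//.
have := normcB rgt ('i * (bot - top)); rewrite ni; have := normcB bot top.
move: b1 b2 b3 b4; do 6 !move: (normc _); move: (2 * _) (2 * _) (2 * _) => *; lra.
Qed.

End ContourBound.

(** Any power above 4 would do in place of 5: the outer arc has to beat
    n = q^4 with exp(- c q). *)
Lemma expRN_le_pow5 (y : R) : 0 < y -> expR (- y) <= (5 / y) ^+ 5.
Proof.
move=> y0; have y5 : 0 < y / 5 by rewrite divr_gt0.
have -> : - y = - (5%:R * (y / 5)) by field.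
rewrite expRN expRM_natl -exprVn lerXn2r ?nnegrE ?invr_ge0 ?expR_ge0//.
  by rewrite divr_ge0// ltW.
rewrite -[5 / y]invf_div lef_pV2 ?posrE ?expR_gt0//.
by rewrite (le_trans _ (expR_ge1Dx _))// lerDr.
Qed.

Lemma sin_small : exists2 d : R, 0 < d &
  forall h : R, 0 <= h < d -> h / 2 <= sin h <= 2 * h.
Proof.
have h0 : 0 < 1 / 2 :> R by [].
have [d d0 H] := is_derive_eps (is_derive_sin (0 : R)) h0.
exists d => // h /andP[h00 hd]; have := H h.
rewrite ger0_norm// add0r sin0 cos0 subr0 mul1r => /(_ hd).
by rewrite ler_norml => /andP[h1 h2]; apply/andP; split; lra.
Qed.

(** Near the singularity the first-order bound applies, on both sides of the
    period; the rest is a compact rectangle. *)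
Lemma bounded_away_singularity f r kap eta C dlt x1 eta1 :
  0 <= C -> 0 <= kap ->
  (forall s x, log_region kap eta s x -> exists l, has_cderiv f (r%:C * cexp (s +i* x)) l) ->
  (forall s x, log_region kap eta s x -> `|s| <= dlt -> `|x| <= dlt ->
    normc (f (r%:C * cexp (s +i* x))) <= C * (`|s| + `|x|)) ->
  0 < x1 -> x1 <= pi / 2 -> x1 <= dlt -> 0 <= eta1 -> eta1 <= dlt -> eta1 < eta ->
  eta1 < kap * sin x1 ->
  exists B, forall s x, 0 <= s <= eta1 -> log_region kap eta s x -> 0 <= x <= 2 * pi ->
    normc (f (r%:C * cexp (s +i* x))) <= B.
Proof.
move=> C0 kap0 df nf x10 x1p x1d eta10 eta1d eta1e eta1k; have p0 := pi_gt0 R.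
have dG : cdiff_on_rect (fun w => f (r%:C * cexp w)) 0 eta1 x1 (2 * pi - x1).
  move=> s x /andP[s0 s1] hx.
  have [l dl] : exists l, has_cderiv f (r%:C * cexp (s +i* x)) l.
    apply: df; right; split; first exact: le_lt_trans eta1e.
    have [h|h] := sin_ge_away x10 x1p hx; [by left|right].
    by rewrite (le_lt_trans s1)// (lt_le_trans eta1k)// ler_wpM2l.
  have d1 := cderivM (cderiv_cst r%:C (s +i* x)) (cderiv_cexp (s +i* x)).
  by eexists; exact: (cderiv_comp d1 dl).
have x1x1 : x1 <= 2 * pi - x1 by lra.
have [B HB] := cdiff_bounded eta10 x1x1 dG.
exists (Num.max B (C * (eta1 + x1))) => s x hs hreg /andP[hx0 hx2].
rewrite le_max; have /andP[s0 s1] := hs.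
have near y : log_region kap eta s y -> `|y| <= x1 ->
    normc (f (r%:C * cexp (s +i* y))) <= C * (eta1 + x1).
  move=> hy yx; apply: le_trans (nf _ _ hy _ _) _.
  - by rewrite ger0_norm// (le_trans s1).
  - exact: le_trans x1d.
  - by rewrite ler_wpM2l// lerD// ger0_norm.
have [xx1|xx1] := leP x x1.
  by apply/orP; right; apply: near => //; rewrite ger0_norm.
have [xx2|xx2] := leP x (2 * pi - x1).
  by apply/orP; left; apply: HB; rewrite // (ltW xx1) xx2.
apply/orP; right.
have xE : x = (x - 2 * pi) + 2 * pi by rewrite subrK.
rewrite xE cexp_period; apply: near; last by rewrite ler_norml; apply/andP; split; lra.
rewrite /log_region.
have -> : cos (x - 2 * pi) = cos x by rewrite cosB mulr_natl cos2pi sin2pi mulr1 mulr0 addr0.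
have -> : sin (x - 2 * pi) = sin x by rewrite sinB mulr_natl cos2pi sin2pi mulr1 mulr0 subr0.
exact: hreg.
Qed.

Lemma half_lt (a : R) : 0 < a -> a / 2 < a.
Proof. by move=> a0; rewrite ltr_pdivrMr// ltr_pMr// ltr1n. Qed.

(** With q = n^(1/4), the contour of [contour_bound] is used with sg = q^-4 and
    x0 = q^-3, s1 being of the order of x0.  Then n sg = 1, so exp(n sg) is
    constant; the pieces near the singularity have length and integrand O(q^-3)
    and contribute O(q^-6); on the outer arc n s1 is of the order of q.  The
    total, multiplied by n = q^4, is O(1 / q). *)
Theorem coefficient_littleo f c r kap eta C dlt : 0 < r -> 0 < kap -> 0 < eta ->
  0 <= C -> 0 < dlt -> has_taylor_coefs f c ->
  (forall s x, log_region kap eta s x -> exists l, has_cderiv f (r%:C * cexp (s +i* x)) l) ->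
  (forall s x, log_region kap eta s x -> `|s| <= dlt -> `|x| <= dlt ->
    normc (f (r%:C * cexp (s +i* x))) <= C * (`|s| + `|x|)) ->
  forall e, 0 < e -> exists N : nat, forall n : nat, (N <= n)%N ->
    n%:R * (normc (c n) * r ^+ n) <= e.
Proof.
move=> r0 kap0 eta0 C0 dlt0 fc df nf e e0; have p0 := pi_gt0 R.
have [d3 d30 hsin] := sin_small.
(* The angle [x1] and abscissa [eta1] delimit the rectangle on which the outer
   arc is uniformly bounded, once x0 <= x1 and s1 <= eta1. *)
pose x1 := Num.min dlt (Num.min (pi / 2) (d3 / 2)).
have x10 : 0 < x1 by rewrite !lt_min dlt0 !divr_gt0.
have x1d : x1 <= dlt by rewrite ge_min lexx.
have x1p : x1 <= pi / 2 by rewrite !ge_min lexx !orbT.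
have x1d3 : x1 < d3 by rewrite !gt_min half_lt ?orbT.
have sx1 : 0 < sin x1.
  have /andP[h _] := hsin x1 (introT andP (conj (ltW x10) x1d3)).
  by apply: lt_le_trans h; rewrite divr_gt0.
pose eta1 := Num.min dlt (Num.min (eta / 2) (kap * sin x1 / 2)).
have ks : 0 < kap * sin x1 by rewrite mulr_gt0.
have eta10 : 0 < eta1 by rewrite !lt_min dlt0 !divr_gt0.
have eta1d : eta1 <= dlt by rewrite ge_min lexx.
have eta1e : eta1 < eta by rewrite !gt_min half_lt ?orbT.
have eta1k : eta1 < kap * sin x1.
  by rewrite !gt_min half_lt ?orbT.
have [B HB] := bounded_away_singularity C0 (ltW kap0) df nf x10 x1p x1d (ltW eta10) eta1d eta1e eta1k.
pose B' := Num.max 0 B; have B'0 : 0 <= B' by rewrite le_max lexx.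
pose E : R := expR 1; have E0 : 0 <= E := expR_ge0 1.
pose K := 8 * (C * E) + 4 * (C * E * ((2 + kap) * (1 + kap))) + 4 * pi * B' * (20 / kap) ^+ 5.
have CE0 : 0 <= C * E by exact: mulr_ge0.
have k20 : 0 <= (20 / kap) ^+ 5 by rewrite exprn_ge0// divr_ge0// ltW.
have kk : 0 <= (2 + kap) * (1 + kap) by rewrite mulr_ge0//; lra.
have a0 : 0 <= 8 * (C * E) + 4 * (C * E * ((2 + kap) * (1 + kap))).
  by rewrite addr_ge0// mulr_ge0// mulr_ge0.
have K0 : 0 <= K.
  by rewrite /K addr_ge0// mulr_ge0// mulr_ge0// mulr_ge0// ltW.
(* A sum rather than a maximum of the lower bounds required of n^(1/4). *)
pose Q := 1 + 1 / x1 + (1 + kap) / dlt + kap / eta1 + K / e.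
have [q1 q2 q3 q4] : [/\ 0 <= 1 / x1, 0 <= (1 + kap) / dlt, 0 <= kap / eta1 & 0 <= K / e].
  have kap1 : 0 <= 1 + kap by rewrite addr_ge0// ltW.
  by split; apply: divr_ge0 => //; exact: ltW.
have Q1 : 1 <= Q by rewrite /Q -!addrA lerDl addr_ge0// addr_ge0// addr_ge0.
exists (Num.bound (Q ^+ 4)) => n nN.
pose q := Num.sqrt (Num.sqrt n%:R) : R.
have q4n : q ^+ 4 = n%:R by rewrite (exprM q 2 2) !sqr_sqrtr// sqrtr_ge0.
have qQ : Q <= q.
  have Qn : Q ^+ 4 <= q ^+ 4.
    rewrite q4n (le_trans (ltW (archi_boundP _)))//; last by rewrite ler_nat.
    by rewrite exprn_ge0// (le_trans ler01).
  have := Qn; rewrite ler_pXn2r// nnegrE ?sqrtr_ge0// (le_trans ler01)//.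
have qx1 : 1 / x1 <= q by apply: le_trans qQ; rewrite /Q; lra.
have qdlt : (1 + kap) / dlt <= q by apply: le_trans qQ; rewrite /Q; lra.
have qeta1 : kap / eta1 <= q by apply: le_trans qQ; rewrite /Q; lra.
have qe : K / e <= q by apply: le_trans qQ; rewrite /Q; lra.
have q1' : 1 <= q by exact: le_trans qQ.
clear qQ Q1 q1 q2 q3 q4 Q nN.
have q0 : 0 < q by exact: lt_le_trans q1'.
pose x0 := q ^- 3; pose sg := q ^- 4; pose s1 := kap / 2 * sin x0.
have x00 : 0 < x0 by rewrite invr_gt0 exprn_gt0.
have sg0 : 0 < sg by rewrite invr_gt0 exprn_gt0.
have x0q : x0 <= q^-1.
  by rewrite /x0 lef_pV2 ?posrE ?exprn_gt0// exprSr ler_peMl ?exprn_ege1// ltW.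
have sgx0 : sg <= x0.
  by rewrite /x0 /sg lef_pV2 ?posrE ?exprn_gt0// (exprS q 3) ler_peMl ?exprn_ge0// ltW.
have qV (a b : R) : 0 < b -> a / b <= q -> a * q^-1 <= b.
  by move=> b0; rewrite !ler_pdivrMr// mulrC.
have x0x1 : x0 <= x1 by rewrite (le_trans x0q)// -[q^-1]mul1r qV.
have /andP[sx0 sx0'] := hsin x0 (introT andP (conj (ltW x00) (le_lt_trans x0x1 x1d3))).
have s1x : s1 <= kap * x0.
  by rewrite /s1; have := ler_wpM2l (ltW kap0) sx0'; lra.
have s1x' : kap / 4 * x0 <= s1.
  by rewrite /s1; have := ler_wpM2l (ltW kap0) sx0; lra.
have s10 : 0 < s1 by apply: lt_le_trans s1x'; rewrite mulr_gt0// divr_gt0.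
have kx0 : kap * x0 <= kap * q^-1 by rewrite ler_wpM2l// ltW.
have s1eta1 : s1 <= eta1 by rewrite (le_trans s1x)// (le_trans kx0)// qV.
have sgs1 : sg + s1 <= dlt.
  by have := qV _ _ dlt0 qdlt; rewrite mulrDl mul1r; lra.
have s1k : s1 < kap * sin x0.
  have : 0 < sin x0 by apply: lt_le_trans sx0; rewrite divr_gt0.
  by move=> /(mulr_gt0 kap0); rewrite /s1; lra.
have x0p : x0 <= pi / 2 by exact: le_trans x1p.
have x0d : x0 <= dlt by exact: le_trans x1d.
have s1e : s1 < eta by exact: le_lt_trans eta1e.
(* The factor 1 / 2 in [s1] keeps the outer arc strictly inside the region. *)
have fB x : x0 <= x <= 2 * pi - x0 -> normc (f (r%:C * cexp (s1 +i* x))) <= B'.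
  move=> hx; rewrite le_max; apply/orP; right; apply: HB.
  - by rewrite (ltW s10).
  - right; split=> //; have [h|h] := sin_ge_away x00 x0p hx; [by left|right].
    by rewrite (lt_le_trans s1k)// ler_wpM2l// ltW.
  - by move/andP: hx => [h1 h2]; apply/andP; split; lra.
have := contour_bound r0 C0 fc df nf n x00 x0p x0d sg0 s10 sgs1 s1e s1k kap0 fB.
have -> : n%:R * sg = 1 by rewrite -q4n divff// gt_eqF// exprn_gt0.
rewrite -/E.
have t1 : 2 * (C * (sg + x0) * E * (2 * x0)) <= 8 * (C * E) * (x0 * x0).
  have -> : 2 * (C * (sg + x0) * E * (2 * x0)) = 4 * (C * E) * ((sg + x0) * x0) by ring.
  have -> : 8 * (C * E) * (x0 * x0) = 4 * (C * E) * ((x0 + x0) * x0) by ring.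
  by rewrite ler_wpM2l ?mulr_ge0// ler_wpM2r ?(ltW x00)// lerD2r.
have t2 : 2 * (2 * (C * (sg + s1 + x0) * E * (s1 + sg))) <=
    4 * (C * E * ((2 + kap) * (1 + kap))) * (x0 * x0).
  have -> : 2 * (2 * (C * (sg + s1 + x0) * E * (s1 + sg))) =
    4 * (C * E) * ((sg + s1 + x0) * (s1 + sg)) by ring.
  have -> : 4 * (C * E * ((2 + kap) * (1 + kap))) * (x0 * x0) =
    4 * (C * E) * (((2 + kap) * x0) * ((1 + kap) * x0)) by ring.
  rewrite ler_wpM2l ?mulr_ge0// ler_pM//.
  - by rewrite !addr_ge0// ltW.
  - by rewrite !addr_ge0// ltW.
  - by rewrite mulrDl; lra.
  - by rewrite mulrDl; lra.
have t3 : 2 * (B' * expR (- (n%:R * s1)) * (2 * pi)) <= 4 * pi * B' * (20 / kap) ^+ 5 * q ^- 5.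
  have -> : 2 * (B' * expR (- (n%:R * s1)) * (2 * pi)) = 4 * pi * B' * expR (- (n%:R * s1)) by ring.
  rewrite -[leRHS]mulrA ler_wpM2l ?mulr_ge0 ?(ltW p0)//.
  have y0 : 0 < kap / 4 * q by rewrite mulr_gt0// divr_gt0.
  have -> : (20 / kap) ^+ 5 * q ^- 5 = (5 / (kap / 4 * q)) ^+ 5.
    by rewrite -exprVn -exprMn; congr (_ ^+ 5); field; rewrite !gt_eqF.
  apply: le_trans (expRN_le_pow5 y0); rewrite ler_expR lerN2 -q4n.
  have -> : kap / 4 * q = q ^+ 4 * (kap / 4 * x0).
    by rewrite /x0; field; rewrite gt_eqF.
  by rewrite ler_wpM2l// exprn_ge0// ltW.
move=> H; have {t1 t2 t3}H := le_trans H (lerD (lerD t1 t2) t3).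
have qq : 0 <= q^-1 by rewrite invr_ge0 ltW.
set m := normc (c n) * r ^+ n in H *.
have m0 : 0 <= m by rewrite mulr_ge0 ?normc_ge0 ?exprn_ge0// ltW.
have x2 : q ^+ 4 * (x0 * x0) <= q^-1.
  have -> : q ^+ 4 * (x0 * x0) = q^-1 * q^-1 by rewrite /x0; field; rewrite gt_eqF.
  by rewrite ler_piMl// invf_le1.
have x5 : q ^+ 4 * q ^- 5 = q^-1 by field; rewrite gt_eqF.
have HK : q ^+ 4 * (2 * pi * m) <= K * q^-1.
  apply: (le_trans (ler_wpM2l (exprn_ge0 4 (ltW q0)) H)).
  rewrite -mulrDl mulrDr mulrCA (mulrCA (q ^+ 4) (4 * pi * B' * _)) x5 /K (mulrDl _ _ q^-1).
  by apply: lerD => //; exact: ler_wpM2l.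
rewrite -q4n; apply: (@le_trans _ _ (q ^+ 4 * (2 * pi * m))).
  rewrite ler_wpM2l ?exprn_ge0 ?(ltW q0)// ler_peMl//.
  by have := pi_ge2 R; lra.
by rewrite (le_trans HK)// qV.
Qed.

End Transfer.

(** * Weights of the two singularity classes *)

Section SingularityClasses.
Variable R : realType.
Implicit Types (f g : R[i] -> R[i]) (a b c : nat -> R[i]) (z w t v : R[i]) (x y s e r vt : R).

Lemma has_taylor_coefs_lin f g a b z : has_taylor_coefs f a -> has_taylor_coefs g b ->
  has_taylor_coefs (fun t => f t + z * g t) (fun k => a k + z * b k).
Proof.
move=> /nearcP[d1 d10 H1] /nearcP[d2 d20 H2]; apply/nearcP.
exists (Num.min d1 d2); first by rewrite lt_min d10.
move=> t; rewrite lt_min => /andP[/H1/cvg_cseqP{}H1 /H2/cvg_cseqP{}H2].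
apply/cvg_cseqP => e e0.
have z0 : 0 < 1 + normc z by rewrite ltr_pwDl// normc_ge0.
have [N1 HN1] := H1 (e / 2) (divr_gt0 e0 (ltr0n R 2)).
have [N2 HN2] := H2 (e / 2 / (1 + normc z)) (divr_gt0 (divr_gt0 e0 (ltr0n R 2)) z0).
exists (maxn N1 N2) => n; rewrite geq_max => /andP[/HN1{}HN1 /HN2{}HN2].
have -> : \sum_(0 <= k < n) (a k + z * b k) * (0 + t) ^+ k =
    \sum_(0 <= k < n) a k * (0 + t) ^+ k + z * \sum_(0 <= k < n) b k * (0 + t) ^+ k.
  by rewrite mulr_sumr -big_split; apply: eq_bigr => k _ /=; rewrite mulrDl mulrA.
set A := \sum_(_ <= _ < _) _ in HN1 *; set B := \sum_(_ <= _ < _) _ in HN2 *.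
have -> : A + z * B - (f (0 + t) + z * g (0 + t)) = (A - f (0 + t)) + z * (B - g (0 + t)) by ring.
rewrite (le_trans (normcD _ _))// normcM [leRHS]splitr lerD//.
rewrite (le_trans (ler_wpM2l (normc_ge0 _) HN2))// mulrCA ger_pMr ?divr_gt0//.
by rewrite ler_pdivrMr// mul1r lerDr.
Qed.

Lemma has_taylor_coefs_cst z :
  has_taylor_coefs (fun=> z) (fun k => if k == 0%N then z else 0).
Proof.
apply/nearcP; exists 1 => // t _; apply/cvg_cseqP => e e0; exists 1%N => -[//|n] _.
rewrite big_nat_recl//= expr0 mulr1 big1 ?addr0 ?subrr ?normc0 ?ltW// => k _.
by rewrite mul0r.
Qed.

(** Uniqueness of Taylor coefficients, through Cauchy's formula. *)
Lemma taylor_zero c : has_taylor_coefs (fun=> 0) c -> forall n, c n = 0.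
Proof.
move=> /(cauchy_coefficient ltr01)[s0 H] n.
have G0 s x : circle_integrand (fun=> 0) 1 n (s +i* x) = 0 by rewrite /circle_integrand mul0r.
have := H s0 n 0 (lexx _); rewrite expr1n mulr1 => /(_ _)/esym.
rewrite (@eq_cint _ _ (fun=> 0)); last by move=> x _.
rewrite cint_cst ?mul0r ?add0r ?mulr_ge0 ?pi_ge0// => h.
have /eqP : (2 * pi)%:C * c n = 0.
  by apply: h => x e e0; exists 1 => // y _; rewrite !G0 subrr normc0 ltW.
rewrite mulf_eq0 => /orP[|/eqP//].
by rewrite eq_complex /= mulf_eq0 pnatr_eq0 /= gt_eqF// pi_gt0.
Qed.

(** The Taylor coefficient of g - vt log (1 / (1 - t / r)). *)
Definition theta_defect (theta : nat -> R) r vt k : R :=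
  theta k / k%:R - vt * (r ^- k / k%:R).

Lemma theta_defectE (theta : nat -> R) r vt n : 0 < r -> (0 < n)%N ->
  n%:R * (`|theta_defect theta r vt n| * r ^+ n) = `|theta n * r ^+ n - vt|.
Proof.
move=> r0 n0; have rn : 0 < r ^+ n by rewrite exprn_gt0.
have nn : 0 < n%:R :> R by rewrite ltr0n.
rewrite -{1}(gtr0_norm nn) -{1}(gtr0_norm rn) -!normrM; congr `|_|.
rewrite /theta_defect; field.
by rewrite !gt_eqF.
Qed.

Lemma taylor_theta_defect (theta : nat -> R) g r vt : 0 < r -> is_g_Theta theta g ->
  has_taylor_coefs (fun t => g t + - vt%:C * clog (1 / (1 - t / r%:C)))
    (fun k => (theta_defect theta r vt k)%:C).
Proof.
move=> r0 gt; have := has_taylor_coefs_lin (- vt%:C) gt (clog_taylor r0).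
congr (has_taylor_coefs _ _); apply/funext => k.
by rewrite /theta_defect mulNr -rmorphM -rmorphB.
Qed.

(** The remainder of the class and the function with coefficients [theta_defect]
    coincide near 0, so that their coefficients do, and N^-gamma tends to 0. *)
Theorem class_eF_theta (theta : nat -> R) g r vt gamma : 0 < r -> 0 < gamma ->
  is_g_Theta theta g -> class_eF r vt gamma g ->
  forall e, 0 < e -> exists N : nat, forall n, (N <= n)%N -> `|theta n * r ^+ n - vt| <= e.
Proof.
move=> r0 gamma0 gt [_ [g0 [a [gE ga [C [N1 _ aC]]]]]] e e0.
have cz : forall n, (theta_defect theta r vt n)%:C + -1 * a n = 0.
  apply: taylor_zero.
  have /nearcP[d d0 H] := has_taylor_coefs_lin (-1) (taylor_theta_defect vt r0 gt) ga.
  apply/nearcP; exists (Num.min d r); first by rewrite lt_min d0.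
  move=> h; rewrite lt_min => /andP[hd hr].
  have := H h hd; rewrite gE; last by rewrite add0r cabsE ltcR.
  suff -> : log_singularity r vt (0 + h) + g0 (0 + h) +
    - vt%:C * clog (1 / (1 - (0 + h) / r%:C)) + -1 * g0 (0 + h) = 0 by [].
  by rewrite /log_singularity; ring.
have aE n : normc (a n) = `|theta_defect theta r vt n|.
  by have := cz n => /eqP; rewrite mulN1r subr_eq0 => /eqP <-; rewrite normcR.
pose C' := 1 + Num.max 0 C; have C'0 : 0 < C' by rewrite /C' ltr_pwDl// le_max lexx.
(* Beyond [M], C' n^-gamma <= e. *)
pose M := (C' / e) `^ gamma^-1.
exists (maxn 1 (maxn N1 (Num.bound M))) => n; rewrite !geq_max => /and3P[n1 nN1 nM].
have nn : 0 < n%:R :> R by rewrite ltr0n.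
rewrite -theta_defectE// -aE.
have rn : 0 < r ^+ n by rewrite exprn_gt0.
have an : normc (a n) <= C' * (r ^- n * n%:R `^ (- 1 - gamma)).
  have := aC n nN1; rewrite /= cabsE lecR => /le_trans; apply.
  rewrite ler_wpM2r//; first by rewrite mulr_ge0 ?powR_ge0// invr_ge0 ltW.
  by rewrite /C' (le_trans (_ : C <= Num.max 0 C))// ?le_max ?lexx ?orbT// lerDr.
apply: (@le_trans _ _ (n%:R * (C' * (r ^- n * n%:R `^ (- 1 - gamma)) * r ^+ n))).
  by rewrite ler_wpM2l ?(ltW nn)// ler_wpM2r// ltW.
have -> : n%:R * (C' * (r ^- n * n%:R `^ (- 1 - gamma)) * r ^+ n) = C' * n%:R `^ (- gamma).
  have -> : n%:R `^ (- 1 - gamma) = n%:R^-1 * n%:R `^ (- gamma).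
    rewrite powRD; first by rewrite powR_inv1 ?ltW.
    by rewrite (gt_eqF nn) implybT.
  by field; rewrite !gt_eqF.
have Mn : M <= n%:R.
  rewrite (le_trans (ltW (archi_boundP _)))// ?powR_ge0//.
  by rewrite ler_nat.
have M0 : 0 < C' / e by rewrite divr_gt0.
have : C' / e <= n%:R `^ gamma.
  have := ge0_ler_powR (ltW gamma0) _ _ Mn; rewrite !nnegrE powR_ge0 => /(_ isT (ltW nn)).
  by rewrite /M -powRrM mulVf ?gt_eqF// powRr1// ltW.
rewrite powRN ler_pdivrMr// => h; rewrite ler_pdivrMr ?powR_gt0//.
by rewrite mulrC.
Qed.

(** Being outside of the cone is a linear inequality between real and imaginary
    parts; where s < kap |sin x|, it follows from exp(- s) >= 1 - s, and the
    slope is preserved. *)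
Lemma log_region_cone kap eta s x : 0 <= kap -> log_region kap eta s x ->
  complex.Re (cexp (s +i* x) - 1) < kap * `|complex.Im (cexp (s +i* x) - 1)|.
Proof.
move=> kap0; rewrite ReD ImD ReN ImN /= oppr0 addr0.
have es := expR_gt0 s.
have rhs0 : 0 <= kap * `|expR s * sin x| by rewrite mulr_ge0.
move=> hreg; have [s0|s0] := ltP s 0.
  apply: lt_le_trans rhs0; rewrite subr_lt0 (@le_lt_trans _ _ (expR s))//.
    by rewrite ler_piMr ?cos_le1// ltW.
  by rewrite -expR0 ltr_expR.
case: hreg => [|[_ [h|h]]]; first by rewrite ltNge s0.
  apply: lt_le_trans rhs0; rewrite subr_lt0 (@le_lt_trans _ _ 0)//.
  by rewrite mulr_ge0_le0// ltW.
rewrite normrM (gtr0_norm es) mulrCA ltrBlDl -ltrBlDr -mulrBr.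
have e1 : expR s * expR (- s) = 1 by rewrite expRN divff// gt_eqF.
rewrite -[ltRHS]e1 ltr_pM2l// (lt_le_trans _ (expR_ge1Dx _))//.
have := cos_le1 x; lra.
Qed.

(** The slope cot phi is that of the boundary of the cone of half-angle phi. *)
Lemma cone_Delta0 phi z : 0 < phi -> phi < pi / 2 ->
  complex.Re z < cos phi / sin phi * `|complex.Im z| -> z != 0 /\ phi < `|carg z|.
Proof.
move=> phi0 phi2 hz; have p0 := pi_gt0 R.
have sp : 0 < sin phi by apply: sin_gt0_pi; apply/andP; split; lra.
have cp : 0 < cos phi by apply: cos_gt0_pihalf; apply/andP; split; lra.
have z0 : z != 0 by apply: contraTneq hz => -> /=; rewrite normr0 mulr0 ltxx.
split=> //; have n0 : 0 < normc z by rewrite normc_gt0.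
set u := complex.Re z / normc z.
have uI : -1 <= u <= 1 by exact: ratio_itv.
have -> : `|carg z| = acos u.
  by rewrite cargE; case: ifP => _; rewrite ?normrN ger0_norm// acos_ge0.
rewrite ltNge; apply/negP => h.
have : cos phi <= u.
  rewrite -[u]acosK; last by rewrite in_itv.
  rewrite leNgt ltr_cos -?leNgt// in_itv /= ?acos_ge0 ?acos_lepi//.
  by apply/andP; split; lra.
rewrite /u ler_pdivlMr// leNgt => /negP; apply.
have [hre|hre] := leP (complex.Re z) 0; first by rewrite (le_lt_trans hre)// mulr_gt0.
have h2 : complex.Re z * sin phi < cos phi * `|complex.Im z|.
  by move: hz; rewrite mulrAC ltr_pdivlMr.
rewrite -(ltr_pXn2r (n := 2))// ?nnegrE ?mulr_ge0 ?(ltW hre) ?(ltW cp) ?(ltW n0)//.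
have h3 : (complex.Re z * sin phi) ^+ 2 < (cos phi * `|complex.Im z|) ^+ 2.
  by rewrite ltr_pXn2r// nnegrE mulr_ge0// ltW.
rewrite exprMn normc_sqr; move: h3; rewrite !exprMn real_normK ?num_real// sin2cos2.
rewrite mulrBr mulr1 mulrDr; move: (complex.Re z ^+ 2) (complex.Im z ^+ 2) => A B.
by rewrite (mulrC A); lra.
Qed.

(** The transfer is applied to g - vt log (1 / (1 - t / r)) - K, which is O(t - r)
    at the singularity; subtracting [K] changes the coefficient of index 0 only. *)
Theorem class_F_theta (theta : nat -> R) g r vt K : 0 < r ->
  is_g_Theta theta g -> class_F r vt K g ->
  forall e, 0 < e -> exists N : nat, forall n, (N <= n)%N -> `|theta n * r ^+ n - vt| <= e.
Proof.
move=> r0 gt [rho [phi [rrho /andP[phi0 phi2] hol [C nearC]]]] e e0.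
have p0 := pi_gt0 R.
have sp : 0 < sin phi by apply: sin_gt0_pi; apply/andP; split; lra.
have cp : 0 < cos phi by apply: cos_gt0_pihalf; apply/andP; split; lra.
pose kap := cos phi / sin phi; have kap0 : 0 < kap by rewrite divr_gt0.
(* The disk |t| < rho reads s < ln (rho / r). *)
pose eta := ln (rho / r); have eta0 : 0 < eta by rewrite ln_gt0// ltr_pdivlMr// mul1r.
have rn0 : r%:C != 0 by rewrite eq_complex /= gt_eqF.
have tE s x : r%:C * cexp (s +i* x) - r%:C = r%:C * (cexp (s +i* x) - 1) by ring.
have cone s x : log_region kap eta s x ->
    complex.Re (r%:C * cexp (s +i* x) - r%:C) <
    kap * `|complex.Im (r%:C * cexp (s +i* x) - r%:C)|.
  move=> /(log_region_cone (ltW kap0)) h; rewrite tE ReM ImM /= !mul0r subr0 addr0.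
  by rewrite normrM (gtr0_norm r0) mulrCA ltr_pM2l.
have inD s x : log_region kap eta s x -> Delta0 r rho phi (r%:C * cexp (s +i* x)).
  move=> hreg; have [h1 h2] := cone_Delta0 phi0 phi2 (cone s x hreg).
  split=> //; last by rewrite -subr_eq0.
  rewrite cabsE ltcR normcM normcR gtr0_norm// normc_cexp /=.
  have rr : 0 < rho / r by rewrite divr_gt0// (lt_trans r0).
  rewrite -ltr_pdivlMl// mulrC -[ltRHS]lnK// ltr_expR.
  by case: hreg => [/lt_trans|[]//]; apply.
have inS s x : log_region kap eta s x -> slit (1 - cexp (s +i* x)).
  move=> /(log_region_cone (ltW kap0)); set v := cexp _.
  have [h|h] := eqVneq (complex.Im (v - 1)) 0.
    rewrite h normr0 mulr0 => h0; apply: slit_Re.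
    by rewrite -opprB ReN oppr_gt0.
  by move=> _; apply: slit_Im; rewrite -opprB ImN oppr_eq0.
pose f t := g t + - vt%:C * clog (1 / (1 - t / r%:C)) + -1 * K.
pose c k := (theta_defect theta r vt k)%:C + -1 * (if k == 0%N then K else 0).
have fc : has_taylor_coefs f c.
  exact: has_taylor_coefs_lin (taylor_theta_defect vt r0 gt) (has_taylor_coefs_cst K).
have df s x : log_region kap eta s x -> exists l, has_cderiv f (r%:C * cexp (s +i* x)) l.
  move=> hreg; have [l dl] := holomorphic_onP hol (inD s x hreg).
  have h1 : has_cderiv (fun t => t / r%:C) (r%:C * cexp (s +i* x)) r%:C^-1.
    by apply: eq_cderiv (cderiv_affine 0 r%:C^-1 _) => u; rewrite add0r mulrC.
  have h2 : slit (1 - r%:C * cexp (s +i* x) / r%:C).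
    by rewrite mulrAC divff// mul1r; exact: inS.
  have h3 := cderiv_comp h1 (cderiv_clog_inv h2).
  have h4 := cderivM (cderiv_cst (- vt%:C) (r%:C * cexp (s +i* x))) h3.
  have h5 := cderivD (cderivD dl h4) (cderiv_cst (-1 * K) _).
  eexists; apply: eq_cderiv h5 => u.
  by rewrite /f div1r.
have /nearcP[d d0 Hd] := nearC.
have [d' d'0 Hd'] := cexp_bound (ltr01 : 0 < 1 :> R).
pose C' := Num.max 0 C; have C'0 : 0 <= C' by rewrite le_max lexx.
pose dlt := Num.min (d' / 4) (d / (8 * r)).
have dlt0 : 0 < dlt by rewrite lt_min !divr_gt0// mulr_gt0.
have nf s x : log_region kap eta s x -> `|s| <= dlt -> `|x| <= dlt ->
    normc (f (r%:C * cexp (s +i* x))) <= (2 * r * C') * (`|s| + `|x|).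
  move=> hreg hs hx; set w := s +i* x; pose h := r%:C * (cexp w - 1).
  have nw : normc w <= `|s| + `|x| := normc_le_ReIm w.
  have dd' : dlt <= d' / 4 by rewrite ge_min lexx.
  have dd : dlt <= d / (8 * r) by rewrite ge_min lexx orbT.
  have c1 : normc (cexp w - 1) <= 2 * (`|s| + `|x|).
    have wd : normc w < d' by rewrite (le_lt_trans nw)//; lra.
    rewrite -(subrK w (cexp w - 1)) (le_trans (normcD _ _))//.
    by have := Hd' _ wd; rewrite mul1r; lra.
  have nh : normc h <= r * (2 * (`|s| + `|x|)).
    by rewrite normcM normcR gtr0_norm// ler_wpM2l// ltW.
  have hd : normc h < d.
    rewrite (le_lt_trans nh)//.
    have sx : 2 * (`|s| + `|x|) <= 4 * (d / (8 * r)) by lra.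
    rewrite (le_lt_trans (ler_wpM2l (ltW r0) sx))//.
    have -> : r * (4 * (d / (8 * r))) = d / 2 by field; rewrite gt_eqF.
    by rewrite ltr_pdivrMr// ltr_pMr// ltr1n.
  have hE : r%:C + h = r%:C * cexp w by rewrite /h; ring.
  have := Hd h hd; rewrite hE => /(_ (inD s x hreg)).
  have -> : g (r%:C * cexp w) - (log_singularity r vt (r%:C * cexp w) + K) = f (r%:C * cexp w).
    by rewrite /f /log_singularity; ring.
  rewrite !cabsE -rmorphM lecR => /le_trans; apply.
  rewrite -hE (addrC r%:C) addrK.
  apply: (@le_trans _ _ (C' * normc h)).
    by rewrite ler_wpM2r ?normc_ge0// le_max lexx orbT.
  apply: (le_trans (ler_wpM2l C'0 nh)).
  by rewrite le_eqVlt; apply/orP; left; apply/eqP; ring.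
have rC0 : 0 <= 2 * r * C' by rewrite !mulr_ge0// ltW.
have [N HN] := coefficient_littleo r0 kap0 eta0 rC0 dlt0 fc df nf e0.
exists (maxn 1 N) => n; rewrite geq_max => /andP[n0 nN].
rewrite -theta_defectE//; apply: le_trans (HN n nN).
by rewrite /c eqn0Ngt n0 mulr0 addr0 normcR.
Qed.

End SingularityClasses.

(** * Asymptotics of the renewal recursion *)

Section RenewalAsymptotics.
Variable R : realType.

Definition eventually_close (u : nat -> R) (l : R) := forall e, 0 < e ->
  exists N : nat, forall n, (N <= n)%N -> `|u n - l| <= e.

Definition harmonic_sum (n : nat) : R := \sum_(0 <= j < n) j.+1%:R^-1.

Lemma harmonic_sum_ln n : (0 < n)%N -> ln n%:R <= harmonic_sum n <= 1 + ln n%:R.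
Proof.
case: n => // n _; have nS k : 0 < k.+1%:R :> R by rewrite ltr0n.
apply/andP; split.
  suff : ln n.+2%:R <= harmonic_sum n.+1.
    by apply: le_trans; rewrite ler_ln ?posrE// ler_nat.
  elim: n => [|n IH].
    rewrite /harmonic_sum big_nat1 invr1 -[2%:R]natr1. by rewrite le_ln1Dx// (lt_trans (ltrN10 R)).
  rewrite /harmonic_sum big_nat_recr//= -/(harmonic_sum n.+1).
  have -> : n.+3%:R = n.+2%:R * (1 + n.+2%:R^-1) :> R.
    by rewrite mulrDr mulr1 divff ?natr1// pnatr_eq0.
  rewrite lnM ?posrE ?addr_gt0 ?invr_gt0//.
  by rewrite lerD// le_ln1Dx// (lt_trans (ltrN10 R))// invr_gt0.
elim: n => [|n IH]; first by rewrite /harmonic_sum big_nat1 invr1 ln1 addr0.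
rewrite /harmonic_sum big_nat_recr//= -/(harmonic_sum n.+1).
apply: (le_trans (lerD IH (lexx _))); rewrite -addrA lerD2l -lerBrDl.
have -> : n.+2%:R^-1 = - ln (expR (- n.+2%:R^-1)) :> R by rewrite expRK opprK.
have -> : ln n.+2%:R - ln n.+1%:R = - ln (n.+1%:R / n.+2%:R) :> R.
  by rewrite ln_div ?posrE// opprB.
rewrite lerN2 ler_ln ?posrE ?divr_gt0 ?expR_gt0//.
apply: le_trans (expR_ge1Dx _).
have -> : n.+1%:R = n.+2%:R - 1 :> R by rewrite -(natr1 n.+1) addrK.
by rewrite mulrBl divff ?pnatr_eq0// mul1r.
Qed.

Variables (th h : nat -> R) (vt : R).
Hypotheses (th0 : forall k, (0 < k)%N -> 0 < th k) (vt0 : 0 < vt).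
Hypothesis th_cvg : eventually_close th vt.
Hypothesis h0 : h 0 = 1.
Hypothesis h_rec : forall n, (0 < n)%N -> n%:R * h n = \sum_(0 <= j < n) th (n - j)%N * h j.

Let S n : R := \sum_(0 <= j < n) h j.

Lemma renewal_gt0 n : 0 < h n.
Proof.
elim/ltn_ind: n => -[|n] IH; first by rewrite h0.
suff : 0 < n.+1%:R * h n.+1 by rewrite pmulr_rgt0// ltr0n.
rewrite h_rec// big_nat_recl//= ltr_pwDl//; first by rewrite mulr_gt0 ?th0 ?IH.
rewrite big_nat; apply: sumr_ge0 => j /andP[_ jn].
rewrite ltW// mulr_gt0//; first by rewrite th0// subn_gt0 ltnS.
by apply: IH; rewrite ltnS.
Qed.

(** The finitely many terms before convergence sets in are bounded by their sum. *)
Lemma renewal_th_bounded : exists2 M : R, 0 < M & forall k, (0 < k)%N -> th k <= M.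
Proof.
have [N HN] := th_cvg vt0.
exists (vt + vt + \sum_(0 <= k < N) `|th k|).
  by rewrite ltr_pwDl ?addr_gt0// sumr_ge0.
move=> k k0; have [kN|kN] := leqP N k.
  have := HN k kN; rewrite ler_norml => /andP[_ h1].
  by rewrite ler_wpDr ?sumr_ge0//; lra.
rewrite ler_wpDl ?addr_ge0 ?(ltW vt0)// (le_trans (ler_norm _))//.
rewrite (bigD1_seq k) ?mem_index_iota ?iota_uniq//= lerDl.
exact: sumr_ge0.
Qed.

Lemma renewal_sum_mono m n : (m <= n)%N -> S m <= S n.
Proof.
move=> mn; rewrite /S [leRHS](big_cat_nat (n := m))//= lerDl.
by apply: sumr_ge0 => j _; exact/ltW/renewal_gt0.
Qed.

Lemma renewal_sum_gt0 n : (0 < n)%N -> 0 < S n.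
Proof.
case: n => // n _; rewrite /S big_nat_recl//= h0 ltr_pwDl//.
by apply: sumr_ge0 => j _; exact/ltW/renewal_gt0.
Qed.

Lemma renewal_term_le M n : 0 < M -> (forall k, (0 < k)%N -> th k <= M) ->
  (0 < n)%N -> n%:R * h n <= M * S n.
Proof.
move=> M0 HM n0; rewrite h_rec// /S mulr_sumr !big_nat; apply: ler_sum => j /andP[_ jn].
by rewrite ler_wpM2r ?(ltW (renewal_gt0 _))// HM// subn_gt0.
Qed.

(** By [renewal_term_le] each of the last k terms of the sum is at most
    M / (n - k) times the whole sum. *)
Lemma renewal_sum_diff M n k : 0 < M -> (forall k, (0 < k)%N -> th k <= M) ->
  (k < n)%N -> S n - S (n - k) <= k%:R * (M / (n - k)%:R) * S n.
Proof.
move=> M0 HM kn; have nk0 : (0 < n - k)%N by rewrite subn_gt0.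
have nk : 0 < (n - k)%:R :> R by rewrite ltr0n.
rewrite {1}/S (big_cat_nat (n := (n - k)%N))//=; last exact: leq_subr.
rewrite -/(S (n - k)) addrAC subrr add0r.
apply: (@le_trans _ _ (\sum_(n - k <= j < n) (M / (n - k)%:R * S n))).
  rewrite !big_nat; apply: ler_sum => j /andP[j1 j2].
  have j0 : 0 < j%:R :> R by rewrite ltr0n (leq_trans nk0).
  have hj : h j <= M / j%:R * S j.
    rewrite mulrAC ler_pdivlMr// mulrC renewal_term_le// (leq_trans nk0)//.
  apply: (le_trans hj); apply: ler_pM.
  - by rewrite divr_ge0// ltW.
  - by rewrite ltW// renewal_sum_gt0// (leq_trans nk0).
  - by rewrite ler_pM2l// lef_pV2 ?posrE// ler_nat.
  - by rewrite renewal_sum_mono// ltnW.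
rewrite sumr_const_nat subKn ?(ltnW kn)//.
by rewrite -[X in _ <= X]mulrA mulr_natl.
Qed.

(** In n h_n = sum_(j < n) th_(n - j) h_j, all but the last K weights are close
    to vt, and by [renewal_sum_diff] the last K terms are a vanishing fraction
    of S n. *)
Lemma renewal_ratio : forall e, 0 < e -> exists N : nat, forall n, (N <= n)%N ->
  `|n%:R * h n - vt * S n| <= e * S n.
Proof.
move=> e e0; have [M M0 HM] := renewal_th_bounded.
have e20 : 0 < e / 2 by rewrite divr_gt0.
have [K HK] := th_cvg e20.
pose A := K%:R * M * (M + vt) / (e / 2).
have MV : 0 <= M + vt by rewrite addr_ge0// ltW.
have A0 : 0 <= A.
  by apply: divr_ge0; [apply: mulr_ge0 => //; apply: mulr_ge0 => //|]; exact: ltW.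
exists (K + (Num.bound A).+1)%N => n nN.
have Kn : (K < n)%N by rewrite (leq_trans _ nN)// addnS ltnS leq_addr.
have n0 : (0 < n)%N by exact: leq_ltn_trans Kn.
have nK0 : 0 < (n - K)%:R :> R by rewrite ltr0n subn_gt0.
have AnK : A <= (n - K)%:R.
  by rewrite (le_trans (ltW (archi_boundP A0)))// ler_nat; lia.
have Sn0 := renewal_sum_gt0 n0.
rewrite h_rec// {1}/S mulr_sumr -sumrB (le_trans (ler_norm_sum _ _ _))//.
rewrite [leLHS](big_cat_nat (n := (n - K)%N))//=; last exact: leq_subr.
rewrite (splitr e) mulrDl lerD//.
  apply: (@le_trans _ _ (e / 2 * S (n - K))); last first.
    by rewrite ler_wpM2l ?(ltW e20)// renewal_sum_mono// leq_subr.
  rewrite /S mulr_sumr !big_nat; apply: ler_sum => j /andP[_ jn].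
  rewrite -mulrBl normrM (gtr0_norm (renewal_gt0 _)) ler_wpM2r ?(ltW (renewal_gt0 _))//.
  by apply: HK; lia.
apply: (@le_trans _ _ ((M + vt) * (S n - S (n - K)))).
  rewrite [X in _ * (X - _)]/S (big_cat_nat (m := 0%N) (n := (n - K)%N) (p := n))//=; last exact: leq_subr.
  rewrite -/(S (n - K)) addrAC subrr add0r mulr_sumr !big_nat; apply: ler_sum => j /andP[_ jn].
  rewrite -mulrBl normrM (gtr0_norm (renewal_gt0 _)) ler_wpM2r ?(ltW (renewal_gt0 _))//.
  have nj : (0 < n - j)%N by lia.
  rewrite (le_trans (ler_normB _ _))// (gtr0_norm vt0) lerD2r.
  by rewrite gtr0_norm ?th0// HM.
apply: (le_trans (ler_wpM2l _ (renewal_sum_diff M0 HM Kn))).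
  by rewrite addr_ge0// ltW.
rewrite [leLHS]mulrA ler_wpM2r ?(ltW Sn0)//.
move: AnK; rewrite /A ler_pdivrMr// => AnK.
have -> : (M + vt) * (K%:R * (M / (n - K)%:R)) = (K%:R * M * (M + vt)) / (n - K)%:R by ring.
by rewrite ler_pdivrMr// [leRHS]mulrC.
Qed.

(** By [renewal_ratio], h_n is close to vt S_n / n, and neither S_n nor n changes
    much, relatively, when n is replaced by n - k with k a small fraction of n. *)
Lemma renewal_regular eta : 0 < eta -> eta <= 1 -> exists2 dl : R, 0 < dl &
  exists N : nat, forall n k, (N <= n)%N -> (k <= n)%N -> k%:R <= dl * n%:R ->
    `|h (n - k) / h n - 1| <= eta.
Proof.
move=> eta0 eta1; have [M M0 HM] := renewal_th_bounded.
(* All the ratios below are within a factor (1 + x) / (1 - x)^2 of 1, which is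
   at most 1 + 8 x as x <= 1 / 8. *)
pose x := eta / 8; have x0 : 0 < x by rewrite divr_gt0.
have x8 : x <= 1 / 8 by rewrite /x; lra.
have e0 : 0 < vt * x by rewrite mulr_gt0.
have [N HN] := renewal_ratio e0.
pose dl := Num.min (x / 4) (x / (2 * M)).
have dl0 : 0 < dl by rewrite lt_min !divr_gt0// mulr_gt0.
have dlx : dl <= x / 4 by rewrite ge_min lexx.
have dlM : dl * M <= x / 2.
  have h1 : dl <= x / (2 * M) by rewrite ge_min lexx orbT.
  apply: (le_trans (ler_wpM2r (ltW M0) h1)).
  by rewrite le_eqVlt; apply/orP; left; apply/eqP; field; rewrite gt_eqF.
exists dl => //; exists (N.+1 * 2)%N => n k nN kn kd.
have n0 : 0 < n%:R :> R by rewrite ltr0n (leq_trans _ nN).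
have kn2 : k%:R <= n%:R / 2 :> R.
  by rewrite (le_trans kd)// [leRHS]mulrC ler_wpM2r ?(ltW n0)//; lra.
have jE : (n - k)%:R = n%:R - k%:R :> R by rewrite natrB.
have jn2 : n%:R / 2 <= (n - k)%:R :> R by rewrite jE; lra.
have jN : (N < n - k)%N.
  rewrite -(ltr_nat R) (lt_le_trans _ jn2)// ltr_pdivlMr// -natrM ltr_nat.
  by rewrite (leq_trans _ nN)// ltn_mul2r ltnSn.
have nN' : (N <= n)%N by rewrite (leq_trans (ltnW jN))// leq_subr.
have j0 : 0 < (n - k)%:R :> R by rewrite (lt_le_trans _ jn2)// divr_gt0.
have hn0 := renewal_gt0 n; have hj0 := renewal_gt0 (n - k).
have Sn0 : 0 < S n by rewrite renewal_sum_gt0// (leq_ltn_trans _ (leq_trans jN (leq_subr _ _))).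
have Sj0 : 0 < S (n - k) by rewrite renewal_sum_gt0// (leq_ltn_trans _ jN).
have kltn : (k < n)%N by rewrite -subn_gt0 (leq_ltn_trans _ jN).
have Sjn : S (n - k) <= S n by rewrite renewal_sum_mono// leq_subr.
have Sjn' : (1 - x) * S n <= S (n - k).
  have := renewal_sum_diff M0 HM kltn.
  have : k%:R * (M / (n - k)%:R) <= x.
    rewrite mulrA ler_pdivrMr// (le_trans (ler_wpM2r (ltW M0) kd))//.
    rewrite mulrAC (le_trans (ler_wpM2r (ltW n0) dlM))//.
    by rewrite mulrAC -mulrA ler_wpM2l// ltW.
  by move=> /(ler_wpM2r (ltW Sn0)); lra.
have a1 := HN _ nN'; have a2 := HN _ (ltnW jN).
move: a1 a2; rewrite !ler_norml => /andP[a1 a2] /andP[b1 b2].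
set hn := h n in a1 a2 hn0 *; set hj := h _ in b1 b2 hj0 *.
set s := S n in a1 a2 Sn0 Sjn Sjn' *; set sj := S _ in b1 b2 Sj0 Sjn Sjn' *.
set nn := n%:R in a1 a2 n0 kd jE jn2 kn2 *; set j := (n - k)%:R in b1 b2 j0 jE jn2 *.
have jn : j <= nn by rewrite jE gerBl.
have jx : (1 - x) * nn <= j.
  have : k%:R <= x * nn by rewrite (le_trans kd)// ler_wpM2r ?(ltW n0)//; lra.
  by rewrite jE; lra.
have etax : eta = 8 * x by rewrite /x; field.
clearbody hn hj s sj nn j x; clear HN HM dlM kd jE jn2 kn2 dlx eta0.
have x1 : 0 < 1 - x by lra.
have A1 : vt * (1 - x) * s <= nn * hn by lra.
have A2 : nn * hn <= vt * (1 + x) * s by lra.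
have B1 : vt * (1 - x) * sj <= j * hj by lra.
have B2 : j * hj <= vt * (1 + x) * sj by lra.
have U : (1 - x) ^+ 2 * hj <= (1 + x) * hn.
  rewrite -(ler_pM2l n0).
  have c1 : nn * ((1 - x) ^+ 2 * hj) <= (1 - x) * (j * hj).
    have -> : nn * ((1 - x) ^+ 2 * hj) = (1 - x) * (((1 - x) * nn) * hj) by ring.
    by rewrite ler_pM2l// ler_wpM2r// ltW.
  apply: (le_trans c1); have c2 : (1 - x) * (j * hj) <= (1 - x) * (vt * (1 + x) * s).
    by rewrite ler_pM2l// (le_trans B2)// ler_wpM2l// mulr_ge0 ?(ltW vt0)//; lra.
  apply: (le_trans c2).
  have -> : (1 - x) * (vt * (1 + x) * s) = (1 + x) * (vt * (1 - x) * s) by ring.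
  have -> : nn * ((1 + x) * hn) = (1 + x) * (nn * hn) by ring.
  by rewrite ler_wpM2l//; lra.
have L : (1 - x) ^+ 2 * hn <= (1 + x) * hj.
  rewrite -(ler_pM2l n0).
  have c1 : nn * ((1 - x) ^+ 2 * hn) <= (1 - x) ^+ 2 * (vt * (1 + x) * s).
    have -> : nn * ((1 - x) ^+ 2 * hn) = (1 - x) ^+ 2 * (nn * hn) by ring.
    by rewrite ler_wpM2l// exprn_ge0// ltW.
  apply: (le_trans c1).
  have -> : (1 - x) ^+ 2 * (vt * (1 + x) * s) = (1 + x) * (vt * (1 - x) * ((1 - x) * s)) by ring.
  have -> : nn * ((1 + x) * hj) = (1 + x) * (nn * hj) by ring.
  rewrite ler_wpM2l//; first by lra.
  have c2 : vt * (1 - x) * ((1 - x) * s) <= vt * (1 - x) * sj.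
    by rewrite ler_wpM2l// mulr_ge0// ltW.
  by rewrite (le_trans c2)// (le_trans B1)// ler_wpM2r// ltW.
have x2 : 0 < (1 - x) ^+ 2 by rewrite exprn_gt0.
have u1 : hj / hn <= (1 + x) / (1 - x) ^+ 2.
  by rewrite ler_pdivrMr// mulrAC ler_pdivlMr// mulrC.
have l1 : (1 - x) ^+ 2 / (1 + x) <= hj / hn.
  have xx : 0 < 1 + x by lra.
  by rewrite ler_pdivlMr// mulrAC ler_pdivrMr// [leRHS]mulrC.
have u2 : (1 + x) / (1 - x) ^+ 2 <= 1 + eta.
  by rewrite ler_pdivrMr// etax; nra.
have l2 : 1 - eta <= (1 - x) ^+ 2 / (1 + x).
  by rewrite ler_pdivlMr ?etax; [nra|lra].
by apply/andP; split; lra.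
Qed.

Let E n := (\sum_(0 <= j < n) th (n - j)%N / (n - j)%:R * h j) / h n.
Let Theta n := \sum_(0 <= j < n) th (n - j)%N / (n - j)%:R.

Lemma renewal_Theta n : Theta n = \sum_(0 <= k < n) th k.+1 / k.+1%:R.
Proof.
rewrite /Theta big_nat_rev /= add0n !big_nat; apply: eq_bigr => k /andP[_ kn].
by rewrite subKn.
Qed.

(** Terms with n - j <= dl n are compared with those of Theta by
    [renewal_regular].  For the others 1 / (n - j) < 1 / (dl n), and the
    recursion for n h_n bounds their sum by a constant. *)
Lemma renewal_E_Theta eta : 0 < eta -> eta <= 1 -> exists C : R,
  exists N : nat, forall n, (N <= n)%N -> `|E n - Theta n| <= eta * Theta n + C.
Proof.
move=> eta0 eta1; have [M M0 HM] := renewal_th_bounded.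
have [dl dl0 [N HN]] := renewal_regular eta0 eta1.
exists (1 / dl + M / dl), N.+1 => n nN.
have n0 : (0 < n)%N by exact: leq_ltn_trans nN.
have nn : 0 < n%:R :> R by rewrite ltr0n.
have hn := renewal_gt0 n.
have -> : E n - Theta n = \sum_(0 <= j < n) th (n - j)%N / (n - j)%:R * (h j / h n - 1).
  rewrite /E /Theta mulr_suml -sumrB; apply: eq_bigr => j _.
  by rewrite mulrBr mulr1 mulrA.
rewrite (le_trans (ler_norm_sum _ _ _))//.
apply: (@le_trans _ _ (\sum_(0 <= j < n) (eta * (th (n - j)%N / (n - j)%:R) +
    (1 / (dl * n%:R * h n) * (th (n - j)%N * h j) + M / (dl * n%:R))))).
  rewrite !big_nat; apply: ler_sum => j /andP[_ jn].
  have nj : (0 < n - j)%N by rewrite subn_gt0.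
  have nj0 : 0 < (n - j)%:R :> R by rewrite ltr0n.
  have t0 := th0 nj; have hj := renewal_gt0 j.
  have p1 : 0 < th (n - j)%N / (n - j)%:R by rewrite divr_gt0.
  have dn : 0 < dl * n%:R by rewrite mulr_gt0.
  rewrite normrM (gtr0_norm p1).
  have [kd|kd] := leP (n - j)%:R (dl * n%:R).
    have := HN n (n - j)%N (ltnW nN) (leq_subr _ _) kd; rewrite subKn ?(ltnW jn)// => h1.
    rewrite ler_wpDr//; last by rewrite mulrC ler_wpM2r// ltW.
    apply: addr_ge0; last exact/ltW/divr_gt0.
    by apply/ltW/mulr_gt0; [apply: divr_gt0 => //|]; exact: mulr_gt0.
  apply: ler_wpDl; first exact/ltW/mulr_gt0.
  have q0 : 0 < h j / h n by rewrite divr_gt0.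
  apply: (@le_trans _ _ (th (n - j)%N / (n - j)%:R * (h j / h n + 1))).
    apply: ler_wpM2l; first exact: ltW.
    by rewrite (le_trans (ler_normB _ _))// normr1 gtr0_norm.
  have p2 : th (n - j)%N / (n - j)%:R <= th (n - j)%N / (dl * n%:R).
    by rewrite ler_pM2l// lef_pV2 ?posrE// ltW.
  rewrite mulrDr mulr1 lerD//.
    apply: (le_trans (ler_wpM2r (ltW q0) p2)).
    by rewrite le_eqVlt; apply/orP; left; apply/eqP; field; rewrite !gt_eqF.
  by rewrite (le_trans p2)// ler_pM2r ?invr_gt0// HM.
rewrite !big_split /= -!mulr_sumr -/(Theta n) -h_rec// lerD2l.
rewrite sumr_const_nat subn0 lerD//.
  by rewrite le_eqVlt; apply/orP; left; apply/eqP; field; rewrite !gt_eqF.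
by rewrite -[_^-1 *+ n]mulr_natl le_eqVlt; apply/orP; left; apply/eqP; field; rewrite !gt_eqF.
Qed.

Lemma renewal_Theta_harmonic e : 0 < e -> exists C : R, forall n,
  `|Theta n - vt * harmonic_sum n| <= e * harmonic_sum n + C.
Proof.
move=> e0; have [K HK] := th_cvg e0.
pose a k := `|th k.+1 - vt| / k.+1%:R.
have a0 k : 0 <= a k by rewrite divr_ge0.
exists (\sum_(0 <= k < K) a k) => n.
have -> : Theta n - vt * harmonic_sum n = \sum_(0 <= k < n) (th k.+1 - vt) / k.+1%:R.
  rewrite renewal_Theta /harmonic_sum mulr_sumr -sumrB; apply: eq_bigr => k _.
  by rewrite mulrBl.
rewrite (le_trans (ler_norm_sum _ _ _))//.
have -> : \sum_(0 <= k < n) `|(th k.+1 - vt) / k.+1%:R| = \sum_(0 <= k < n) a k.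
  by apply: eq_bigr => k _; rewrite normrM (gtr0_norm (_ : 0 < k.+1%:R^-1)) ?invr_gt0 ?ltr0n.
have H0 m : 0 <= harmonic_sum m by apply: sumr_ge0 => k _; rewrite invr_ge0.
have [nK|Kn] := leqP n K.
  rewrite (big_cat_nat (n := n) (p := K))//= ler_wpDl ?mulr_ge0 ?(ltW e0)//.
  by rewrite lerDl sumr_ge0.
rewrite (big_cat_nat (n := K))//=; last exact: ltnW.
rewrite addrC lerD2r /harmonic_sum [X in _ <= _ * X](big_cat_nat (n := K))//=; last exact: ltnW.
rewrite mulrDr ler_wpDl//; first by rewrite mulr_ge0 ?(ltW e0)// -/(harmonic_sum K).
rewrite mulr_sumr !big_nat; apply: ler_sum => k /andP[kK _].
by rewrite /a ler_wpM2r ?invr_ge0// HK// (leq_trans kK).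
Qed.

Theorem renewal_expected_cycles : forall e, 0 < e -> exists N : nat,
  forall n, (N <= n)%N -> `|E n - vt * ln n%:R| <= e * ln n%:R.
Proof.
move=> e e0; have [M M0 HM] := renewal_th_bounded.
pose eta := Num.min 1 (e / (4 * M)).
have eta0 : 0 < eta by rewrite lt_min ltr01 divr_gt0// mulr_gt0.
have eta1 : eta <= 1 by rewrite ge_min lexx.
have etaM : eta * M <= e / 4.
  have h1 : eta <= e / (4 * M) by rewrite ge_min lexx orbT.
  apply: (le_trans (ler_wpM2r (ltW M0) h1)).
  by rewrite le_eqVlt; apply/orP; left; apply/eqP; field; rewrite gt_eqF.
have [C1 [N1 H1]] := renewal_E_Theta eta0 eta1.
have e4 : 0 < e / 4 by rewrite divr_gt0.
have [C2 H2] := renewal_Theta_harmonic e4.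
pose C := Num.max 0 (C1 + C2 + vt + e).
pose B := expR (2 * C / e).
exists (maxn 1 (maxn N1 (Num.bound B))) => n; rewrite !geq_max => /and3P[n0 nN1 nB].
have nn : 0 < n%:R :> R by rewrite ltr0n.
have /andP[l1 l2] := harmonic_sum_ln n0.
have ThetaH : Theta n <= M * harmonic_sum n.
  rewrite renewal_Theta /harmonic_sum mulr_sumr; apply: ler_sum => k _.
  by rewrite ler_wpM2r ?invr_ge0// HM.
have lnC : C <= e / 2 * ln n%:R.
  have : 2 * C / e <= ln n%:R.
    rewrite -[leLHS]expRK ler_ln ?posrE ?expR_gt0//.
    by rewrite (le_trans (ltW (archi_boundP _)))// ?expR_ge0// ler_nat.
  by rewrite ler_pdivrMr//; lra.
have C0 : C1 + C2 + vt + e <= C by rewrite le_max lexx orbT.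
have h1 := H1 n nN1; have h2 := H2 n.
have hl : `|vt * harmonic_sum n - vt * ln n%:R| <= vt.
  rewrite -mulrBr normrM (gtr0_norm vt0) ler_piMr ?(ltW vt0)//.
  by rewrite ger0_norm; lra.
have -> : E n - vt * ln n%:R = (E n - Theta n) + (Theta n - vt * harmonic_sum n)
  + (vt * harmonic_sum n - vt * ln n%:R) by ring.
rewrite (le_trans (ler_normD _ _))// (le_trans (lerD (ler_normD _ _) (lexx _)))//.
rewrite (le_trans (lerD (lerD h1 h2) hl))//.
have h3 : eta * Theta n <= e / 4 * harmonic_sum n.
  apply: (le_trans (ler_wpM2l (ltW eta0) ThetaH)); rewrite mulrA ler_wpM2r//.
  by apply: sumr_ge0 => k _; rewrite invr_ge0.
have h4 : e / 4 * harmonic_sum n <= e / 4 * (1 + ln n%:R) by rewrite ler_wpM2l// ltW.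
by move: lnC C0 h3 h4; clear -e0; move: (eta * _) (e / 4 * harmonic_sum n) (ln n%:R) => X Y Z; lra.
Qed.

End RenewalAsymptotics.

(** * Sums over permutations weighted by their cycles *)

Section CycleSums.
Local Close Scope classical_set_scope.
Import mathcomp.boot.fintype mathcomp.boot.finset.
Variables (K : fieldType) (th : nat -> K).
Implicit Types (T : finType).

Lemma porbit_id_step T (s : {perm T}) x : s x \in porbit s x.
Proof. by have := mem_porbit s 1 x; rewrite expg1. Qed.

Lemma porbit_step T (s : {perm T}) x y : y \in porbit s x -> s y \in porbit s x.
Proof.
by rewrite -eq_porbit_mem => /eqP <-; exact: porbit_id_step.
Qed.

Lemma stable_porbit T (s : {perm T}) (X : {set T}) x :
  (forall y, y \in X -> s y \in X) -> x \in X -> porbit s x \subset X.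
Proof.
move=> sX xX; apply/subsetP => y /porbitP[n ->]; elim: n => [|n IH].
  by rewrite expg0 perm1.
by rewrite expgSr permM; exact: sX.
Qed.

Lemma porbit_fix T (s : {perm T}) i : s i = i -> porbit s i = [set i].
Proof.
move=> si; apply/eqP; rewrite eqEsubset sub1set porbit_id andbT.
by apply: stable_porbit => [y|]; rewrite !inE// => /eqP ->; rewrite si.
Qed.

(** A permutation [t] fixing [i] composed with the transposition of [i] and [j]
    is [t] with [i] inserted just before [j] in its cycle.  Every permutation
    sending [i] to [j] arises in this way exactly once, which makes induction on
    the support possible. *)
Section InsertPoint.
Variables (T : finType) (t : {perm T}) (i j : T).
Hypotheses (ti : t i = i) (ij : j != i).
Let s := (t * tperm i j)%g.
Let X := i |: porbit t j.

Lemma insert_i_notin : i \notin porbit t j.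
Proof. by rewrite porbit_sym porbit_fix// inE. Qed.

Lemma insert_stepE y : y != i -> s y = if t y == j then i else t y.
Proof.
move=> yi; rewrite /s permM; case: tpermP => [h|->|/eqP h1 /eqP h2].
- by move: yi; rewrite -(inj_eq (@perm_inj _ t)) ti h eqxx.
- by rewrite eqxx.
- by rewrite (negbTE h2).
Qed.

Lemma insert_step_i : s i = j.
Proof. by rewrite /s permM ti tpermL. Qed.

Lemma insert_X_stable y : y \in X -> s y \in X.
Proof.
rewrite /X !inE; case: eqVneq => [-> _|yi /= yj].
  by rewrite insert_step_i porbit_id orbT.
rewrite insert_stepE//; case: ifP => _; first by rewrite eqxx.
by rewrite (porbit_step yj) orbT.
Qed.

Lemma porbit_insert : porbit s i = X.
Proof.
apply/eqP; rewrite eqEsubset; apply/andP; split.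
  by apply: stable_porbit; [exact: insert_X_stable|rewrite !inE eqxx].
rewrite subUset sub1set porbit_id /=.
have jo : j \in porbit s i by rewrite -{1}insert_step_i porbit_id_step.
apply: stable_porbit => // y yo; have [->|yi] := eqVneq y i; first by rewrite ti porbit_id.
have := porbit_step yo; rewrite insert_stepE//; case: ifP => // /eqP -> _.
exact: jo.
Qed.

Lemma porbit_insert_out x : x \notin X -> porbit s x = porbit t x.
Proof.
move=> xX; have outX y : y \notin X -> t y \notin X /\ s y = t y.
  rewrite !inE !negb_or => /andP[yi yj].
  have tyi : t y != i by rewrite -{1}ti (inj_eq (@perm_inj _ t)).
  have tyj : t y \notin porbit t j.
    apply: contra yj; rewrite -!eq_porbit_mem => /eqP <-.
    by rewrite eq_porbit_mem porbit_sym porbit_id_step.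
  rewrite tyi tyj insert_stepE//; split=> //.
  by case: ifP tyj => // /eqP ->; rewrite porbit_id.
have it n : ((s ^+ n)%g x = (t ^+ n)%g x) /\ (t ^+ n)%g x \notin X.
  elim: n => [|n [IH1 IH2]]; first by rewrite !expg0 perm1.
  have [h1 h2] := outX _ IH2; rewrite !expgSr (permM _ s) (permM _ t) IH1.
  by split.
apply/setP => y; apply/porbitP/porbitP => -[n ->]; exists n; have [h _] := it n.
  by rewrite h.
by rewrite h.
Qed.

End InsertPoint.

(** The weight of the cycle through [i] is free: with [th] itself this gives the
    normalization, and with th_k / k the expected number of cycles.  Fixed
    points outside of [A] carry no weight. *)
Definition marked_sum T (A : {set T}) (i : T) (phi : nat -> K) : K :=
  \sum_(s : {perm T} | perm_on A s) phi #|porbit s i| *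
    \prod_(c in porbits s | (c \subset A) && (i \notin c)) th #|c|.

Definition cycle_sum T (A : {set T}) : K :=
  \sum_(s : {perm T} | perm_on A s) \prod_(c in porbits s | c \subset A) th #|c|.

Lemma porbit_sub T (A : {set T}) (s : {perm T}) i : perm_on A s -> i \in A ->
  porbit s i \subset A.
Proof. by move=> As iA; apply: stable_porbit => // y; rewrite perm_closed. Qed.

Lemma mem_porbits T (s : {perm T}) i : porbit s i \in porbits s.
Proof. exact: imset_f. Qed.

Lemma porbitsP T (s : {perm T}) c : reflect (exists i, c = porbit s i) (c \in porbits s).
Proof.
apply: (iffP imsetP) => [[i _ ->]|[i ->]]; by exists i.
Qed.

Lemma porbits_memE T (s : {perm T}) c i : c \in porbits s -> (i \in c) = (c == porbit s i).
Proof. by move=> /porbitsP[k ->]; rewrite eq_sym eq_porbit_mem. Qed.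

Lemma prod_porbits_mark T (A : {set T}) (s : {perm T}) i : perm_on A s -> i \in A ->
  \prod_(c in porbits s | c \subset A) th #|c| = th #|porbit s i| *
    \prod_(c in porbits s | (c \subset A) && (i \notin c)) th #|c|.
Proof.
move=> As iA; rewrite (bigD1 (porbit s i)) /= ?mem_porbits ?porbit_sub//.
congr (_ * _); apply: eq_bigl => c; rewrite -andbA.
by case cp : (c \in porbits s) => //=; rewrite (porbits_memE _ cp).
Qed.

Lemma cycle_sum_marked T (A : {set T}) i : i \in A -> cycle_sum A = marked_sum A i th.
Proof. by move=> iA; apply: eq_bigr => s As; exact: prod_porbits_mark. Qed.

Lemma perm_on_insert T (A : {set T}) (i j : T) (t : {perm T}) : i \in A -> j \in A ->
  perm_on A (t * tperm i j)%g && ((t * tperm i j)%g i == j) = perm_on (A :\ i) t.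
Proof.
move=> iA jA; apply/andP/idP => [[As /eqP sj]|At].
  have ti : t i = i by apply: (@perm_inj _ (tperm i j)); rewrite tpermL -permM.
  apply/subsetP => x; rewrite !inE => tx; apply/andP; split.
    by apply: contraNneq tx => ->; rewrite ti.
  apply: contraNT tx => xA; have := out_perm As xA; rewrite permM.
  case: tpermP => [_ h2|_ h2|_ _ ->//]; first by rewrite -h2 jA in xA.
  by rewrite -h2 iA in xA.
have ti : t i = i by apply: out_perm At _; rewrite !inE eqxx.
split; last by rewrite permM ti tpermL.
apply: perm_onM.
  by apply: subset_trans At _; exact: subD1set.
by apply: subset_trans (tperm_on i j) _; rewrite subUset !sub1set iA.
Qed.

(** Sorting the permutations by the image j of [i] and removing [i]: either [i]
    was a fixed point, or the cycle of j, shorter by one, becomes the marked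
    one. *)
Lemma marked_sum_rec T (A : {set T}) i phi : i \in A ->
  marked_sum A i phi = phi 1%N * cycle_sum (A :\ i) +
    \sum_(j in A :\ i) marked_sum (A :\ i) j (fun k => phi k.+1).
Proof.
move=> iA; rewrite /marked_sum.
rewrite (partition_big (fun s : {perm T} => s i) (mem A)) /=; last first.
  by move=> s As; rewrite perm_closed.
have step j : j \in A ->
   \sum_(s : {perm T} | perm_on A s && (s i == j)) phi #|porbit s i| *
    \prod_(c in porbits s | (c \subset A) && (i \notin c)) th #|c| =
   \sum_(t : {perm T} | perm_on (A :\ i) t) phi #|porbit (t * tperm i j)%g i| *
    \prod_(c in porbits (t * tperm i j)%g | (c \subset A) && (i \notin c)) th #|c|.
  move=> jA; rewrite (reindex_inj (mulIg (tperm i j))) /=.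
  by apply: eq_bigl => t; exact: perm_on_insert.
rewrite (bigD1 i)//= step// tperm1; congr (_ + _).
  rewrite mulr_sumr; apply: eq_bigr => t At; rewrite mulg1.
  have ti : t i = i by apply: out_perm At _; rewrite !inE eqxx.
  rewrite porbit_fix// cards1; congr (_ * _); apply: eq_bigl => c.
  by rewrite subsetD1.
apply: eq_big => [j|j /andP[jA ji]]; first by rewrite !inE andbC.
rewrite step//; apply: eq_bigr => t At.
have ti : t i = i by apply: out_perm At _; rewrite !inE eqxx.
rewrite (porbit_insert j ti) cardsU1 (insert_i_notin ti ji); congr (_ * _).
apply: eq_bigl => c.
apply/and3P/and3P => -[/porbitsP[x cE]]; subst c.
  move=> cA ic.
  have xX : x \notin i |: porbit t j.
    rewrite -(porbit_insert j ti); apply: contra ic; rewrite porbit_sym//.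
  rewrite (porbit_insert_out ti xX) in cA ic *; split; rewrite ?mem_porbits//.
    by rewrite subsetD1 cA.
  by apply: contra xX => jx; rewrite inE porbit_sym jx orbT.
rewrite subsetD1 => /andP[cA ic] jc.
have xX : x \notin i |: porbit t j.
  rewrite !inE negb_or porbit_sym jc andbT.
  by apply: contraNneq ic => <-; exact: porbit_id.
by rewrite -(porbit_insert_out ti xX) in cA ic *; split; rewrite ?mem_porbits.
Qed.

(** The Taylor coefficients of exp(g), with g the sum of the th_k / k t^k. *)
Definition cycle_coef n : K := cycle_sum [set: 'I_n] / n`!%:R.

Hypothesis char0 : forall n, n`!%:R != 0 :> K.

(** By induction on the size of the support, unfolding [marked_sum_rec]: j is the
    number of points outside of the marked cycle, and (n - 1)! / j! counts the
    possible marked cycles of length n - j. *)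
Lemma cycle_coef_spec n :
  (forall T (A : {set T}), #|A| = n -> cycle_sum A = n`!%:R * cycle_coef n) /\
  (forall T (A : {set T}) i phi, #|A| = n -> i \in A ->
    marked_sum A i phi = n.-1`!%:R * \sum_(0 <= j < n) phi (n - j)%N * cycle_coef j).
Proof.
elim: n => [|n [IH1 IH2]].
  have H0 T (A : {set T}) : #|A| = 0%N -> cycle_sum A = 1.
    move=> /cards0_eq ->; rewrite /cycle_sum (big_pred1 1%g).
      rewrite big_pred0// => c; apply/negP => /andP[/porbitsP[x ->]].
      by rewrite subset0 => /eqP h; have := porbit_id 1 x; rewrite h inE.
    move=> s /=; apply/idP/eqP => [/perm_on_id ->//|->]; rewrite ?cards0//.
    exact: perm_on1.
  split=> [T A A0|T A i phi /cards0_eq ->]; last by rewrite inE.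
  rewrite H0// /cycle_coef H0; last by rewrite cardsT card_ord.
  by rewrite mul1r divff.
have M T (A : {set T}) i phi : #|A| = n.+1 -> i \in A ->
    marked_sum A i phi = n.+1.-1`!%:R * \sum_(0 <= j < n.+1) phi (n.+1 - j)%N * cycle_coef j.
  move=> An iA; have An' : #|A :\ i| = n by move: An; rewrite (cardsD1 i) iA => -[].
  rewrite marked_sum_rec// (IH1 _ _ An') /=.
  rewrite (eq_bigr (fun=> n.-1`!%:R * \sum_(0 <= j < n) phi (n - j).+1 * cycle_coef j)); last first.
    by move=> j jA; rewrite (IH2 _ _ _ _ An' jA).
  rewrite sumr_const An' -[X in _ + X]mulr_natl mulrA.
  rewrite big_nat_recr//= subSnn mulrDr addrC mulrCA; congr (_ + _); last by rewrite mulrA (mulrC (phi 1%N)).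
  case: n {IH1 IH2 An} An' => [|n] An'; first by rewrite !big_geq// !mulr0.
  rewrite mulrA -natrM [(_ * n.+1)%N]mulnC -factS; congr (_ * _); rewrite !big_nat; apply: eq_bigr => j /andP[_ jn].
  by rewrite (subSn (ltnW jn)).
have CS T (A : {set T}) : #|A| = n.+1 ->
    cycle_sum A = n`!%:R * \sum_(0 <= j < n.+1) th (n.+1 - j)%N * cycle_coef j.
  move=> An; have /card_gt0P[i iA] : (0 < #|A|)%N by rewrite An.
  by rewrite (cycle_sum_marked iA) (M _ _ _ _ An iA).
split=> // T A An; rewrite CS// /cycle_coef CS ?cardsT ?card_ord//.
by rewrite [RHS]mulrC divfK.
Qed.

Lemma cycle_coef0 : cycle_coef 0 = 1.
Proof.
have e0 : cycle_sum [set: 'I_0] = 1.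
  rewrite /cycle_sum (big_pred1 1%g).
    by rewrite big_pred0// => c; apply/negP => /andP[/porbitsP[[]]].
  move=> s /=; apply/idP/eqP => [_|->]; last exact: perm_on1.
  by apply/permP => -[].
by rewrite /cycle_coef e0 fact0 divr1.
Qed.

Lemma cycle_coef_rec n : (0 < n)%N ->
  n%:R * cycle_coef n = \sum_(0 <= j < n) th (n - j)%N * cycle_coef j.
Proof.
case: n => // n _; have [H1 H2] := cycle_coef_spec n.+1.
have cn : #|[set: 'I_n.+1]| = n.+1 by rewrite cardsT card_ord.
have := H2 _ _ (ord0 : 'I_n.+1) th cn (in_setT _).
rewrite -cycle_sum_marked ?in_setT// (H1 _ _ cn) factS natrM /= => h.
by apply: (mulfI (char0 n)); rewrite -h mulrCA mulrA.
Qed.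

End CycleSums.

(** * The generalized Ewens measure *)

Section EwensMeasure.
Local Close Scope classical_set_scope.
Import mathcomp.boot.fintype mathcomp.boot.finset.
Variable R : realType.
Variables (theta : nat -> R).
Hypothesis theta0 : forall k, (0 < k)%N -> 0 < theta k.

Lemma sum_porbits (V : nmodType) (T : finType) (s : {perm T}) (F : {set T} -> V) :
  \sum_i F (porbit s i) = \sum_(c in porbits s) F c *+ #|c|.
Proof.
rewrite (partition_big (porbit s) (mem (porbits s))) /=; last by move=> i _; exact: mem_porbits.
apply: eq_bigr => c cs; rewrite (eq_bigr (fun=> F c)); last by move=> i /eqP ->.
rewrite sumr_const; congr (_ *+ _); apply: eq_card => i.
by rewrite (porbits_memE i cs) unfold_in eq_sym.
Qed.

Lemma card_porbits_gt0 (T : finType) (s : {perm T}) c : c \in porbits s -> (0 < #|c|)%N.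
Proof. by move=> /porbitsP[i ->]; rewrite lt0n card_porbit_neq0. Qed.

(** Each cycle c contributes #|c| times 1 / #|c|. *)
Lemma total_cycles_sum n (s : 'S_n) :
  (total_cycles s)%:R = \sum_i (#|porbit s i|%:R)^-1 :> R.
Proof.
rewrite (sum_porbits s (fun c => #|c|%:R^-1)) /total_cycles -sum1_card natr_sum.
apply: eq_bigr => c /card_porbits_gt0 c0; rewrite -[RHS]mulr_natl mulfV//.
by rewrite pnatr_eq0 -lt0n.
Qed.

Lemma cycle_weightE n (s : 'S_n) : cycle_weight theta s = \prod_(c in porbits s) theta #|c|.
Proof.
have cn (c : {set 'I_n}) : (#|c| < n.+1)%N by rewrite ltnS -[leqRHS]card_ord max_card.
rewrite (partition_big (fun c : {set 'I_n} => Ordinal (cn c)) predT)//=.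
rewrite big_ord_recl /= big_pred0 ?mul1r; last first.
  move=> c; apply/negP => /andP[/card_porbits_gt0 c0 /eqP/(congr1 val) /= h].
  by rewrite h in c0.
rewrite /cycle_weight big_add1 /= big_mkord; apply: eq_bigr => k _.
rewrite (eq_bigr (fun=> theta k.+1)); last first.
  by move=> c /andP[_ /eqP/(congr1 val) /= ->].
rewrite prodr_const; congr (_ ^+ _); apply: eq_card => c.
by rewrite [LHS]inE.
Qed.

Lemma cycle_weight_gt0 n (s : 'S_n) : 0 < cycle_weight theta s.
Proof.
rewrite cycle_weightE; apply: prodr_gt0 => c /card_porbits_gt0; exact: theta0.
Qed.

Lemma perm_onT (T : finType) (s : {perm T}) : perm_on [set: T] s.
Proof. by apply/subsetP => x _; rewrite inE. Qed.

Lemma cycle_sum_weight n : cycle_sum theta [set: 'I_n] = \sum_(s : 'S_n) cycle_weight theta s.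
Proof.
apply: eq_big => [s|s _]; first exact: perm_onT.
by rewrite cycle_weightE; apply: eq_bigl => c; rewrite subsetT andbT.
Qed.

Lemma ewens_normE n : ewens_norm theta n = cycle_coef theta n.
Proof. by rewrite /ewens_norm /cycle_coef cycle_sum_weight mulrC. Qed.

Lemma factR_neq0 n : n`!%:R != 0 :> R.
Proof. by rewrite pnatr_eq0 -lt0n fact_gt0. Qed.

Lemma ewens_norm_gt0 n : 0 < ewens_norm theta n.
Proof.
rewrite mulr_gt0 ?invr_gt0 ?ltr0n ?fact_gt0//.
rewrite (bigD1 1%g)//= ltr_pwDl ?cycle_weight_gt0//.
by apply: sumr_ge0 => s _; exact/ltW/cycle_weight_gt0.
Qed.

Lemma ewens_prob_ge0 n (s : 'S_n) : 0 <= ewens_prob theta s.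
Proof.
apply: mulr_ge0; last exact/ltW/cycle_weight_gt0.
by rewrite invr_ge0 mulr_ge0// ltW// ewens_norm_gt0.
Qed.

Lemma ewens_prob_sum n : \sum_(s : 'S_n) ewens_prob theta s = 1.
Proof.
rewrite -mulr_sumr; have h := ewens_norm_gt0 n.
have -> : \sum_(s : 'S_n) cycle_weight theta s = ewens_norm theta n * n`!%:R.
  by rewrite /ewens_norm mulrC mulrA divff ?mul1r// factR_neq0.
by rewrite mulVf// mulf_neq0 ?factR_neq0// gt_eqF.
Qed.

Lemma ewens_norm0 : ewens_norm theta 0 = 1.
Proof. by rewrite ewens_normE cycle_coef0// => n; exact: factR_neq0. Qed.

Lemma ewens_norm_rec n : (0 < n)%N ->
  n%:R * ewens_norm theta n = \sum_(0 <= j < n) theta (n - j)%N * ewens_norm theta j.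
Proof.
move=> n0; rewrite ewens_normE (cycle_coef_rec theta factR_neq0 n0).
by apply: eq_bigr => j _; rewrite ewens_normE.
Qed.

(** By [total_cycles_sum], counting cycles amounts to summing over the points the
    inverse of the length of their cycle, that is, to marking the cycle of a
    point with weight theta_k / k. *)
Lemma expected_cyclesE n : (0 < n)%N -> expected_cycles theta n =
  (\sum_(0 <= j < n) theta (n - j)%N / (n - j)%:R * ewens_norm theta j) / ewens_norm theta n.
Proof.
move=> n0; have h := ewens_norm_gt0 n; have hn : ewens_norm theta n != 0 by rewrite gt_eqF.
rewrite /expected_cycles /ewens_expectation /ewens_prob.
rewrite (eq_bigr (fun s : 'S_n => (ewens_norm theta n * n`!%:R)^-1 *
    (cycle_weight theta s * (total_cycles s)%:R))); last by move=> s _; rewrite mulrA.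
rewrite -mulr_sumr.
have -> : \sum_(s : 'S_n) cycle_weight theta s * (total_cycles s)%:R =
    \sum_i marked_sum theta [set: 'I_n] i (fun k => theta k / k%:R).
  rewrite exchange_big /=; apply: eq_big => [s|s _]; first by rewrite perm_onT.
  rewrite total_cycles_sum mulr_sumr; apply: eq_bigr => i _.
  rewrite cycle_weightE; have := prod_porbits_mark theta (perm_onT s) (in_setT i).
  rewrite (eq_bigl (mem (porbits s))); last by move=> c; rewrite subsetT andbT.
  by move=> ->; rewrite mulrAC.
have [_ M] := cycle_coef_spec theta factR_neq0 n.
rewrite (eq_bigr (fun=> n.-1`!%:R * \sum_(0 <= j < n) theta (n - j)%N / (n - j)%:R *
   ewens_norm theta j)); last first.
  move=> i _; rewrite M ?in_setT ?cardsT ?card_ord//; congr (_ * _).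
  by apply: eq_bigr => j _; rewrite ewens_normE.
rewrite sumr_const card_ord -[X in _ * X]mulr_natl mulrA -natrM.
have -> : (n * n.-1`! = n`!)%N by case: (n) n0 => // m _; rewrite factS.
by field; rewrite ?hn ?factR_neq0.
Qed.

End EwensMeasure.

Section ScaledWeights.
Variables (R : realType) (theta : nat -> R) (r vt : R).
Hypothesis theta0 : forall k, (0 < k)%N -> 0 < theta k.
Hypotheses (r0 : 0 < r) (vt0 : 0 < vt).
Hypothesis theta_cvg : eventually_close (fun k => theta k * r ^+ k) vt.

(** Both recursions are homogeneous, so they are satisfied by theta_k r^k and
    h_n r^n, without any change of the expectation. *)
Lemma expected_cycles_log : forall e, 0 < e -> exists N : nat, forall n, (N <= n)%N ->
  `|expected_cycles theta n - vt * ln n%:R| <= e * ln n%:R.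
Proof.
move=> e e0.
pose th k := theta k * r ^+ k; pose h k := ewens_norm theta k * r ^+ k.
have th0 k : (0 < k)%N -> 0 < th k by move=> k0; rewrite mulr_gt0 ?exprn_gt0// theta0.
have h0 : h 0%N = 1 by rewrite /h ewens_norm0 mulr1.
have h_rec n : (0 < n)%N -> n%:R * h n = \sum_(0 <= j < n) th (n - j)%N * h j.
  move=> n0; rewrite /h mulrA ewens_norm_rec// mulr_suml !big_nat.
  apply: eq_bigr => j /andP[_ jn]; rewrite /th mulrACA -exprD subnK//.
  exact: ltnW.
have [N HN] := renewal_expected_cycles th0 vt0 theta_cvg h0 h_rec e0.
exists (maxn 1 N) => n; rewrite geq_max => /andP[n0 nN].
have := HN n nN; congr (`|_ - _| <= _); rewrite expected_cyclesE//.
have rn : r ^+ n != 0 by rewrite expf_neq0// gt_eqF.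
have hn : ewens_norm theta n != 0 by rewrite gt_eqF// ewens_norm_gt0.
rewrite /h -[LHS]/(_ / (_ * _)) invfM mulrA mulrAC; congr (_ / _).
apply: (mulIf rn); rewrite divfK// mulr_suml !big_nat.
apply: eq_bigr => j /andP[_ jn]; rewrite /th.
have -> : r ^+ n = r ^+ (n - j) * r ^+ j by rewrite -exprD subnK// ltnW.
ring.
Qed.

End ScaledWeights.

(** * Eigenvalues of a permutation matrix *)

Section PermutationEigenvalues.
Local Close Scope classical_set_scope.
Import mathcomp.boot.fintype mathcomp.boot.finset.
Variables (R : realType) (N : nat) (s : 'S_N).
Local Notation C := (R[i]).

Let len (i : 'I_N) : nat := #|porbit s i|.
(* The base point depends on the cycle only, so that positions along it are
   consistent. *)
Let root (i : 'I_N) : 'I_N := odflt i [pick j in porbit s i].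
Let pos (i : 'I_N) : nat := index i (traject s (root i) (len i)).
Let angle (i : 'I_N) : C := circle_point ((pos i)%:R / (len i)%:R).

Lemma len_gt0 i : (0 < len i)%N.
Proof. by rewrite lt0n card_porbit_neq0. Qed.

Lemma root_in i : root i \in porbit s i.
Proof.
rewrite /root; case: pickP => [//|/(_ i)]; by rewrite porbit_id.
Qed.

Lemma porbit_root i : porbit s (root i) = porbit s i.
Proof. by apply/eqP; rewrite eq_porbit_mem root_in. Qed.

Lemma root_eq i j : porbit s i = porbit s j -> root i = root j.
Proof.
move=> ij; rewrite /root ij; case: pickP => [//|/(_ j)]; by rewrite porbit_id.
Qed.

Lemma mem_traject_root i : i \in traject s (root i) (len i).
Proof.
by rewrite /len -porbit_root -porbit_traject porbit_root porbit_id.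
Qed.

Lemma uniq_traject_root i : uniq (traject s (root i) (len i)).
Proof. by rewrite /len -porbit_root uniq_traject_porbit. Qed.

Lemma pos_lt i : (pos i < len i)%N.
Proof. by rewrite -[X in (_ < X)%N](size_traject s (root i)) index_mem mem_traject_root. Qed.

Lemma iter_pos i : iter (pos i) s (root i) = i.
Proof. by rewrite -(nth_traject s (pos_lt i)) nth_index// mem_traject_root. Qed.

Lemma porbit_iter k i : porbit s (iter k s i) = porbit s i.
Proof. by rewrite -permX porbit_perm. Qed.

Lemma pos_iter i k : (k < len i)%N -> pos (iter k s (root i)) = k.
Proof.
move=> kl; have e : porbit s (iter k s (root i)) = porbit s i by rewrite porbit_iter porbit_root.
by rewrite /pos (root_eq e) /len e -(nth_traject s kl) index_uniq ?size_traject// uniq_traject_root.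
Qed.

Lemma pos_inj i j : porbit s i = porbit s j -> pos i = pos j -> i = j.
Proof. by move=> ij pij; rewrite -(iter_pos i) -(iter_pos j) (root_eq ij) pij. Qed.

(** Along a cycle, the positions take each value below the length exactly once. *)
Lemma sum_pos (V : nmodType) i (f : nat -> V) :
  \sum_(k in porbit s i) f (pos k) = \sum_(0 <= j < len i) f j.
Proof.
rewrite (eq_bigl (mem (traject s (root i) (len i)))); last first.
  by move=> k; rewrite /len -porbit_root porbit_traject.
rewrite -big_uniq ?uniq_traject_root//=.
rewrite big_mkord.
have -> : traject s (root i) (len i) = [seq iter k s (root i) | k <- iota 0 (len i)].
  apply: (@eq_from_nth _ (root i)); first by rewrite size_map size_iota size_traject.
  move=> k; rewrite size_traject => kl.
  by rewrite (nth_map 0%N) ?size_iota// nth_iota// nth_traject.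
have -> : iota 0 (len i) = index_iota 0 (len i) by rewrite /index_iota subn0.
by rewrite big_map big_mkord; apply: eq_bigr => k _; rewrite pos_iter.
Qed.

Let unit_root (i : 'I_N) : C := circle_point (1 / (len i)%:R).

Lemma circle_pointE (x : R) : circle_point x = cexp (0 +i* (2 * pi * x)).
Proof. by rewrite /cexp /= expR0 !mul1r. Qed.

Lemma circle_pointX (x : R) n : circle_point x ^+ n = circle_point (n%:R * x).
Proof.
rewrite !circle_pointE cexpX; congr cexp.
rewrite -(rmorph_nat (real_complex R)).
by apply/eqP; rewrite eq_complex /=; apply/andP; split; apply/eqP; ring.
Qed.

Lemma circle_point_neq0 (x : R) : circle_point x != 0.
Proof. by rewrite circle_pointE cexp_neq0. Qed.

Lemma circle_point1 : circle_point (1 : R) = 1.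
Proof. by rewrite circle_pointE mulr1 cexp_2pi. Qed.

Lemma angleE i : angle i = unit_root i ^+ pos i.
Proof. by rewrite /angle /unit_root circle_pointX mulrA mulr1. Qed.

Lemma unit_root_len i : unit_root i ^+ len i = 1.
Proof.
rewrite /unit_root circle_pointX mulrA mulr1 divff ?circle_point1//.
by rewrite pnatr_eq0 -lt0n len_gt0.
Qed.

Lemma unit_root_neq1 i k : (0 < k < len i)%N -> unit_root i ^+ k != 1.
Proof.
move=> /andP[k0 kl]; rewrite /unit_root circle_pointX mulrA mulr1.
set x := _ / _; have len0 : 0 < (len i)%:R :> R by rewrite ltr0n len_gt0.
have x0 : 0 < x by rewrite divr_gt0// ltr0n.
have x1 : x < 1 by rewrite ltr_pdivrMr// mul1r ltr_nat.
have p0 := pi_gt0 R.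
apply/eqP => -[c1 _]; have : sin (pi * x) = 0.
  have : cos (2 * pi * x) = 1 - sin (pi * x) ^+ 2 *+ 2.
    by rewrite -mulrA mulr_natl cos_mulr2n cos2sin2 mulrnBl; ring.
  rewrite c1 => /eqP; rewrite -subr_eq0 opprB addrCA subrr addr0.
  by rewrite mulrn_eq0 /= sqrf_eq0 => /eqP.
have : 0 < sin (pi * x).
  by apply: sin_gt0_pi; rewrite mulr_gt0//= gtr_pMr.
by move=> h1 h2; rewrite h2 ltxx in h1.
Qed.

Lemma unit_root_inj i a b : (a < len i)%N -> (b < len i)%N ->
  unit_root i ^+ a = unit_root i ^+ b -> a = b.
Proof.
move=> al bl; wlog ab : a b al bl / (a <= b)%N => [H|].
  by case: (leqP a b) => [|/ltnW] h e; [exact: H|apply/esym; exact: H].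
rewrite -{1}(subnK ab) exprD -[LHS]mul1r => /(mulIf (expf_neq0 _ (circle_point_neq0 _))) e.
apply/eqP; rewrite eqn_leq ab /= -subn_eq0 -leqn0 leqNgt; apply/negP => h.
have := @unit_root_neq1 i (b - a); rewrite h (leq_ltn_trans (leq_subr _ _) bl) -e eqxx.
by move=> /(_ isT).
Qed.

Lemma unit_root_eq i j : porbit s i = porbit s j -> unit_root i = unit_root j.
Proof. by rewrite /unit_root /len => ->. Qed.

Lemma unit_root_step i j : porbit s i = porbit s j ->
  unit_root i ^+ pos (s j) = unit_root i ^+ (pos j).+1.
Proof.
move=> ij; have sj : porbit s (s j) = porbit s j by rewrite -(porbit_iter 1 j).
have e : s j = iter (pos j).+1 s (root j) by rewrite iterS iter_pos.
have [lt|ge] := ltnP (pos j).+1 (len j).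
  by rewrite e pos_iter.
have el : (pos j).+1 = len j by apply/eqP; rewrite eqn_leq ge pos_lt.
have -> : pos (s j) = 0%N.
  rewrite e el /len -porbit_root iter_porbit -[root j]/(iter 0 s (root j)) pos_iter//.
  exact: len_gt0.
by rewrite el expr0 (unit_root_eq ij) unit_root_len.
Qed.

Let V : 'M[C]_N := \matrix_(k, i)
  if porbit s k == porbit s i then (unit_root i ^+ (pos i * pos k))^-1 else 0.
Let W : 'M[C]_N := \matrix_(i, k)
  if porbit s k == porbit s i then unit_root i ^+ (pos i * pos k) / (len i)%:R else 0.

Lemma geometric_root0 (x : C) m : x ^+ m = 1 -> x != 1 -> \sum_(0 <= j < m) x ^+ j = 0.
Proof.
move=> xm x1; have := subrX1 x m; rewrite xm subrr -(big_mkord predT (fun j => x ^+ j)) => /esym/eqP.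
by rewrite mulf_eq0 subr_eq0 (negbTE x1) => /eqP.
Qed.

(** [V] and [W] are block-diagonal over the cycles, each block being the discrete
    Fourier transform of the cycle and its inverse. *)
Lemma eigenbasis_inverse : W *m V = 1%:M.
Proof.
apply/matrixP => i j; rewrite !mxE.
under eq_bigr do rewrite !mxE.
rewrite (bigID (fun k => k \in porbit s i)) /= [X in _ + X]big1 ?addr0; last first.
  by move=> k; rewrite -eq_porbit_mem => /negbTE ->; rewrite mul0r.
have [ij|ij] := eqVneq (porbit s i) (porbit s j); last first.
  rewrite big1.
    by rewrite (_ : (i == j) = false)//; apply/negP => /eqP ijE; rewrite ijE eqxx in ij.
  move=> k; rewrite -eq_porbit_mem => /eqP ki.
  by rewrite ki (negbTE ij) mulr0.
have li : (len i)%:R != 0 :> C by rewrite pnatr_eq0 -lt0n len_gt0.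
have w0 : unit_root i != 0 by exact: circle_point_neq0.
pose x := unit_root i ^+ pos i / unit_root i ^+ pos j.
rewrite (eq_bigr (fun k => x ^+ pos k / (len i)%:R)); last first.
  move=> k; rewrite -eq_porbit_mem => /eqP ki; rewrite ki eqxx ij eqxx.
  by rewrite -(unit_root_eq ij) mulrAC /x expr_div_n -!exprM.
rewrite -mulr_suml (sum_pos i (fun m => x ^+ m)).
have [pij|pij] := eqVneq (pos i) (pos j).
  have -> : i = j by exact: pos_inj.
  rewrite eqxx /x pij divff ?expf_neq0//.
  under eq_bigr do rewrite expr1n.
  by rewrite sumr_const_nat subn0 mulfV// pnatr_eq0 -lt0n len_gt0.
have ijN : (i == j) = false by apply: contraNF pij => /eqP ->.
rewrite ijN geometric_root0 ?mul0r//.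
  by rewrite /x expr_div_n -!exprM !(mulnC _ (len i)) !exprM unit_root_len !expr1n divr1.
apply: contraNneq pij => xE; apply/eqP/(@unit_root_inj i); rewrite ?pos_lt//.
  by rewrite /len ij pos_lt.
by move: xE; rewrite /x => /(canRL (divfK (expf_neq0 _ w0))); rewrite mul1r.
Qed.

Lemma eigenbasis_det : \det V != 0.
Proof.
have := congr1 determinant eigenbasis_inverse; rewrite det_mulmx det1 => h.
by apply: contra_eq_neq h => ->; rewrite mulr0 eq_sym oner_neq0.
Qed.

Lemma eigenbasis_eigen : permutation_matrix C s *m V = V *m diag_mx (\row_i angle i).
Proof.
apply/matrixP => k i; rewrite mul_mx_diag !mxE.
(* The only nonzero entry of row [k] is in the column of the preimage of [k]. *)
pose l := (s^-1)%g k; have kl : k = s l by rewrite /l permKV.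
rewrite (bigD1 l)//= !mxE kl eqxx mul1r big1 ?addr0; last first.
  by move=> j jl; rewrite !mxE (inj_eq (@perm_inj _ s)) eq_sym (negbTE jl) mul0r.
have sl : porbit s (s l) = porbit s l by rewrite -(porbit_iter 1 l).
rewrite sl; case: eqP => [li|]; last by rewrite mul0r.
have w0 : unit_root i != 0 by exact: circle_point_neq0.
rewrite angleE !(mulnC (pos i)) !exprM unit_root_step// -!exprM mulSn exprD invfM.
by rewrite mulrAC mulVf ?mul1r// expf_neq0.
Qed.

Lemma char_poly_permutation :
  char_poly (permutation_matrix C s) = \prod_i ('X - (angle i)%:P).
Proof.
have := char_poly_trig (diag_mx_is_trig (\row_i angle i)).
rewrite (eq_bigr (fun i => 'X - (angle i)%:P)); last by move=> i _; rewrite !mxE eqxx.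
move=> <-; rewrite /char_poly /char_poly_mx.
have V0 : \det (map_mx polyC V) != 0 by rewrite det_map_mx polyC_eq0 eigenbasis_det.
apply: (mulIf V0); rewrite -det_mulmx mulrC -det_mulmx; congr (\det _).
rewrite mulmxBl mulmxBr scalar_mxC; congr (_ - _).
by rewrite -!map_mxM eigenbasis_eigen.
Qed.

Lemma eigenvalues_permutation :
  perm_eq (eigenvalues (permutation_matrix C s)) [seq angle i | i <- enum 'I_N].
Proof.
apply: prod_XsubC_eq; rewrite big_map big_enum /= -char_poly_permutation.
rewrite /eigenvalues; case: closed_field_poly_normal => t /= e.
by rewrite [RHS]e (monicP (char_poly_monic _)) scale1r.
Qed.

Lemma trace_porbits (F : C -> C) : Tr F s =
  \sum_(c in porbits s) \sum_(0 <= j < #|c|) F (circle_point (j%:R / #|c|%:R)).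
Proof.
rewrite /Tr (perm_big _ eigenvalues_permutation) big_map big_enum /=.
rewrite (partition_big (porbit s) (mem (porbits s))) /=; last by move=> i _; exact: mem_porbits.
apply: eq_bigr => c /porbitsP[i ->].
rewrite -(sum_pos i (fun j => F (circle_point (j%:R / #|porbit s i|%:R)))).
apply: eq_big => [k|k /eqP ki]; first by rewrite eq_porbit_mem.
by rewrite /angle /len ki.
Qed.

End PermutationEigenvalues.

(** * Riemann sums of functions of bounded variation *)

Section RiemannSums.
Variable R : realType.
Notation mu := (@lebesgue_measure R).
Implicit Types (f p q : R -> R).

Let grid m j : R := j%:R / m%:R.

(** A function monotone on [0, 1] only is extended to a monotone function on the
    line by precomposition with the retraction onto [0, 1]. *)
Lemma monotone_integrable p : {in `[0, 1] &, nondecreasing_fun p} ->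
  mu.-integrable `[0, 1] (EFin \o p).
Proof.
move=> pn; pose clamp (x : R) := Num.max 0 (Num.min x 1).
have clampI x : clamp x \in `[0, 1].
  by rewrite in_itv /= le_max lexx /= ge_max ler01 ge_min lexx orbT.
have clampE x : x \in `[0, 1] -> clamp x = x.
  by rewrite in_itv /= => /andP[x0 x1]; rewrite /clamp min_l// max_r.
have clampn x y : x <= y -> clamp x <= clamp y.
  move=> xy; rewrite /clamp ge_max !le_max lexx /=; apply/orP; right.
  by rewrite le_min !ge_min xy lexx orbT.
have i1 : mu.-integrable `[0, 1] (EFin \o (p \o clamp)).
  apply: measurable_bounded_integrable => //.
  - by rewrite /= lebesgue_measure_itv /= lte_fin ltr01 oppr0 adde0 ltry.
  - by apply: nondecreasing_measurable => // x y xy; apply: pn => //; exact: clampn.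
  - exists (`|p 0| + `|p 1|); split; first exact: num_real.
    move=> M hM x /= _; rewrite (le_trans _ (ltW hM))//.
    have in0 : 0 \in `[0, 1 : R] by rewrite in_itv /= lexx ler01.
    have in1 : 1 \in `[0, 1 : R] by rewrite in_itv /= lexx ler01.
    have /andP[c0 c1] : 0 <= clamp x <= 1 by have := clampI x; rewrite in_itv.
    have h0 : p 0 <= p (clamp x) by exact: pn.
    have h1 : p (clamp x) <= p 1 by exact: pn.
    have n0 := ler_norm (- p 0); have n1 := ler_norm (p 1); rewrite normrN in n0.
    have a0 := normr_ge0 (p 0); have a1 := normr_ge0 (p 1).
    by rewrite ler_norml; apply/andP; split; lra.
by apply: eq_integrable i1 => // x; rewrite inE /= => xI; rewrite /= clampE.
Qed.

(** On each cell the integral lies between the values at the two ends; the sums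
    of left and right values differ by a telescoping sum. *)
Lemma monotone_riemann p m : {in `[0, 1] &, nondecreasing_fun p} -> (0 < m)%N ->
  \sum_(0 <= j < m) p (grid m j) <= m%:R * (\int[mu]_(x in `[0, 1]) p x)%R
    <= \sum_(0 <= j < m) p (grid m j) + (p 1 - p 0).
Proof.
move=> pn m0; have Ip := monotone_integrable pn.
have mR : 0 < m%:R :> R by rewrite ltr0n.
have g01 j : (j <= m)%N -> 0 <= grid m j <= 1.
  move=> jm; rewrite divr_ge0 ?(ltW mR)//= ler_pdivrMr// mul1r ler_nat.
  exact: jm.
have gS j : grid m j <= grid m j.+1 by rewrite ler_pM2r ?invr_gt0// ler_nat.
have gd j : grid m j.+1 - grid m j = m%:R^-1.
  by rewrite /grid -mulrBl -natrB// subSnn mul1r.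
have sub j : (j < m)%N -> mu.-integrable `[grid m j, grid m j.+1] (EFin \o p).
  move=> jm; apply: integrableS Ip => //; apply: subset_itv; rewrite bnd_simp.
    by have /andP[] := g01 j (ltnW jm).
  by have /andP[] := g01 j.+1 jm.
have cells k : (k <= m)%N -> (\int[mu]_(x in `[0%R, grid m k]) p x)%R =
    \sum_(0 <= j < k) (\int[mu]_(x in `[grid m j, grid m j.+1]) p x)%R.
  elim: k => [_|k IH km].
    by rewrite big_geq// /grid mul0r set_itv1 Rintegral_set1.
  rewrite big_nat_recr//= -IH ?(ltnW km)//; apply: Rint_cat.
    by rewrite gS andbT; have /andP[] := g01 k (ltnW km).
  apply: integrableS Ip => //; apply: subset_itv; rewrite bnd_simp//.
  by have /andP[] := g01 k.+1 km.
have -> : (\int[mu]_(x in `[0, 1]) p x)%R =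
    \sum_(0 <= j < m) (\int[mu]_(x in `[grid m j, grid m j.+1]) p x)%R.
  by rewrite -cells// /grid divff// gt_eqF.
have cst (c : R) j : (\int[mu]_(x in `[grid m j, grid m j.+1]) c)%R = c * m%:R^-1.
  rewrite Rintegral_cst//= lebesgue_measure_itv/= lte_fin.
  have -> : grid m j < grid m j.+1 by rewrite -subr_gt0 gd invr_gt0.
  by rewrite /= gd.
have Icst (c : R) j : mu.-integrable `[grid m j, grid m j.+1] (EFin \o (fun=> c)).
  by apply: continuous_compact_integrable; [exact: segment_compact|move=> x; exact: cvg_cst].
have lo j : (j < m)%N -> p (grid m j) <=
    m%:R * (\int[mu]_(x in `[grid m j, grid m j.+1]) p x)%R.
  move=> jm; rewrite -ler_pdivrMl// mulrC -(cst _ j).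
  apply: le_Rintegral (Icst _ j) (sub j jm) _ => // x /=; rewrite in_itv /= => /andP[x1 x2].
  have /andP[a1 a2] := g01 j (ltnW jm); have /andP[b1 b2] := g01 j.+1 jm.
  by apply: pn; rewrite ?in_itv /= ?a1 ?a2 ?(le_trans a1)// (le_trans x2).
have hi j : (j < m)%N ->
    m%:R * (\int[mu]_(x in `[grid m j, grid m j.+1]) p x)%R <= p (grid m j.+1).
  move=> jm; rewrite -ler_pdivlMl// mulrC -(cst _ j).
  apply: le_Rintegral (sub j jm) (Icst _ j) _ => // x /=; rewrite in_itv /= => /andP[x1 x2].
  have /andP[a1 a2] := g01 j (ltnW jm); have /andP[b1 b2] := g01 j.+1 jm.
  by apply: pn; rewrite ?in_itv /= ?b1 ?b2 ?(le_trans a1)// (le_trans x2).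
rewrite mulr_sumr; apply/andP; split.
  by rewrite !big_nat; apply: ler_sum => j /andP[_ jm]; exact: lo.
apply: (@le_trans _ _ (\sum_(0 <= j < m) p (grid m j.+1))).
  by rewrite !big_nat; apply: ler_sum => j /andP[_ jm]; exact: hi.
have := telescope_sumr (fun j => p (grid m j)) (leq0n m).
rewrite sumrB [grid m m]divff ?gt_eqF// /grid mul0r => <-.
by rewrite addrC subrK.
Qed.

Lemma bounded_variation_riemann f : bounded_variation 0 1 f ->
  exists2 V : R, 0 <= V &
    [/\ mu.-integrable `[0, 1] (EFin \o f),
        forall x, 0 <= x <= 1 -> `|f x| <= V &
        forall m, (0 < m)%N -> `|\sum_(0 <= j < m) f (grid m j) -
           m%:R * (\int[mu]_(x in `[0, 1]) f x)%R| <= V].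
Proof.
move=> bf; have bNf : bounded_variation 0 1 (\- f) by exact: bounded_variationN.
(* The Jordan decomposition. *)
pose p := fine \o pos_tv 0 f; pose q := fine \o neg_tv 0 f.
have pn : {in `[0, 1] &, nondecreasing_fun p} by exact: fine_neg_tv_nondecreasing bNf.
have qn : {in `[0, 1] &, nondecreasing_fun q} by exact: fine_neg_tv_nondecreasing bf.
have fE x : 0 <= x <= 1 -> f x = p x - q x.
  by move=> x01; rewrite (bounded_variation_pos_neg_tvE bf)// in_itv.
have Ip := monotone_integrable pn; have Iq := monotone_integrable qn.
have I01 : (\int[mu]_(x in `[0, 1]) f x)%R =
    (\int[mu]_(x in `[0, 1]) p x)%R - (\int[mu]_(x in `[0, 1]) q x)%R.
  rewrite -RintegralB//; apply: eq_Rintegral => x; rewrite inE /= in_itv /=.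
  exact: fE.
pose V := (p 1 - p 0) + (q 1 - q 0) + `|p 0| + `|q 0|.
have in0 : 0 \in `[0, 1 : R] by rewrite in_itv /= lexx ler01.
have in1 : 1 \in `[0, 1 : R] by rewrite in_itv /= lexx ler01.
have p01 : p 0 <= p 1 by apply: pn.
have q01 : q 0 <= q 1 by apply: qn.
have a0 := normr_ge0 (p 0); have b0 := normr_ge0 (q 0).
exists V; first by rewrite /V; lra.
split.
- apply: eq_integrable (integrableB _ Ip Iq) => // x.
  by rewrite inE /= in_itv /= => /fE ->; rewrite EFinB.
- move=> x x01; rewrite fE//; have xI : x \in `[0, 1] by rewrite in_itv.
  have /andP[x0 x1] := x01.
  have u1 : p 0 <= p x by apply: pn.
  have u2 : p x <= p 1 by apply: pn.
  have v1 : q 0 <= q x by apply: qn.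
  have v2 : q x <= q 1 by apply: qn.
  have c1 := ler_norm (p 0); have c2 := ler_norm (- p 0).
  have d1 := ler_norm (q 0); have d2 := ler_norm (- q 0).
  rewrite !normrN in c2 d2.
  by rewrite /V ler_norml; apply/andP; split; lra.
- move=> m m0.
  have -> : \sum_(0 <= j < m) f (grid m j) =
      \sum_(0 <= j < m) p (grid m j) - \sum_(0 <= j < m) q (grid m j).
    rewrite -sumrB !big_nat; apply: eq_bigr => j /andP[_ jm]; apply: fE.
    by rewrite divr_ge0//= ler_pdivrMr ?ltr0n// mul1r ler_nat ltnW.
  rewrite I01 mulrBr; have := monotone_riemann pn m0; have := monotone_riemann qn m0.
  move=> /andP[u1 u2] /andP[v1 v2]; rewrite /V ler_norml.
  by apply/andP; split; lra.
Qed.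

End RiemannSums.

(** * Moments of the trace *)

Section TraceDeviation.
Variables (R : realType) (F : R[i] -> R[i]).
Notation mu := (@lebesgue_measure R).

Lemma sum_zip_swap (T U : Type) (V : nmodType) (g : T -> U -> V) (s : seq T) (t : seq U) :
  \sum_(x <- zip s t) g x.1 x.2 = \sum_(x <- zip t s) g x.2 x.1.
Proof.
elim: s t => [|a s IH] [|b t]; rewrite ?big_nil//.
by rewrite /= !big_cons IH.
Qed.

(** Real and imaginary parts are 1-Lipschitz, so their variation is at most that
    of [F]. *)
Lemma circle_variation_component (g : R[i] -> R) :
  (forall z w, `|g z - g w| <= normc (z - w)) -> circle_bounded_variation F ->
  bounded_variation 0 1 (fun x => g (F (circle_point x))).
Proof.
move=> glip [V HV]; exists V => _ [s hs <-]; have := HV _ (ex_intro2 _ _ s hs erefl).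
apply: le_trans; rewrite variation_zip//.
rewrite (sum_zip_swap (fun x y => `|g (F (circle_point x)) - g (F (circle_point y))|)).
apply: ler_sum => -[x y] _ /=; exact: glip.
Qed.

Hypothesis hF : circle_bounded_variation F.

Lemma circle_riemann : exists2 V : R, 0 <= V &
  [/\ forall x, 0 <= x <= 1 -> normc (F (circle_point x)) <= V,
      normc (circle_integral F) <= V &
      forall m, (0 < m)%N ->
        normc (\sum_(0 <= j < m) F (circle_point (j%:R / m%:R)) - m%:R * circle_integral F) <= V].
Proof.
have bR : bounded_variation 0 1 (fun x => complex.Re (F (circle_point x))).
  apply: circle_variation_component hF => z w.
  by rewrite -ReN -ReD normc_ge_absRe.
have bI : bounded_variation 0 1 (fun x => complex.Im (F (circle_point x))).
  apply: circle_variation_component hF => z w.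
  by rewrite -ImN -ImD normc_ge_absIm.
have [V1 V10 [I1 B1 S1]] := bounded_variation_riemann bR.
have [V2 V20 [I2 B2 S2]] := bounded_variation_riemann bI.
exists (2 * (V1 + V2)); first by rewrite mulr_ge0 ?addr_ge0.
have bd x : 0 <= x <= 1 -> normc (F (circle_point x)) <= V1 + V2.
  by move=> hx; rewrite (le_trans (normc_le_ReIm _))// lerD// ?B1 ?B2.
split.
- by move=> x hx; rewrite (le_trans (bd x hx))// ler_peMl ?addr_ge0// ler1n.
- have := @cint_bound _ (fun x => F (circle_point x)) 0 1 (V1 + V2) ler01 (conj I1 I2) bd.
  by rewrite subr0 mulr1.
- move=> m m0; rewrite (le_trans (normc_le_ReIm _))//.
  have ReS (G : nat -> R[i]) : complex.Re (\sum_(0 <= j < m) G j) = \sum_(0 <= j < m) complex.Re (G j).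
    by elim/big_ind2 : _ => // z x w y <- <-; rewrite ReD.
  have ImS (G : nat -> R[i]) : complex.Im (\sum_(0 <= j < m) G j) = \sum_(0 <= j < m) complex.Im (G j).
    by elim/big_ind2 : _ => // z x w y <- <-; rewrite ImD.
  rewrite ReD ImD ReN ImN ReS ImS -(rmorph_nat (real_complex R)) ReM ImM /=.
  rewrite !mul0r subr0 addr0; have := S1 m m0; have := S2 m m0.
  lra.
Qed.

Lemma sum_card_porbits n (s : 'S_n) : (\sum_(c in porbits s) #|c|)%N = n.
Proof.
have := @sum_porbits nat _ s (fun=> 1%N); rewrite sum1_card card_ord => e.
rewrite [RHS]e; apply: eq_bigr => c _.
by rewrite -[RHS]mulr_natl mulr1 natn.
Qed.

(** The errors of the Riemann sums over the cycles are bounded by one and the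
    same constant, independently of the lengths. *)
Lemma trace_deviation : exists2 V : R, 0 <= V &
  normc (circle_integral F) <= V /\
  forall n (s : 'S_n), normc (Tr F s) <= V * n%:R /\
    normc (Tr F s - n%:R * circle_integral F) <= V * (total_cycles s)%:R.
Proof.
have [V V0 [B I S]] := circle_riemann; exists V => //; split=> // n s.
have nE (K : pzSemiRingType) : n%:R = \sum_(c in porbits s) #|c|%:R :> K.
  by rewrite -natr_sum sum_card_porbits.
rewrite trace_porbits; split.
  rewrite (le_trans (normc_sum _ _ _))// nE mulr_sumr.
  apply: ler_sum => c _; rewrite (le_trans (normc_sum _ _ _))//.
  rewrite (le_trans (_ : _ <= \sum_(0 <= j < #|c|) V))//; last first.
    by rewrite sumr_const_nat subn0 mulr_natr.
  rewrite !big_nat; apply: ler_sum => j /andP[_ jc]; apply: B.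
  rewrite divr_ge0//= ler_pdivrMr ?ltr0n ?(leq_ltn_trans _ jc)// mul1r ler_nat.
  exact: ltnW.
rewrite nE mulr_suml -sumrB.
rewrite (le_trans (normc_sum _ _ _))// /total_cycles -sum1_card natr_sum mulr_sumr.
apply: ler_sum => c cs; rewrite mulr1; apply: S.
exact: card_porbits_gt0 cs.
Qed.

Lemma normc_subX (V : R) d : 0 <= V -> exists2 D : R, 0 <= D &
  forall a b : R[i], normc a <= V -> normc b <= V ->
    normc (a ^+ d - b ^+ d) <= D * normc (a - b).
Proof.
move=> V0; elim: d => [|d [D D0 H]].
  by exists 0 => // a b _ _; rewrite !expr0 subrr normc0 mul0r.
exists (V * D + V ^+ d); first by rewrite addr_ge0 ?mulr_ge0 ?exprn_ge0.
move=> a b ha hb.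
have -> : a ^+ d.+1 - b ^+ d.+1 = a * (a ^+ d - b ^+ d) + b ^+ d * (a - b).
  by rewrite !exprS; ring.
rewrite (le_trans (normcD _ _))// !normcM mulrDl lerD//.
  by rewrite -mulrA ler_pM ?normc_ge0// H.
by rewrite ler_wpM2r ?normc_ge0// normcX lerXn2r ?nnegrE ?normc_ge0.
Qed.

(** [normc_subX] is applied to Tr F / n and the integral, both bounded by [V]. *)
Theorem trace_moment_deviation d : exists2 C : R, 0 <= C &
  forall theta : nat -> R, (forall k, (0 < k)%N -> 0 < theta k) ->
  forall n, (0 < n)%N ->
    `|(n%:R ^+ d)^-1 * trace_moment theta F d n - circle_integral F ^+ d|
      <= (C * (expected_cycles theta n / n%:R))%:C.
Proof.
have [V V0 [VI VT]] := trace_deviation; have [D D0 HD] := normc_subX d V0.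
exists (D * V); first exact: mulr_ge0.
move=> theta theta0 n n0; rewrite cabsE lecR.
have nR : 0 < n%:R :> R by rewrite ltr0n.
have nC : n%:R != 0 :> R[i] by rewrite pnatr_eq0 -lt0n.
have nn : normc (n%:R : R[i]) = n%:R by rewrite -(rmorph_nat (real_complex R)) normcR gtr0_norm.
pose X (s : 'S_n) := (Tr F s / n%:R) ^+ d - circle_integral F ^+ d.
have -> : (n%:R ^+ d)^-1 * trace_moment theta F d n - circle_integral F ^+ d =
    \sum_(s : 'S_n) (ewens_prob theta s)%:C * X s.
  rewrite /trace_moment /ewens_expectationC mulr_sumr.
  rewrite -[circle_integral F ^+ d]mul1r -[in X in _ - X](rmorph1 (real_complex R)).
  rewrite -(ewens_prob_sum theta0 n) rmorph_sum mulr_suml -sumrB.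
  apply: eq_bigr => s _; rewrite /X mulrBr; congr (_ - _).
  by rewrite expr_div_n mulrCA (mulrC (Tr F s ^+ d)).
rewrite (le_trans (normc_sum _ _ _))//.
rewrite /expected_cycles /ewens_expectation mulr_suml mulr_sumr.
apply: ler_sum => s _; rewrite normcM normcR ger0_norm ?ewens_prob_ge0//.
have [h1 h2] := VT n s.
have h3 : normc (X s) <= D * V * ((total_cycles s)%:R / n%:R).
  rewrite -mulrA; apply: le_trans (HD _ _ _ VI) _.
    by rewrite normcM normcV nn ler_pdivrMr.
  rewrite ler_wpM2l// mulrA ler_pdivlMr// -nn -normcM mulrBl divfK//.
  by rewrite [circle_integral F * _]mulrC.
rewrite (le_trans (ler_wpM2l (ewens_prob_ge0 theta0 s) h3))//.
by rewrite le_eqVlt; apply/orP; left; apply/eqP; ring.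
Qed.

End TraceDeviation.

(** * Moments and cycles under the generalized Ewens measure *)

Theorem theorem4p5 (R : realType) (F : R[i] -> R[i]) (d : nat)
    (hF : circle_bounded_variation F) :
  (exists C : R, exists N0 : nat,
     forall theta : nat -> R, (forall k, (0 < k)%N -> 0 < theta k) ->
     forall N : nat, (N0 <= N)%N ->
       `|(N%:R ^+ d)^-1 * trace_moment theta F d N - circle_integral F ^+ d|
         <= (C * (expected_cycles theta N / N%:R))%:C)
  /\
  (forall (theta : nat -> R), (forall k, (0 < k)%N -> 0 < theta k) ->
   forall (r vt gamma : R) (K : R[i]) (g : R[i] -> R[i]),
     0 < r -> 0 < vt -> 0 < gamma <= 1 ->
     is_g_Theta theta g ->
     class_F r vt K g \/ class_eF r vt gamma g ->
     ((fun N : nat => expected_cycles theta N : R^o)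
        ~_\oo (fun N : nat => vt * ln N%:R : R^o))
     /\ exists C : R, \forall N \near \oo,
          `|(N%:R ^+ d)^-1 * trace_moment theta F d N - circle_integral F ^+ d|
            <= (C * (ln N%:R / N%:R))%:C).
Proof.
have [C C0 dev] := trace_moment_deviation hF d.
split; first by exists C, 1%N => theta theta0 N; exact: dev.
move=> theta theta0 r vt gamma K g r0 vt0 /andP[gamma0 _] gt hg.
have theta_cvg : eventually_close (fun k => theta k * r ^+ k) vt.
  by case: hg; [exact: class_F_theta|exact: class_eF_theta].
have cycles := expected_cycles_log theta0 r0 vt0 theta_cvg.
have ln0 (n : nat) : (0 < n)%N -> 0 <= ln n%:R :> R by move=> n0; rewrite ln_ge0// ler1n.
split.
  apply/eqaddoP => e e0; have [N HN] := cycles _ (mulr_gt0 e0 vt0).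
  exists (maxn 1 N) => // n /=; rewrite geq_max => /andP[n0 nN].
  have := HN n nN; rewrite -mulrA [`|vt * _|]ger0_norm//.
  by rewrite mulr_ge0 ?ln0// ltW.
have [N HN] := cycles _ ltr01; exists (C * (vt + 1)).
exists (maxn 1 N) => // n /=; rewrite geq_max => /andP[n0 nN].
apply: le_trans (dev theta theta0 n n0) _; rewrite lecR -mulrA ler_wpM2l// mulrA.
rewrite ler_wpM2r ?invr_ge0//.
have := HN n nN; rewrite mul1r ler_norml => /andP[_].
by rewrite lerBlDr mulrDl mul1r addrC.
Qed.
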